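(* Let $k,m>0$, $q_0>0$, $r_0>0$ and put $n=\sqrt{4k+1}$. Consider the Sturm-Liouville problem in Liouville normal form $$\text{(N)}\qquad -\frac{d^2v}{dt^2}+\frac{k}{(t+m)^2}v=\lambda v,\quad 0<t<\pi,\qquad v(0)=0=v(\pi),$$ with constant potential function $q=q_0$ and constant density function $r=r_0$. Let $\tau=t+m$, $\overline\tau=\sqrt{|q_0/r_0|}\,\tau$, and $\overline\omega=\overline\omega_2=\sqrt{\overline\tau}\,Y_{n/2}(\overline\tau)$, where $Y_{n/2}$ is the Bessel function of the second kind. Assume that neither $\sqrt{|q_0/r_0|}\,m$ nor $\sqrt{|q_0/r_0|}\,(\pi+m)$ is a zero of $Y_{n/2}$. Then for every $x_1\in\mathbb R$, (N) has, asymptotically (to leading order as $\overline\tau\to\infty$), the canonical form $$-\frac d{dx}\left\{\pi^2q_0(x+x_1)^2\,Y^4_{n/2}\left[\pi\sqrt{|q_0r_0|}\,(x+x_1)\right]\frac{du}{dx}\right\}+q_0\,u=\lambda r_0\,u,\qquad a<x<b,$$ with Dirichlet boundary conditions $u(a)=0=u(b)$, where $$a=-x_1+\frac m{\pi r_0},\qquad b=-x_1+\frac{\pi+m}{\pi r_0},$$ $$\delta_0=\sqrt{\left|\frac{q_0}{r_0}\right|}\,m\,Y_{n/2}^2\left(\sqrt{\left|\frac{q_0}{r_0}\right|}\,m\right),\qquad \gamma_0=\sqrt{\left|\frac{q_0}{r_0}\right|}\,(\pi+m)\,Y_{n/2}^2\left(\sqrt{\left|\frac{q_0}{r_0}\r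ight|}\,(\pi+m)\right).$$
   Context: A canonical form is a problem $-(p\,u')'+q\,u=\lambda r\,u$ on $a<x<b$ with boundary conditions $\delta_0u(a)=0=\gamma_0u(b)$. It is produced from (N) by Liouville's transformation as follows: for given $q,r$ take a nonzero real solution $\overline\omega=1/w$ of $$\frac1{\overline\omega}\frac{d^2\overline\omega}{d\tau^2}+\frac qr=\frac k{\tau^2},$$ put $p=\overline\omega^{\,4}/r$ and $u=wv$, and let $x$ be determined by $\frac{dx}{d\tau}=\sqrt{p/r}=\overline\omega^{\,2}/r$, i.e. $x+x_1=F(\overline\tau)$. (Relations are understood where $\overline\omega\neq0$.) Boundary coefficients: $\delta_0=\overline\omega^{\,2}$ at $\tau=m$ ($t=0$), $\gamma_0=\overline\omega^{\,2}$ at $\tau=\pi+m$ ($t=\pi$); the conditions are Dirichlet when $\delta_0,\gamma_0\neq0$. ''Asymptotically, to leading order as $\overline\tau\to\infty$'' means: the exact relation $x+x_1=F(\overline\tau)$ is replaced by $x+x_1=F_{\mathrm{lead}}(\overline\tau)$, where $F_{\mathrm{lead}}$ is the leading (linear) term of $F$, so $F(\overline\tau)/F_{\mathrm{lead}}(\overline\tau)\to1$ as $\overline\tau\to\infty$. The function $p$ is expressed in $x$, and the endpoints $a,b$ corresponding to $\tau=m,\pi+m$ are computed, by means of this leading-order relation. *)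

(* Defs.v *)
From Stdlib Require Import Factorial Reals.
From Coquelicot Require Import Coquelicot.
Open Scope R_scope.

(* Gauss' product for 1/Gamma(z); it is 0 at the poles z = 0, -1, -2, ... *)
Definition inv_gamma (z : R) : R :=
  real (Lim_seq (fun n =>
    prod_f_R0 (fun j => z + INR j) n / (INR (fact n) * Rpower (INR n) z))).

(* Only meant for x > 0, as is [bessel_Y]. *)
Definition bessel_J (nu x : R) : R :=
  Rpower (x / 2) nu *
  Series (fun j =>
    (-1) ^ j / INR (fact j) * inv_gamma (nu + INR j + 1) * (x / 2) ^ (2 * j)).

Definition weber_quotient (x mu : R) : R :=
  (bessel_J mu x * cos (mu * PI) - bessel_J (- mu) x) / sin (mu * PI).

(* At integer order the quotient is 0/0 and Y is its limit in the order. *)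
Definition bessel_Y (nu x : R) : R :=
  if Req_EM_T (sin (nu * PI)) 0
  then real (Lim (weber_quotient x) nu)
  else weber_quotient x nu.

(* The problem  - (p u')' + q u = lam r u  on  lo < x < hi,
   with  bc_lo * u(lo) = 0 = bc_hi * u(hi). *)
Record sl_problem := SL {
  sl_p : R -> R;
  sl_q : R -> R;
  sl_r : R -> R;
  sl_lo : R;
  sl_hi : R;
  bc_lo : R;
  bc_hi : R
}.

Definition sl_equation (P : sl_problem) (lam : R) (u : R -> R) (x : R) : Prop :=
  locally x (fun y => ex_derive u y) /\
  ex_derive (fun y => sl_p P y * Derive u y) x /\
  - Derive (fun y => sl_p P y * Derive u y) x + sl_q P x * u x
    = lam * sl_r P x * u x.

Definition sl_bc_lo (P : sl_problem) (u : R -> R) : Prop :=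
  bc_lo P * u (sl_lo P) = 0.

Definition sl_bc_hi (P : sl_problem) (u : R -> R) : Prop :=
  bc_hi P * u (sl_hi P) = 0.

Definition dirichlet (P : sl_problem) : Prop :=
  bc_lo P <> 0 /\ bc_hi P <> 0.

Definition normal_form (k m : R) : sl_problem :=
  SL (fun _ => 1) (fun t => k / (t + m) ^ 2) (fun _ => 1) 0 PI 1 1.

(* From here on q, r and omega are functions of tau = t + m, and omega = 1/w.
   The equation for omega is imposed only where omega <> 0. *)
Definition omega_solution (k : R) (q r omega : R -> R) : Prop :=
  (forall tau, 0 < tau -> ex_derive omega tau /\ ex_derive (Derive omega) tau) /\
  (exists tau, 0 < tau /\ omega tau <> 0) /\
  (forall tau, 0 < tau -> omega tau <> 0 ->
     / omega tau * Derive_n omega 2 tau + q tau / r tau = k / tau ^ 2).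

(* dx/dtau = sqrt (p/r) = omega^2/r  for  x + x1 = F (s * tau). *)
Definition exact_relation (r omega : R -> R) (s : R) (F : R -> R) : Prop :=
  forall tau, 0 < tau ->
    is_derive (fun tau' => F (s * tau')) tau (omega tau ^ 2 / r tau).

(* P is the problem obtained when tau is exchanged for x through the relation
   x + x1 = G (s * tau), exact or approximate. *)
Definition expressed_through (m : R) (q r omega : R -> R) (s x1 : R)
    (G : R -> R) (P : sl_problem) : Prop :=
  let x tau := - x1 + G (s * tau) in
  (forall tau, m <= tau <= PI + m ->
     sl_p P (x tau) = omega tau ^ 4 / r tau /\
     sl_q P (x tau) = q tau /\
     sl_r P (x tau) = r tau) /\
  sl_lo P = x m /\
  sl_hi P = x (PI + m) /\
  bc_lo P = omega m ^ 2 /\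
  bc_hi P = omega (PI + m) ^ 2.

(* Under u = w v the normal form and P are the same problem, wherever
   omega <> 0. *)
Definition liouville_equivalent (k m : R) (omega : R -> R) (s x1 : R)
    (F : R -> R) (P : sl_problem) : Prop :=
  let x tau := - x1 + F (s * tau) in
  forall (lam : R) (v u : R -> R),
    (forall tau, m <= tau <= PI + m -> omega tau <> 0 ->
       u (x tau) = / omega tau * v (tau - m)) ->
    (forall tau, m < tau < PI + m -> omega tau <> 0 ->
       (sl_equation (normal_form k m) lam v (tau - m) <->
        sl_equation P lam u (x tau))) /\
    (omega m <> 0 -> (sl_bc_lo (normal_form k m) v <-> sl_bc_lo P u)) /\
    (omega (PI + m) <> 0 -> (sl_bc_hi (normal_form k m) v <-> sl_bc_hi P u)).

Definition exact_canonical_form (k m : R) (q r omega : R -> R) (s x1 : R)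
    (F : R -> R) (P : sl_problem) : Prop :=
  omega_solution k q r omega /\
  exact_relation r omega s F /\
  expressed_through m q r omega s x1 F P /\
  liouville_equivalent k m omega s x1 F P.

(* F is replaced by its leading term c * y as y = s * tau -> oo. *)
Definition asymptotic_canonical_form (k m : R) (q r omega : R -> R) (s x1 : R)
    (P : sl_problem) : Prop :=
  exists (F : R -> R) (E : sl_problem) (c : R),
    exact_canonical_form k m q r omega s x1 F E /\
    c <> 0 /\
    is_lim (fun y => F y / (c * y)) p_infty 1 /\
    expressed_through m q r omega s x1 (fun y => c * y) P.

(* Main.v *)
Require Import Defs.
From Stdlib Require Import Reals Arith Lra Lia ClassicalEpsilon.
From Coquelicot Require Import Coquelicot.
Open Scope R_scope.

(* Everything reduces to two facts about omega(y) = sqrt y * Y_nu(y), nu = n/2: it solves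
   omega'' = (k/y^2 - 1) omega, and omega^2 + omega'^2 tends to 2/pi.  The second one makes
   the mean of omega^2 tend to 1/pi, which is the constant c = 1/(pi r0 s).

   Asymptotics of J_nu, every real nu: for nu >= 2 the transform
   K(p) = int e^{-pt} t^nu J_nu(t) dt satisfies (1 + p^2) K' = -(2 nu + 1) p K.  Along
   p = e + i it is solved explicitly; its constant is read off as e -> oo from the power series
   at 0, and the limit e -> 0 gives, by an Abelian argument, amplitude and phase of
   sqrt t * J_nu(t) at infinity.  Gauss' product is matched with Euler's integral by the
   Bohr-Mollerup argument, and the constant simplifies by the duplication formula.
   The recurrence in nu carries the result down to all orders.

   For non-integer order Y_nu is a combination of J_nu and J_(-nu).  At integer order the
   defining limit is handled from infinity: the asymptotic data of sqrt x * Y_mu(x) are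
   continuous in mu, and a Gronwall estimate started at infinity makes the sequence defining
   Y_nu uniformly Cauchy on [x0, oo) together with its derivatives, so no differentiation
   in the order is needed. *)

(** The order n/2 is an integer for some k > 0 (k = 3/4 gives order 1), so the limiting definition
    of Y cannot be bypassed. The differential equation shows that omega^2 + omega'^2 has a limit but
    not which one: the normalisation of J_nu is fixed at 0, so a connection problem between 0 and
    infinity has to be solved. The Laplace transform does it because K(p) is a constant times (1 +
    p^2)^(-nu - 1/2): its decay as p -> oo sees the power series at 0, while the strength of its
    singularity at p = i sees the oscillation of t^(nu - 1/2) e^(it) at infinity. Although only 2/pi
    is used in the end, the phase of J_nu is needed too, since the size of a combination of J_nu and
    J_(-nu) depends on their relative phase. The bound nu >= 2 keeps the powers of t involved, down
    to t^(nu - 3/2), continuous at 0. The mean of omega^2 is half the limit of omega^2 + omega'^2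
    because 2 omega^2 differs from that sum by the derivative of a bounded function and a term
    O(1/y^2). *)

(** * Monotonicity, limits at infinity, and a Gronwall inequality with weight 1/x^2 *)

(** [auto_derive] leaves unknown derivatives as [Derive] of an eta-expanded function; this form
    rewrites them. *)
Lemma Derive_eta (f : R -> R) (x l : R) :
  is_derive f x l -> Derive (fun y : R => f y) x = l.
Proof. exact (is_derive_unique f x l). Qed.

Lemma nondecreasing_of_derive (f df : R -> R) (a b : R) :
  a <= b ->
  (forall x, a <= x <= b -> is_derive f x (df x)) ->
  (forall x, a <= x <= b -> 0 <= df x) ->
  f a <= f b.
Proof.
  intros Hab Hd Hp.
  destruct (MVT_gen f a b df) as [c [Hc E]].
  - intros x Hx; rewrite Rmin_left, Rmax_right in Hx by lra; apply Hd; lra.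
  - intros x Hx; rewrite Rmin_left, Rmax_right in Hx by lra.
    apply continuity_pt_filterlim, @ex_derive_continuous.
    exists (df x); apply Hd; lra.
  - rewrite Rmin_left, Rmax_right in Hc by lra.
    specialize (Hp c Hc); nra.
Qed.

Lemma is_lim_nondecreasing (f : R -> R) (x0 M : R) :
  (forall x y, x0 <= x -> x <= y -> f x <= f y) ->
  (forall x, x0 <= x -> f x <= M) ->
  exists l : R, is_lim f p_infty l /\ l <= M /\ forall x, x0 <= x -> f x <= l.
Proof.
  intros Hm Hb.
  destruct (completeness (fun v => exists x, x0 <= x /\ v = f x)) as [l [Hu Hl]].
  - exists M; intros v [x [Hx ->]]; auto.
  - exists (f x0), x0; split; [lra|reflexivity].
  - exists l; repeat split.
    + intros P [eps HP].
      destruct (Classical_Prop.classic (exists x, x0 <= x /\ l - eps < f x))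
        as [[x [Hx Hfx]]|Hn].
      * exists x; intros y Hy; apply HP.
        assert (f x <= f y) by (apply Hm; lra).
        assert (f y <= l) by (apply Hu; exists y; split; [lra|reflexivity]).
        pose proof (cond_pos eps).
        change (Rabs (f y - l) < eps); apply Rabs_def1; lra.
      * exfalso; pose proof (cond_pos eps).
        assert (l <= l - eps); [|lra].
        apply Hl; intros v [x [Hx ->]].
        destruct (Rle_lt_dec (f x) (l - eps)); [assumption|].
        exfalso; apply Hn; exists x; auto.
    + apply Hl; intros v [x [Hx ->]]; auto.
    + intros x Hx; apply Hu; exists x; auto.
Qed.

Lemma is_lim_p_infty_le (f g : R -> R) (x0 a b : R) :
  is_lim f p_infty a -> is_lim g p_infty b ->
  (forall x, x0 < x -> f x <= g x) -> a <= b.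
Proof.
  intros Hf Hg H.
  apply (is_lim_le_loc f g p_infty a b); [|exact Hf|exact Hg].
  exists x0; exact H.
Qed.

(** Since (c/t)' = -c/t^2, the function P - c/t increases and P + c/t decreases. Their common limit
    is the limit of P, and the gap c/x is the rate. *)
Lemma is_lim_of_derive_inv_sqr (P dP : R -> R) (c x0 : R) :
  0 < x0 ->
  (forall x, x0 <= x -> is_derive P x (dP x)) ->
  (forall x, x0 <= x -> Rabs (dP x) <= c / x ^ 2) ->
  exists l : R, is_lim P p_infty l /\
    forall x, x0 <= x -> Rabs (P x - l) <= c / x.
Proof.
  intros H0 Hd Hb.
  assert (Hc : 0 <= c).
  { specialize (Hb x0 (Rle_refl _)).
    pose proof (Rabs_pos (dP x0)).
    assert (0 < x0 ^ 2) by nra.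
    apply (Rmult_le_reg_r (/ x0 ^ 2)); [apply Rinv_0_lt_compat; lra|].
    unfold Rdiv in Hb; lra. }
  assert (Hlo : forall x y, x0 <= x -> x <= y -> P x - c / x <= P y - c / y).
  { intros x y Hx Hy.
    apply (nondecreasing_of_derive (fun t => P t - c / t)
             (fun t => dP t + c / t ^ 2)); [exact Hy| |].
    - intros t Ht. specialize (Hd t ltac:(lra)).
      auto_derive; [split; [exists (dP t); exact Hd | split; [lra|exact I]]|].
      rewrite (Derive_eta _ _ _ Hd); unfold Rdiv; field; lra.
    - intros t Ht. specialize (Hb t ltac:(lra)).
      apply Rabs_le_between in Hb; lra. }
  assert (Hhi : forall x y, x0 <= x -> x <= y -> P y + c / y <= P x + c / x).
  { intros x y Hx Hy.
    cut (- (P x + c / x) <= - (P y + c / y)); [lra|].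
    apply (nondecreasing_of_derive (fun t => - (P t + c / t))
             (fun t => - dP t + c / t ^ 2)); [exact Hy| |].
    - intros t Ht. specialize (Hd t ltac:(lra)).
      auto_derive; [split; [exists (dP t); exact Hd | split; [lra|exact I]]|].
      rewrite (Derive_eta _ _ _ Hd); unfold Rdiv; field; lra.
    - intros t Ht. specialize (Hb t ltac:(lra)).
      apply Rabs_le_between in Hb; lra. }
  assert (Hpos : forall x, x0 <= x -> 0 <= c / x).
  { intros x Hx; apply Rmult_le_pos; [lra|].
    apply Rlt_le, Rinv_0_lt_compat; lra. }
  destruct (is_lim_nondecreasing (fun t => P t - c / t) x0 (P x0 + c / x0) Hlo)
    as [l [Hl [_ Hle]]].
  { intros x Hx. pose proof (Hhi x0 x (Rle_refl _) Hx). specialize (Hpos x Hx). lra. }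
  assert (HP : is_lim P p_infty l).
  { apply is_lim_ext_loc with (fun t => (P t - c / t) + c * / t).
    - exists x0; intros x Hx; field; lra.
    - replace l with (l + c * 0) by ring.
      apply (is_lim_plus' _ _ p_infty l (c * 0)); [exact Hl|].
      apply (is_lim_scal_l _ c p_infty 0).
      apply (is_lim_inv (fun t => t) p_infty p_infty); [apply is_lim_id|discriminate]. }
  exists l; split; [exact HP|].
  intros x Hx. apply Rabs_le_between. split.
  - assert (l <= P x + c / x); [|lra].
    apply (is_lim_p_infty_le P (fun _ => P x + c / x) x);
      [exact HP|apply is_lim_const|].
    intros y Hy.
    pose proof (Hhi x y Hx ltac:(lra)). specialize (Hpos y ltac:(lra)). lra.
  - specialize (Hle x Hx); lra.
Qed.

(** The integrating factors are e^(kap/t) and e^(-kap/t): the hypothesis makes W e^(kap/t) decrease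
    and W e^(-kap/t) increase. *)
Lemma gronwall_inv_sqr (W dW : R -> R) (kap x y : R) :
  0 < x <= y ->
  (forall t, x <= t <= y -> is_derive W t (dW t)) ->
  (forall t, x <= t <= y -> Rabs (dW t) <= kap / t ^ 2 * W t) ->
  W y * exp (kap / y) <= W x * exp (kap / x) /\
  W x * exp (- kap / x) <= W y * exp (- kap / y).
Proof.
  intros Hxy Hd Hb; split.
  - cut (- (W x * exp (kap / x)) <= - (W y * exp (kap / y))); [lra|].
    apply (nondecreasing_of_derive (fun t => - (W t * exp (kap / t)))
      (fun t => (kap / t ^ 2 * W t - dW t) * exp (kap / t))); [lra| |].
    + intros t Ht; specialize (Hd t Ht).
      auto_derive; [split; [exists (dW t); exact Hd | split; [lra|exact I]]|].
      rewrite (Derive_eta _ _ _ Hd); unfold Rdiv; field; lra.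
    + intros t Ht; specialize (Hb t Ht); apply Rabs_le_between in Hb.
      apply Rmult_le_pos; [lra|apply Rlt_le, exp_pos].
  - apply (nondecreasing_of_derive (fun t => W t * exp (- kap / t))
      (fun t => (kap / t ^ 2 * W t + dW t) * exp (- kap / t))); [lra| |].
    + intros t Ht; specialize (Hd t Ht).
      auto_derive; [split; [exists (dW t); exact Hd | split; [lra|exact I]]|].
      rewrite (Derive_eta _ _ _ Hd); unfold Rdiv; field; lra.
    + intros t Ht; specialize (Hb t Ht); apply Rabs_le_between in Hb.
      apply Rmult_le_pos; [lra|apply Rlt_le, exp_pos].
Qed.

Lemma is_lim_div_p_infty (c : R) : is_lim (fun x => c / x) p_infty 0.
Proof.
  replace (Finite 0) with (Rbar_mult c 0) by (simpl; f_equal; ring).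
  apply (is_lim_scal_l (fun x => / x) c p_infty 0).
  apply (is_lim_inv (fun t => t) p_infty p_infty); [apply is_lim_id|discriminate].
Qed.

Lemma is_lim_exp_div_p_infty (c : R) : is_lim (fun x => exp (c / x)) p_infty 1.
Proof.
  rewrite <- exp_0.
  apply (is_lim_comp_continuous (fun x => c / x) exp p_infty 0);
    [apply is_lim_div_p_infty|].
  apply continuity_pt_filterlim, derivable_continuous, derivable_exp.
Qed.

(** The weight 1/t^2 is integrable at infinity, so the integrating factors tend to 1 and the
    estimate can be started at infinity: the limit of W controls W all the way down to x0. *)
Lemma gronwall_inv_sqr_lim (W dW : R -> R) (kap x0 L : R) :
  0 < x0 ->
  (forall t, x0 <= t -> is_derive W t (dW t)) ->
  (forall t, x0 <= t -> Rabs (dW t) <= kap / t ^ 2 * W t) ->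
  is_lim W p_infty L ->
  forall x, x0 <= x -> L * exp (- kap / x) <= W x <= L * exp (kap / x).
Proof.
  intros H0 Hd Hb HL x Hx.
  assert (G : forall y, x <= y ->
    W y * exp (kap / y) <= W x * exp (kap / x) /\
    W x * exp (- kap / x) <= W y * exp (- kap / y)).
  { intros y Hy; apply (gronwall_inv_sqr W dW); [lra| |]; intros t Ht;
      [apply Hd|apply Hb]; lra. }
  assert (E : exp (kap / x) * exp (- kap / x) = 1).
  { rewrite <- exp_plus; replace (kap / x + - kap / x) with 0 by (field; lra).
    apply exp_0. }
  pose proof (exp_pos (kap / x)) as P1. pose proof (exp_pos (- kap / x)) as P2.
  assert (L1 : L <= W x * exp (kap / x)).
  { apply (is_lim_p_infty_le (fun y => W y * exp (kap / y))
             (fun _ => W x * exp (kap / x)) x).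
    - replace (Finite L) with (Rbar_mult L 1) by (simpl; f_equal; ring).
      apply is_lim_mult; [exact HL|apply is_lim_exp_div_p_infty|exact I].
    - apply is_lim_const.
    - intros y Hy; apply G; lra. }
  assert (L2 : W x * exp (- kap / x) <= L).
  { apply (is_lim_p_infty_le (fun _ => W x * exp (- kap / x))
             (fun y => W y * exp (- kap / y)) x).
    - apply is_lim_const.
    - replace (Finite L) with (Rbar_mult L 1) by (simpl; f_equal; ring).
      apply is_lim_mult; [exact HL|apply is_lim_exp_div_p_infty|exact I].
    - intros y Hy; apply G; lra. }
  split.
  - apply (Rmult_le_reg_r (exp (kap / x))); [exact P1|].
    rewrite Rmult_assoc, (Rmult_comm (exp (- kap / x))), E; lra.
  - apply (Rmult_le_reg_r (exp (- kap / x))); [exact P2|].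
    rewrite (Rmult_assoc L), E; lra.
Qed.

Lemma exp_le (x y : R) : x <= y -> exp x <= exp y.
Proof.
  intros H; destruct (Req_dec x y) as [->|]; [lra|apply Rlt_le, exp_increasing; lra].
Qed.

Lemma is_lim_squeeze_div (f : R -> R) (l C : R) :
  (forall x, 1 <= x -> Rabs (f x - l) <= C / x) -> is_lim f p_infty l.
Proof.
  intros H. pose proof (is_lim_div_p_infty C) as L0.
  apply (is_lim_le_le_loc (fun x => l - C / x) (fun x => l + C / x)).
  - exists 1; intros x Hx; specialize (H x ltac:(lra)); apply Rabs_le_between in H; lra.
  - replace l with (l - 0) at 1 by ring.
    apply (is_lim_minus' _ _ p_infty l 0); [apply is_lim_const|exact L0].
  - replace l with (l + 0) at 1 by ring.
    apply (is_lim_plus' _ _ p_infty l 0); [apply is_lim_const|exact L0].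
Qed.

Lemma is_lim_scal_rotation (a b c s r : R -> R) (la lb lc ls lr : R) :
  is_lim a p_infty la -> is_lim b p_infty lb -> is_lim c p_infty lc ->
  is_lim s p_infty ls -> is_lim r p_infty lr ->
  is_lim (fun x => (a x * c x - b x * s x) * r x) p_infty ((la * lc - lb * ls) * lr) /\
  is_lim (fun x => (b x * c x + a x * s x) * r x) p_infty ((lb * lc + la * ls) * lr).
Proof.
  intros Ha Hb Hc Hs Hr.
  assert (M : forall (f g : R -> R) (lf lg : R), is_lim f p_infty lf ->
            is_lim g p_infty lg -> is_lim (fun x => f x * g x) p_infty (lf * lg))
    by (intros f g lf lg Hf Hg; exact (is_lim_mult f g p_infty lf lg Hf Hg I)).
  split; apply M; try assumption;
    [apply (is_lim_minus' _ _ p_infty (la * lc) (lb * ls))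
    |apply (is_lim_plus' _ _ p_infty (lb * lc) (la * ls))]; apply M; assumption.
Qed.

(** * Laplace transforms *)

(* Coquelicot often states real equations in the carrier of a normed module. *)
Ltac eqR := match goal with |- @eq _ ?a ?b => change (@eq R a b) end.

Lemma continuity_continuous (f : R -> R) :
  continuity f -> forall t, continuous f t.
Proof. intros H t; apply continuity_pt_filterlim, H. Qed.

Lemma continuity_of_derive (f df : R -> R) :
  (forall t, is_derive f t (df t)) -> continuity f.
Proof.
  intros H t; apply continuity_pt_filterlim, @ex_derive_continuous.
  exists (df t); apply H.
Qed.

Lemma cont_mult (f g : R -> R) :
  continuity f -> continuity g -> continuity (fun t => f t * g t).
Proof. exact (continuity_mult f g). Qed.

Lemma cont_plus (f g : R -> R) :
  continuity f -> continuity g -> continuity (fun t => f t + g t).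
Proof. exact (continuity_plus f g). Qed.

Lemma cont_minus (f g : R -> R) :
  continuity f -> continuity g -> continuity (fun t => f t - g t).
Proof. exact (continuity_minus f g). Qed.

Lemma cont_opp (f : R -> R) : continuity f -> continuity (fun t => - f t).
Proof. exact (continuity_opp f). Qed.

Lemma cont_const (c : R) : continuity (fun _ => c).
Proof. apply continuity_const; intros x y; reflexivity. Qed.

Lemma cont_id : continuity (fun t => t).
Proof. exact (derivable_continuous _ derivable_id). Qed.

Lemma cont_comp (f g : R -> R) :
  continuity f -> continuity g -> continuity (fun t => f (g t)).
Proof. intros Hf Hg; exact (continuity_comp g f Hg Hf). Qed.

Lemma cont_exp : continuity exp.
Proof. exact (derivable_continuous _ derivable_exp). Qed.

Lemma cont_abs (f : R -> R) : continuity f -> continuity (fun t => Rabs (f t)).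
Proof. intros H; apply (cont_comp Rabs f); [exact Rcontinuity_abs|exact H]. Qed.

Create HintDb cont.
#[local] Hint Resolve cont_mult cont_plus cont_minus cont_opp cont_const cont_id
  cont_exp cont_abs continuity_sin continuity_cos : cont.

Lemma cont_exp_lin (c : R) : continuity (fun t => exp (- (c * t))).
Proof. apply (cont_comp exp); auto with cont. Qed.
#[local] Hint Resolve cont_exp_lin : cont.

Lemma ex_RInt_cont (f : R -> R) (a b : R) : continuity f -> ex_RInt f a b.
Proof.
  intros H; apply (@ex_RInt_continuous R_CompleteNormedModule); intros t _.
  apply continuity_continuous, H.
Qed.

(* [Rpower 0 a] is [1] in the library; cut off at [t <= 0], the power is continuous on R
   for [0 < a]. *)
Definition pw (a t : R) : R := if Rle_dec t 0 then 0 else Rpower t a.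

Lemma pw_pos (a t : R) : 0 < t -> pw a t = Rpower t a.
Proof. intros H; unfold pw; destruct (Rle_dec t 0); [lra|reflexivity]. Qed.

Lemma pw_nonpos (a t : R) : t <= 0 -> pw a t = 0.
Proof. intros H; unfold pw; destruct (Rle_dec t 0); [reflexivity|lra]. Qed.

Lemma Rpower_pos (t a : R) : 0 < Rpower t a.
Proof. apply exp_pos. Qed.

Lemma pw_ge0 (a t : R) : 0 <= pw a t.
Proof.
  unfold pw; destruct (Rle_dec t 0); [lra|apply Rlt_le, Rpower_pos].
Qed.

Lemma pw_1 (t : R) : 0 <= t -> pw 1 t = t.
Proof.
  intros H; destruct (Req_dec t 0) as [->|H0]; [apply pw_nonpos; lra|].
  rewrite pw_pos by lra; apply Rpower_1; lra.
Qed.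

Lemma pw_mult (a t : R) : t * pw a t = pw (a + 1) t.
Proof.
  destruct (Rle_dec t 0).
  - rewrite !pw_nonpos by lra; ring.
  - rewrite !pw_pos by lra. rewrite Rpower_plus, Rpower_1 by lra; ring.
Qed.

Lemma Rpower_Rinv_exponent (e a : R) : 0 < a -> 0 < e -> Rpower (Rpower e (/ a)) a = e.
Proof.
  intros Ha He; rewrite Rpower_mult, Rinv_l, Rpower_1 by lra; reflexivity.
Qed.

Lemma cont_pw (a : R) : 0 < a -> continuity (pw a).
Proof.
  intros Ha t.
  destruct (Rtotal_order t 0) as [Ht|[->|Ht]].
  - apply continuity_pt_filterlim.
    apply (continuous_ext_loc (pw a) (fun _ : R => 0) t).
    + assert (H : 0 < - t) by lra.
      exists (mkposreal _ H); intros y Hy.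
      change (Rabs (y - t) < - t) in Hy; apply Rabs_def2 in Hy.
      rewrite pw_nonpos by lra; reflexivity.
    + apply continuous_const.
  - intros eps Heps.
    exists (Rpower eps (/ a)); split; [apply Rpower_pos|].
    intros x [_ Hx]. simpl in *; unfold Rdist in *.
    rewrite (pw_nonpos a 0), Rminus_0_r in * by lra.
    rewrite Rabs_pos_eq by apply pw_ge0.
    destruct (Rle_dec x 0).
    + rewrite pw_nonpos by lra; lra.
    + rewrite pw_pos by lra; rewrite Rabs_pos_eq in Hx by lra.
      rewrite <- (Rpower_Rinv_exponent eps a) by lra.
      apply Rlt_Rpower_l; lra.
  - apply continuity_pt_filterlim.
    apply (continuous_ext_loc (pw a) (fun x : R => Rpower x a) t).
    + exists (mkposreal _ Ht); intros y Hy.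
      change (Rabs (y - t) < t) in Hy; apply Rabs_def2 in Hy.
      rewrite pw_pos by lra; reflexivity.
    + apply @ex_derive_continuous; unfold Rpower; auto_derive; lra.
Qed.
#[local] Hint Extern 3 (continuity (pw _)) => apply cont_pw; lra : cont.

Lemma pw_is_derive (a t : R) : 1 < a -> is_derive (pw a) t (a * pw (a - 1) t).
Proof.
  intros Ha.
  destruct (Rtotal_order t 0) as [Ht|[->|Ht]].
  - apply (is_derive_ext_loc (fun _ => 0)).
    + assert (H : 0 < - t) by lra.
      exists (mkposreal _ H); intros y Hy.
      change (Rabs (y - t) < - t) in Hy; apply Rabs_def2 in Hy.
      rewrite pw_nonpos by lra; reflexivity.
    + rewrite pw_nonpos by lra; rewrite Rmult_0_r; exact (is_derive_const 0 t).
  - rewrite (pw_nonpos (a - 1)), Rmult_0_r by lra.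
    apply is_derive_Reals; intros eps Heps.
    destruct (cont_pw (a - 1) ltac:(lra) 0 eps Heps) as [d [Hd H]].
    exists (mkposreal d Hd); intros h Hh0 Hh; simpl in Hh.
    (* At 0 the difference quotient of [pw a] is exactly [pw (a - 1) h], so its limit is the
       continuity of [pw (a - 1)] at 0. *)
    replace (pw a (0 + h)) with (h * pw (a - 1) h)
      by (rewrite pw_mult; f_equal; ring).
    rewrite (pw_nonpos a 0) by lra.
    replace ((h * pw (a - 1) h - 0) / h - 0) with (pw (a - 1) h - pw (a - 1) 0)
      by (rewrite (pw_nonpos _ 0) by lra; field; exact Hh0).
    apply H; split.
    + split; [exact I|auto].
    + simpl; unfold Rdist; rewrite Rminus_0_r; exact Hh.
  - apply (is_derive_ext_loc (fun x => Rpower x a)).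
    + exists (mkposreal _ Ht); intros y Hy.
      change (Rabs (y - t) < t) in Hy; apply Rabs_def2 in Hy.
      rewrite pw_pos by lra; reflexivity.
    + rewrite pw_pos by lra; apply is_derive_Reals, derivable_pt_lim_power; exact Ht.
Qed.

(** Growth slower than every exponential makes the transform converge for every e > 0, as the later
    limit e -> 0 requires, and the class is closed under sums and products, in particular under
    multiplication by t. Continuity on all of R spares integrability side conditions. *)
Definition subexp (phi : R -> R) : Prop :=
  continuity phi /\
  forall d, 0 < d -> exists C, forall t, 0 <= t -> Rabs (phi t) <= C * exp (d * t).

Lemma subexp_cont (phi : R -> R) : subexp phi -> continuity phi.
Proof. intros [H _]; exact H. Qed.

Lemma subexp_dominated (phi psi : R -> R) :
  continuity phi -> subexp psi ->
  (forall t, 0 <= t -> Rabs (phi t) <= psi t) -> subexp phi.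
Proof.
  intros Hc [_ Hs] Hb; split; [exact Hc|]; intros d Hd.
  destruct (Hs d Hd) as [C HC]; exists C; intros t Ht.
  specialize (HC t Ht); specialize (Hb t Ht).
  pose proof (Rle_abs (psi t)); lra.
Qed.

Lemma subexp_plus (phi psi : R -> R) :
  subexp phi -> subexp psi -> subexp (fun t => phi t + psi t).
Proof.
  intros [H1 H2] [H3 H4]; split; [auto with cont|]; intros d Hd.
  destruct (H2 d Hd) as [C HC], (H4 d Hd) as [D HD].
  exists (C + D); intros t Ht; specialize (HC t Ht); specialize (HD t Ht).
  pose proof (Rabs_triang (phi t) (psi t)); lra.
Qed.

Lemma subexp_mult (phi psi : R -> R) :
  subexp phi -> subexp psi -> subexp (fun t => phi t * psi t).
Proof.
  intros [H1 H2] [H3 H4]; split; [auto with cont|]; intros d Hd.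
  destruct (H2 (d / 2) ltac:(lra)) as [C HC], (H4 (d / 2) ltac:(lra)) as [D HD].
  exists (C * D); intros t Ht; specialize (HC t Ht); specialize (HD t Ht).
  rewrite Rabs_mult.
  replace (C * D * exp (d * t))
    with ((C * exp (d / 2 * t)) * (D * exp (d / 2 * t))).
  - apply Rmult_le_compat; auto using Rabs_pos.
  - replace (d * t) with (d / 2 * t + d / 2 * t) by field.
    rewrite exp_plus; ring.
Qed.

Lemma subexp_bounded (phi : R -> R) (M : R) :
  continuity phi -> (forall t, 0 <= t -> Rabs (phi t) <= M) -> subexp phi.
Proof.
  intros Hc Hb; split; [exact Hc|]; intros d Hd; exists M; intros t Ht.
  specialize (Hb t Ht); pose proof (Rabs_pos (phi t)).
  assert (1 <= exp (d * t)).
  { rewrite <- exp_0; apply exp_le; nra. }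
  nra.
Qed.

Lemma subexp_const (c : R) : subexp (fun _ => c).
Proof. apply (subexp_bounded _ (Rabs c)); [auto with cont|intros; lra]. Qed.

Lemma subexp_sin : subexp sin.
Proof.
  apply (subexp_bounded _ 1); [auto with cont|].
  intros t _; apply Rabs_le, SIN_bound.
Qed.

Lemma subexp_cos : subexp cos.
Proof.
  apply (subexp_bounded _ 1); [auto with cont|].
  intros t _; apply Rabs_le, COS_bound.
Qed.

Lemma subexp_pw (a : R) : 0 < a -> subexp (pw a).
Proof.
  intros Ha; split; [auto with cont|]; intros d Hd.
  (* From ln u <= u at u = d t / a: t^a = (a/d)^a u^a <= (a/d)^a e^(d t). *)
  exists (exp (a * ln (a / d))); intros t Ht.
  rewrite Rabs_pos_eq by apply pw_ge0.
  destruct (Req_dec t 0) as [->|Ht0].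
  - rewrite pw_nonpos by lra; apply Rmult_le_pos; apply Rlt_le, exp_pos.
  - rewrite pw_pos by lra; unfold Rpower; rewrite <- exp_plus.
    assert (Hda : 0 < a / d) by (apply Rdiv_lt_0_compat; lra).
    assert (E : ln t = ln (a / d) + ln (d * t / a)).
    { rewrite <- ln_mult.
      - f_equal; field; lra.
      - lra.
      - apply Rdiv_lt_0_compat; nra. }
    assert (L : ln (d * t / a) <= d * t / a).
    { assert (0 < d * t / a) by (apply Rdiv_lt_0_compat; nra).
      rewrite <- (ln_exp (d * t / a)) at 2.
      apply ln_le; [lra|]. pose proof (exp_ineq1_le (d * t / a)); lra. }
    assert (a * ln t <= a * ln (a / d) + d * t).
    { rewrite E; apply (Rmult_le_compat_l a) in L; [|lra].
      replace (a * (d * t / a)) with (d * t) in L by (field; lra); lra. }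
    apply exp_le; lra.
Qed.

Lemma subexp_id : subexp (fun t => t).
Proof.
  apply (subexp_dominated _ (pw 1)); [auto with cont|apply subexp_pw; lra|].
  intros t Ht; rewrite pw_1 by lra; rewrite Rabs_pos_eq; lra.
Qed.

Lemma subexp_opp (phi : R -> R) : subexp phi -> subexp (fun t => - phi t).
Proof.
  intros [H1 H2]; split; [auto with cont|]; intros d Hd.
  destruct (H2 d Hd) as [C HC]; exists C; intros t Ht; rewrite Rabs_Ropp; auto.
Qed.

Lemma subexp_minus (phi psi : R -> R) :
  subexp phi -> subexp psi -> subexp (fun t => phi t - psi t).
Proof.
  intros H1 H2; apply (subexp_plus phi (fun t => - psi t) H1), subexp_opp, H2.
Qed.

Lemma subexp_abs (phi : R -> R) : subexp phi -> subexp (fun t => Rabs (phi t)).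
Proof.
  intros [H1 H2]; split; [auto with cont|]; intros d Hd.
  destruct (H2 d Hd) as [C HC]; exists C; intros t Ht; rewrite Rabs_Rabsolu; auto.
Qed.

Create HintDb subexp.
#[local] Hint Resolve subexp_plus subexp_mult subexp_minus subexp_opp subexp_const
  subexp_sin subexp_cos subexp_id subexp_abs : subexp.
#[local] Hint Extern 3 (subexp (pw _)) => apply subexp_pw; lra : subexp.

Definition is_laplace (phi : R -> R) (e l : R) : Prop :=
  is_lim (fun T => RInt (fun t => exp (- (e * t)) * phi t) 0 T) p_infty l.

Definition laplace (phi : R -> R) (e : R) : R :=
  real (Lim (fun T => RInt (fun t => exp (- (e * t)) * phi t) 0 T) p_infty).

Lemma is_laplace_unique (phi : R -> R) (e l : R) : is_laplace phi e l -> laplace phi e = l.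
Proof. intros H; unfold laplace; rewrite (is_lim_unique _ _ _ H); reflexivity. Qed.

Lemma is_lim_exp_opp (d : R) : 0 < d -> is_lim (fun T => exp (- (d * T))) p_infty 0.
Proof.
  intros Hd.
  apply (is_lim_comp exp (fun T => - (d * T)) p_infty 0 m_infty).
  - apply is_lim_exp_m.
  - apply (is_lim_opp (fun T => d * T) p_infty p_infty).
    replace p_infty with (Rbar_mult d p_infty) at 2.
    + apply (is_lim_scal_l (fun T => T) d p_infty p_infty), is_lim_id.
    + simpl; destruct (Rle_dec 0 d); [|lra].
      destruct (Rle_lt_or_eq_dec 0 d r); [reflexivity|lra].
  - exists 0; discriminate.
Qed.

Lemma RInt_of_derive (f df : R -> R) (a b : R) :
  (forall t, is_derive f t (df t)) -> continuity df ->
  RInt df a b = f b - f a.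
Proof.
  intros Hd Hc; apply is_RInt_unique.
  apply (is_RInt_derive f df a b); intros t _; [apply Hd|].
  apply continuity_continuous, Hc.
Qed.

(** Adding the dominating function makes the integrand nonnegative, so its primitive is monotone and
    bounded by 2 C/d; the explicit integral of the dominating function is then subtracted again. *)
Lemma is_lim_RInt_exp_dominated (psi : R -> R) (C d : R) :
  0 < d -> continuity psi ->
  (forall t, 0 <= t -> Rabs (psi t) <= C * exp (- (d * t))) ->
  exists l : R, is_lim (fun T => RInt psi 0 T) p_infty l.
Proof.
  intros Hd Hc Hb.
  set (b := fun t => C * exp (- (d * t))).
  assert (Cb : continuity b) by (unfold b; auto with cont).
  assert (Ib : forall T, RInt b 0 T = C / d - C / d * exp (- (d * T))).
  { intros T.
    rewrite (RInt_of_derive (fun t => - (C / d * exp (- (d * t)))) b); [| |exact Cb].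
    - rewrite Rmult_0_r, Ropp_0, exp_0; eqR; ring.
    - intros t; unfold b; auto_derive; [exact I|field; lra]. }
  assert (HC : 0 <= C).
  { specialize (Hb 0 (Rle_refl 0)); rewrite Rmult_0_r, Ropp_0, exp_0 in Hb.
    pose proof (Rabs_pos (psi 0)); lra. }
  assert (Cs : continuity (fun t => psi t + b t)) by auto with cont.
  destruct (is_lim_nondecreasing (fun T => RInt (fun t => psi t + b t) 0 T)
              0 (2 * (C / d))) as [l [Hl _]].
  - intros x y Hx Hy.
    rewrite <- (RInt_Chasles (fun t => psi t + b t) 0 x y)
      by (apply ex_RInt_cont; exact Cs).
    change (RInt (fun t => psi t + b t) 0 x <=
      RInt (fun t => psi t + b t) 0 x + RInt (fun t => psi t + b t) x y).
    assert (0 <= RInt (fun t => psi t + b t) x y); [|lra].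
    apply RInt_ge_0; [exact Hy|apply ex_RInt_cont; exact Cs|].
    intros t Ht; specialize (Hb t ltac:(lra)); apply Rabs_le_between in Hb.
    unfold b; lra.
  - intros T HT.
    apply Rle_trans with (RInt (fun t => 2 * b t) 0 T).
    + apply RInt_le; [exact HT|apply ex_RInt_cont; exact Cs| |].
      * apply ex_RInt_cont; auto with cont.
      * intros t Ht; specialize (Hb t ltac:(lra)); apply Rabs_le_between in Hb.
        unfold b in *; lra.
    + rewrite (RInt_scal b) by (apply ex_RInt_cont; exact Cb).
      change (2 * RInt b 0 T <= 2 * (C / d)); rewrite Ib.
      pose proof (exp_pos (- (d * T))).
      assert (0 <= C / d) by (apply Rmult_le_pos; [lra|apply Rlt_le, Rinv_0_lt_compat; lra]).
      nra.
  - exists (l - (C / d - C / d * 0)).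
    apply (is_lim_ext (fun T => RInt (fun t => psi t + b t) 0 T -
                                (C / d - C / d * exp (- (d * T))))).
    + intros T; rewrite <- Ib.
      rewrite (RInt_plus psi b) by (apply ex_RInt_cont; assumption).
      change (RInt psi 0 T + RInt b 0 T - RInt b 0 T = RInt psi 0 T); ring.
    + apply (is_lim_minus' _ _ p_infty l (C / d - C / d * 0)); [exact Hl|].
      apply (is_lim_minus' _ _ p_infty (C / d) (C / d * 0)); [apply is_lim_const|].
      apply (is_lim_scal_l _ (C / d) p_infty 0), is_lim_exp_opp, Hd.
Qed.

Lemma subexp_damped (phi : R -> R) (e : R) : subexp phi -> 0 < e ->
  exists C, forall t, 0 <= t ->
    Rabs (exp (- (e * t)) * phi t) <= C * exp (- (e / 2 * t)).
Proof.
  intros [_ Hs] He; destruct (Hs (e / 2) ltac:(lra)) as [C HC]; exists C; intros t Ht.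
  rewrite Rabs_mult, (Rabs_pos_eq (exp _)) by apply Rlt_le, exp_pos.
  replace (C * exp (- (e / 2 * t))) with (exp (- (e * t)) * (C * exp (e / 2 * t))).
  - apply Rmult_le_compat_l; [apply Rlt_le, exp_pos|apply HC, Ht].
  - replace (- (e / 2 * t)) with (- (e * t) + e / 2 * t) by field.
    rewrite exp_plus; ring.
Qed.

Lemma laplace_correct (phi : R -> R) (e : R) : subexp phi -> 0 < e -> is_laplace phi e (laplace phi e).
Proof.
  intros Hs He; destruct (subexp_damped phi e Hs He) as [C HC].
  apply subexp_cont in Hs.
  destruct (is_lim_RInt_exp_dominated (fun t => exp (- (e * t)) * phi t) C (e / 2))
    as [l Hl]; [lra|auto with cont|exact HC|].
  rewrite (is_laplace_unique phi e l Hl); exact Hl.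
Qed.

Lemma is_laplace_plus (phi psi : R -> R) (e a b : R) :
  continuity phi -> continuity psi ->
  is_laplace phi e a -> is_laplace psi e b -> is_laplace (fun t => phi t + psi t) e (a + b).
Proof.
  intros C1 C2 H1 H2; unfold is_laplace.
  apply (is_lim_ext (fun T => RInt (fun t => exp (- (e * t)) * phi t) 0 T +
                              RInt (fun t => exp (- (e * t)) * psi t) 0 T)).
  - intros T; rewrite <- (RInt_plus (fun t => exp (- (e * t)) * phi t)
      (fun t => exp (- (e * t)) * psi t)) by (apply ex_RInt_cont; auto with cont).
    apply RInt_ext; intros t _.
    change (exp (- (e * t)) * phi t + exp (- (e * t)) * psi t =
            exp (- (e * t)) * (phi t + psi t)); ring.
  - apply (is_lim_plus' _ _ p_infty a b); assumption.
Qed.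

Lemma is_laplace_scal (phi : R -> R) (c e a : R) :
  continuity phi -> is_laplace phi e a -> is_laplace (fun t => c * phi t) e (c * a).
Proof.
  intros C1 H1; unfold is_laplace.
  apply (is_lim_ext (fun T => c * RInt (fun t => exp (- (e * t)) * phi t) 0 T)).
  - intros T. symmetry.
    rewrite <- (RInt_scal (fun t => exp (- (e * t)) * phi t))
      by (apply ex_RInt_cont; auto with cont).
    apply RInt_ext; intros t _.
    change (exp (- (e * t)) * (c * phi t) = c * (exp (- (e * t)) * phi t)); ring.
  - apply (is_lim_scal_l _ c p_infty a), H1.
Qed.

Lemma laplace_plus (phi psi : R -> R) (e : R) : subexp phi -> subexp psi -> 0 < e ->
  laplace (fun t => phi t + psi t) e = laplace phi e + laplace psi e.
Proof.
  intros H1 H2 He; apply is_laplace_unique, is_laplace_plus; auto using subexp_cont, laplace_correct.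
Qed.

Lemma laplace_scal (phi : R -> R) (c e : R) : subexp phi -> 0 < e ->
  laplace (fun t => c * phi t) e = c * laplace phi e.
Proof.
  intros H1 He; apply is_laplace_unique, is_laplace_scal; auto using subexp_cont, laplace_correct.
Qed.

Lemma laplace_ext (phi psi : R -> R) (e : R) :
  (forall t, 0 <= t -> phi t = psi t) -> laplace phi e = laplace psi e.
Proof.
  intros H; unfold laplace; f_equal; apply Lim_ext_loc.
  exists 0; intros T HT; apply RInt_ext; intros t Ht.
  rewrite Rmin_left in Ht by lra; rewrite H by lra; reflexivity.
Qed.

Lemma laplace_opp (phi : R -> R) (e : R) : subexp phi -> 0 < e ->
  laplace (fun t => - phi t) e = - laplace phi e.
Proof.
  intros H He. rewrite (laplace_ext _ (fun t => (-1) * phi t)) by (intros; ring).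
  rewrite laplace_scal by assumption; ring.
Qed.

Lemma laplace_minus (phi psi : R -> R) (e : R) : subexp phi -> subexp psi -> 0 < e ->
  laplace (fun t => phi t - psi t) e = laplace phi e - laplace psi e.
Proof.
  intros H1 H2 He.
  rewrite (laplace_ext _ (fun t => phi t + (- psi t))) by (intros; ring).
  rewrite laplace_plus, laplace_opp by auto with subexp; ring.
Qed.

Lemma laplace_le (phi psi : R -> R) (e : R) : subexp phi -> subexp psi -> 0 < e ->
  (forall t, 0 <= t -> phi t <= psi t) -> laplace phi e <= laplace psi e.
Proof.
  intros H1 H2 He H.
  apply (is_lim_p_infty_le (fun T => RInt (fun t => exp (- (e * t)) * phi t) 0 T)
           (fun T => RInt (fun t => exp (- (e * t)) * psi t) 0 T) 0).
  - apply laplace_correct; assumption.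
  - apply laplace_correct; assumption.
  - intros T HT; apply RInt_le; [lra| | |].
    + apply ex_RInt_cont; apply subexp_cont in H1; auto with cont.
    + apply ex_RInt_cont; apply subexp_cont in H2; auto with cont.
    + intros t Ht; apply Rmult_le_compat_l; [apply Rlt_le, exp_pos|apply H; lra].
Qed.

Lemma laplace_abs_le (phi psi : R -> R) (e : R) : subexp phi -> subexp psi -> 0 < e ->
  (forall t, 0 <= t -> Rabs (phi t) <= psi t) -> Rabs (laplace phi e) <= laplace psi e.
Proof.
  intros H1 H2 He H; apply Rabs_le; split.
  - rewrite <- laplace_opp by assumption; apply laplace_le; auto with subexp.
    intros t Ht; specialize (H t Ht); apply Rabs_le_between in H; lra.
  - apply laplace_le; auto with subexp.
    intros t Ht; specialize (H t Ht); apply Rabs_le_between in H; lra.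
Qed.

(** Integration by parts in a form without separate convergence questions: an explicit primitive
    yields the identity between transforms. *)
Lemma is_laplace_of_derive (Phi phi : R -> R) (e L : R) :
  continuity phi ->
  (forall t, is_derive Phi t (exp (- (e * t)) * phi t)) ->
  is_lim Phi p_infty L -> is_laplace phi e (L - Phi 0).
Proof.
  intros Hc Hd HL.
  apply (is_lim_ext (fun T => Phi T - Phi 0)).
  - intros T; symmetry; apply (RInt_of_derive Phi); [exact Hd|auto with cont].
  - apply (is_lim_minus' _ _ p_infty L (Phi 0)); [exact HL|apply is_lim_const].
Qed.

Lemma is_lim_exp_subexp (phi : R -> R) (e : R) : subexp phi -> 0 < e ->
  is_lim (fun t => exp (- (e * t)) * phi t) p_infty 0.
Proof.
  intros Hs He; destruct (subexp_damped phi e Hs He) as [C HB].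
  assert (HE : is_lim (fun t => C * exp (- (e / 2 * t))) p_infty 0).
  { replace (Finite 0) with (Rbar_mult C 0) by (simpl; f_equal; ring).
    apply is_lim_scal_l, is_lim_exp_opp; lra. }
  apply (is_lim_le_le_loc (fun t => - (C * exp (- (e / 2 * t))))
           (fun t => C * exp (- (e / 2 * t)))).
  - exists 0; intros t Ht; apply Rabs_le_between, HB; lra.
  - replace (Finite 0) with (Rbar_opp 0) by (simpl; f_equal; ring).
    apply is_lim_opp, HE.
  - exact HE.
Qed.

Lemma laplace_derive_fun (phi dphi : R -> R) (e : R) : subexp phi -> subexp dphi -> 0 < e ->
  (forall t, is_derive phi t (dphi t)) -> laplace dphi e = e * laplace phi e - phi 0.
Proof.
  intros H1 H2 He Hd.
  assert (E : laplace (fun t => dphi t - e * phi t) e = 0 - exp (- (e * 0)) * phi 0).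
  { apply is_laplace_unique.
    apply (is_laplace_of_derive (fun t => exp (- (e * t)) * phi t)).
    - apply subexp_cont; auto with subexp.
    - intros t; specialize (Hd t); auto_derive.
      + exists (dphi t); exact Hd.
      + rewrite (Derive_eta _ _ _ Hd); ring.
    - apply is_lim_exp_subexp; assumption. }
  rewrite laplace_minus, laplace_scal in E by auto with subexp.
  rewrite Rmult_0_r, Ropp_0, exp_0 in E; lra.
Qed.

Lemma exp_taylor1_bound (x : R) : Rabs (exp x - 1 - x) <= x ^ 2 * exp (Rabs x).
Proof.
  assert (H0 : forall y, 1 + y <= exp y) by apply exp_ineq1_le.
  pose proof (H0 x) as H1.
  rewrite Rabs_pos_eq by lra.
  assert (H2 : exp x - 1 <= x * exp x).
  { pose proof (H0 (- x)) as H; rewrite exp_Ropp in H.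
    pose proof (exp_pos x).
    apply (Rmult_le_compat_l (exp x)) in H; [|lra].
    rewrite Rinv_r in H by lra; lra. }
  destruct (Rle_dec 0 x).
  - rewrite Rabs_pos_eq by lra; nra.
  - assert (1 <= exp (Rabs x)).
    { pose proof (H0 (Rabs x)); pose proof (Rabs_pos x); lra. }
    pose proof (pow2_ge_0 x). nra.
Qed.

Lemma laplace_shift (phi : R -> R) (a b : R) :
  laplace phi (a + b) = laplace (fun t => exp (- (b * t)) * phi t) a.
Proof.
  unfold laplace; f_equal; apply Lim_ext; intros T; apply RInt_ext; intros t _.
  replace (- ((a + b) * t)) with (- (a * t) + - (b * t)) by ring.
  rewrite exp_plus; eqR; ring.
Qed.

Lemma subexp_exp (b : R) : 0 <= b -> subexp (fun t => exp (- (b * t))).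
Proof.
  intros Hb; apply (subexp_bounded _ 1); [auto with cont|]; intros t Ht.
  rewrite Rabs_pos_eq by apply Rlt_le, exp_pos.
  rewrite <- exp_0; apply exp_le; nra.
Qed.
#[local] Hint Extern 3 (subexp (fun t => exp (- (_ * t)))) =>
  apply subexp_exp; lra : subexp.

(** Differentiation under the integral sign. The Taylor remainder of e^(-ht) is at most (ht)^2
    e^(|h|t); for |h| < e/2 half of the damping e^(-et) absorbs e^(|h|t), and the other half leaves
    the transform [B] at e/2, independent of h. The error is therefore at most h^2 B. *)
Lemma laplace_is_derive (phi : R -> R) (e : R) : subexp phi -> 0 < e ->
  is_derive (laplace phi) e (- laplace (fun t => t * phi t) e).
Proof.
  intros Hp He.
  set (B := laplace (fun t => t * t * Rabs (phi t)) (e / 2)).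
  assert (HB : 0 <= B).
  { apply Rle_trans with (laplace (fun _ => 0 * 0) (e / 2)).
    - rewrite (laplace_scal (fun _ => 0)) by (auto with subexp; lra); lra.
    - apply laplace_le; auto with subexp; [lra|].
      intros t Ht; pose proof (Rabs_pos (phi t)); nra. }
  assert (Key : forall h, Rabs h < e / 2 ->
    Rabs (laplace phi (e + h) - laplace phi e + h * laplace (fun t => t * phi t) e) <= h ^ 2 * B).
  { intros h Hh; assert (Hh' := Hh); apply Rabs_def2 in Hh'.
    assert (S1 : subexp (fun t => exp (- ((e / 2 + h) * t)))) by (apply subexp_exp; lra).
    assert (S2 : subexp (fun t => exp (- (e / 2 * t)))) by (apply subexp_exp; lra).
    replace (e + h) with (e / 2 + (e / 2 + h)) by field.
    replace e with (e / 2 + e / 2) at 3 4 by field.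
    rewrite !laplace_shift. unfold B.
    rewrite <- !laplace_scal, <- laplace_minus, <- laplace_plus by (auto with subexp; lra).
    apply laplace_abs_le; auto with subexp; [lra|]; intros t Ht.
    replace (- ((e / 2 + h) * t)) with (- (e / 2 * t) + - (h * t)) by ring.
    rewrite exp_plus.
    replace (exp (- (e / 2 * t)) * exp (- (h * t)) * phi t - exp (- (e / 2 * t)) * phi t
             + h * (exp (- (e / 2 * t)) * (t * phi t)))
      with (exp (- (e / 2 * t)) * (exp (- (h * t)) - 1 - - (h * t)) * phi t) by ring.
    rewrite !Rabs_mult, (Rabs_pos_eq (exp _)) by apply Rlt_le, exp_pos.
    replace (h ^ 2 * (t * t * Rabs (phi t))) with ((- (h * t)) ^ 2 * 1 * Rabs (phi t))
      by ring.
    apply Rmult_le_compat_r; [apply Rabs_pos|].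
    apply Rle_trans with
      (exp (- (e / 2 * t)) * ((- (h * t)) ^ 2 * exp (Rabs (- (h * t))))).
    - apply Rmult_le_compat_l; [apply Rlt_le, exp_pos|apply exp_taylor1_bound].
    - replace (exp (- (e / 2 * t)) * ((- (h * t)) ^ 2 * exp (Rabs (- (h * t)))))
        with ((- (h * t)) ^ 2 * (exp (- (e / 2 * t)) * exp (Rabs (- (h * t))))) by ring.
      apply Rmult_le_compat_l; [apply pow2_ge_0|].
      rewrite <- exp_plus, <- exp_0; apply exp_le.
      rewrite Rabs_Ropp, Rabs_mult, (Rabs_pos_eq t) by lra; nra. }
  apply is_derive_Reals; intros eps Heps.
  assert (Hd : 0 < Rmin (e / 2) (eps / (B + 1))).
  { apply Rmin_pos; [lra|apply Rdiv_lt_0_compat; lra]. }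
  exists (mkposreal _ Hd); intros h Hh0 Hh; simpl in Hh.
  pose proof (Rmin_l (e / 2) (eps / (B + 1))). pose proof (Rmin_r (e / 2) (eps / (B + 1))).
  specialize (Key h ltac:(lra)).
  replace ((laplace phi (e + h) - laplace phi e) / h - - laplace (fun t => t * phi t) e)
    with ((laplace phi (e + h) - laplace phi e + h * laplace (fun t => t * phi t) e) / h)
    by (field; exact Hh0).
  unfold Rdiv; rewrite Rabs_mult, Rabs_inv.
  assert (Ph : 0 < Rabs h) by (apply Rabs_pos_lt; exact Hh0).
  apply Rle_lt_trans with (Rabs h * B).
  - apply (Rmult_le_reg_r (Rabs h)); [exact Ph|].
    rewrite Rmult_assoc, Rinv_l, Rmult_1_r by lra.
    replace (Rabs h * B * Rabs h) with (Rabs h ^ 2 * B) by ring.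
    rewrite pow2_abs; exact Key.
  - apply Rle_lt_trans with (Rabs h * (B + 1)); [nra|].
    apply (Rmult_lt_reg_r (/ (B + 1))); [apply Rinv_0_lt_compat; lra|].
    rewrite Rmult_assoc, Rinv_r, Rmult_1_r by lra. unfold Rdiv in *; lra.
Qed.

(** * The Gamma function *)

Lemma constant_of_derive_0 (f : R -> R) :
  (forall x, 0 < x -> is_derive f x 0) -> forall x y, 0 < x -> 0 < y -> f x = f y.
Proof.
  intros H.
  assert (G : forall x y, 0 < x -> x <= y -> f x = f y).
  { intros x y Hx Hy; apply Rle_antisym.
    - apply (nondecreasing_of_derive f (fun _ => 0)); [exact Hy| |intros; lra].
      intros t Ht; apply H; lra.
    - cut (- f x <= - f y); [lra|].
      apply (nondecreasing_of_derive (fun t => - f t) (fun _ => 0));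
        [exact Hy| |intros; lra].
      intros t Ht; rewrite <- Ropp_0; apply (is_derive_opp f), H; lra. }
  intros x y Hx Hy; destruct (Rle_dec x y).
  - apply G; lra.
  - symmetry; apply G; lra.
Qed.

(** Euler's integral for Gamma(z). It is handled for z > 1, where the cut-off power is continuous at
    0. *)
Definition euler (z : R) : R := laplace (pw (z - 1)) 1.

Lemma laplace_pw_succ (a e : R) : 0 < a -> 0 < e ->
  e * laplace (pw (a + 1)) e = (a + 1) * laplace (pw a) e.
Proof.
  intros Ha He.
  pose proof (laplace_derive_fun (pw (a + 1)) (fun t => (a + 1) * pw a t) e
    ltac:(auto with subexp) ltac:(auto with subexp) He) as H.
  rewrite laplace_scal, (pw_nonpos _ 0) in H by (auto with subexp; lra).
  rewrite H; [ring|].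
  intros t. replace (pw a t) with (pw (a + 1 - 1) t) by (f_equal; ring).
  apply pw_is_derive; lra.
Qed.

Lemma is_derive_Rpower_l (x y : R) :
  0 < x -> is_derive (fun t => Rpower t y) x (y * Rpower x (y - 1)).
Proof. intros H; apply is_derive_Reals, derivable_pt_lim_power, H. Qed.

(** Scaling without a substitution in the integral: by [laplace_pw_succ] the product of the
    transform with x^(a+1) has derivative 0, so its value at e is its value at 1. *)
Lemma laplace_pw (a e : R) : 0 < a -> 0 < e ->
  laplace (pw a) e = Rpower e (- (a + 1)) * euler (a + 1).
Proof.
  intros Ha He.
  assert (H : laplace (pw a) e * Rpower e (a + 1) = laplace (pw a) 1 * Rpower 1 (a + 1)).
  { apply (constant_of_derive_0 (fun x => laplace (pw a) x * Rpower x (a + 1))); [|lra|lra].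
    intros x Hx.
    replace 0 with ((- laplace (fun t => t * pw a t) x) * Rpower x (a + 1)
       + laplace (pw a) x * ((a + 1) * Rpower x (a + 1 - 1))).
    - apply (is_derive_mult (laplace (pw a)) (fun x => Rpower x (a + 1)));
        [apply laplace_is_derive|apply is_derive_Rpower_l|intros; apply Rmult_comm];
        auto with subexp.
    - rewrite (laplace_ext (fun t => t * pw a t) (pw (a + 1))) by (intros; apply pw_mult).
      replace (a + 1 - 1) with a by ring.
      rewrite Rpower_plus, Rpower_1 by lra.
      pose proof (laplace_pw_succ a x Ha Hx) as E.
      eqR; transitivity (Rpower x a * ((a + 1) * laplace (pw a) x - x * laplace (pw (a + 1)) x));
        [ring|rewrite E; ring]. }
  rewrite Rpower_Ropp; unfold euler. replace (a + 1 - 1) with a by ring.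
  replace (Rpower 1 (a + 1)) with 1 in H
    by (unfold Rpower; rewrite ln_1, Rmult_0_r, exp_0; reflexivity).
  rewrite Rmult_1_r in H; rewrite <- H.
  field; apply Rgt_not_eq, Rpower_pos.
Qed.

Lemma euler_succ (z : R) : 1 < z -> euler (z + 1) = z * euler z.
Proof.
  intros Hz; unfold euler.
  pose proof (laplace_pw_succ (z - 1) 1 ltac:(lra) ltac:(lra)) as H.
  replace (z - 1 + 1) with z in H by ring.
  replace (z + 1 - 1) with z by ring; lra.
Qed.

(** The derivative rule is applied to t and to 1, and the transform of 0 is found by scaling with
    the factor 0. The normalisation is taken at 2, since the cut-off power t^0 jumps at 0. *)
Lemma euler_2 : euler 2 = 1.
Proof.
  unfold euler; replace (2 - 1) with 1 by ring.
  rewrite (laplace_ext (pw 1) (fun t => t)) by (intros; apply pw_1; assumption).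
  assert (E1 : laplace (fun _ => 1) 1 = 1 * laplace (fun t => t) 1 - 0).
  { apply (laplace_derive_fun (fun t => t)); auto with subexp; [lra|].
    intros t; apply (is_derive_id t). }
  assert (E2 : laplace (fun _ => 0) 1 = 1 * laplace (fun _ => 1) 1 - 1).
  { apply (laplace_derive_fun (fun _ => 1)); auto with subexp; [lra|].
    intros t; exact (is_derive_const 1 t). }
  assert (E3 : laplace (fun _ => 0 * 0) 1 = 0 * laplace (fun _ => 0) 1)
    by (apply laplace_scal; auto with subexp; lra).
  rewrite Rmult_0_l, Rmult_0_l in E3; lra.
Qed.

Lemma euler_fact (n : nat) : euler (INR n + 2) = INR (fact (n + 1)).
Proof.
  induction n as [|n IH].
  - simpl INR at 1; rewrite Rplus_0_l, euler_2; reflexivity.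
  - rewrite S_INR. replace (INR n + 1 + 2) with (INR n + 2 + 1) by ring.
    pose proof (pos_INR n).
    rewrite euler_succ, IH by lra.
    replace (S n + 1)%nat with (S (n + 1)) by lia.
    rewrite fact_simpl, mult_INR, S_INR, plus_INR; simpl INR; ring.
Qed.

(** After division by e^(th u) this is a weighted sum of the tangent-line bounds for e^((1-th)u) and
    e^(-th u), in which the linear terms cancel. *)
Lemma exp_convex_0 (th u : R) : 0 <= th <= 1 -> exp (th * u) <= (1 - th) + th * exp u.
Proof.
  intros Hth.
  pose proof (exp_ineq1_le ((1 - th) * u)) as H1.
  pose proof (exp_ineq1_le (- (th * u))) as H2.
  assert (E1 : exp u = exp (th * u) * exp ((1 - th) * u))
    by (rewrite <- exp_plus; f_equal; ring).
  assert (E2 : 1 = exp (th * u) * exp (- (th * u)))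
    by (rewrite <- exp_plus, Rplus_opp_r, exp_0; reflexivity).
  pose proof (exp_pos (th * u)) as P.
  rewrite E1.
  set (X := exp (th * u)) in *. set (Y := exp ((1 - th) * u)) in *.
  set (Z := exp (- (th * u))) in *.
  assert (1 - th = (1 - th) * (X * Z)) by (rewrite <- E2; ring).
  assert (X <= (1 - th) * (X * Z) + th * (X * Y)); [|lra].
  replace ((1 - th) * (X * Z) + th * (X * Y)) with (X * ((1 - th) * Z + th * Y)) by ring.
  assert (1 <= (1 - th) * Z + th * Y); [|nra].
  apply Rmult_le_compat_l with (r := 1 - th) in H2; [|lra].
  apply Rmult_le_compat_l with (r := th) in H1; [|lra].
  nra.
Qed.

(* Log-convexity of Gamma, obtained from the tangent line of [t ^ th] at [t = z]
   instead of Hoelder's inequality. *)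
Lemma euler_shift_le (z th : R) : 1 < z -> 0 <= th <= 1 ->
  euler (z + th) <= Rpower z th * euler z.
Proof.
  intros Hz Hth.
  replace (Rpower z th * euler z) with
    ((1 - th) * Rpower z th * euler z + th * Rpower z (th - 1) * euler (z + 1)).
  2: { rewrite euler_succ by lra.
       replace (Rpower z th) with (Rpower z (th - 1) * z).
       - ring.
       - rewrite <- (Rpower_1 z) at 2 by lra; rewrite <- Rpower_plus; f_equal; ring. }
  unfold euler.
  rewrite <- !laplace_scal, <- laplace_plus by auto with subexp || lra.
  apply laplace_le; auto with subexp; [lra|].
  intros t Ht; destruct (Req_dec t 0) as [->|Ht0].
  - rewrite !(pw_nonpos _ 0) by lra; lra.
  - replace (z + 1 - 1) with (z - 1 + 1) by ring.
    replace (z + th - 1) with (z - 1 + th) by ring.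
    rewrite <- pw_mult, !pw_pos, Rpower_plus by lra.
    pose proof (Rpower_pos t (z - 1)) as P.
    assert (H : Rpower t th <= (1 - th) * Rpower z th + th * Rpower z (th - 1) * t).
    { pose proof (exp_convex_0 th (ln (t / z)) Hth) as H.
      rewrite exp_ln in H by (apply Rdiv_lt_0_compat; lra).
      rewrite ln_div, Rmult_minus_distr_l, Rminus_def, exp_plus, exp_Ropp in H by lra.
      fold (Rpower t th) (Rpower z th) in H.
      pose proof (Rpower_pos z th) as Pz.
      apply (Rmult_le_compat_r (Rpower z th)) in H; [|lra].
      rewrite Rmult_assoc, Rinv_l, Rmult_1_r in H by lra.
      replace (Rpower z (th - 1)) with (Rpower z th / z).
      - unfold Rdiv in *; lra.
      - unfold Rminus; rewrite Rpower_plus, Rpower_Ropp, Rpower_1 by lra; reflexivity. }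
    nra.
Qed.

Lemma euler_shift_ge (z th : R) : 1 < z -> 0 <= th <= 1 ->
  z * euler z <= Rpower (z + th) (1 - th) * euler (z + th).
Proof.
  intros Hz Hth. rewrite <- euler_succ by lra.
  replace (z + 1) with (z + th + (1 - th)) by ring.
  apply euler_shift_le; lra.
Qed.

Definition gauss (z : R) (n : nat) : R :=
  prod_f_R0 (fun j => z + INR j) n / (INR (fact n) * Rpower (INR n) z).

Lemma prod_f_R0_S (f : nat -> R) (n : nat) :
  prod_f_R0 f (S n) = prod_f_R0 f n * f (S n).
Proof. reflexivity. Qed.

Lemma prod_shift (z : R) (n : nat) :
  prod_f_R0 (fun j => z + INR j) n * (z + INR n + 1) =
  z * prod_f_R0 (fun j => z + 1 + INR j) n.
Proof.
  induction n as [|n IH].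
  - simpl; ring.
  - rewrite !prod_f_R0_S. rewrite S_INR.
    replace (prod_f_R0 (fun j => z + INR j) n * (z + (INR n + 1)) * (z + (INR n + 1) + 1))
      with (prod_f_R0 (fun j => z + INR j) n * (z + INR n + 1) * (z + 1 + (INR n + 1)))
      by ring.
    rewrite IH; ring.
Qed.

Lemma gauss_succ (z : R) (n : nat) : (1 <= n)%nat ->
  gauss z n * ((z + INR n + 1) / INR n) = z * gauss (z + 1) n.
Proof.
  intros Hn; unfold gauss.
  assert (0 < INR n) by (apply lt_0_INR; lia).
  rewrite Rpower_plus, Rpower_1 by lra.
  pose proof (INR_fact_neq_0 n). pose proof (Rpower_pos (INR n) z).
  transitivity (prod_f_R0 (fun j => z + INR j) n * (z + INR n + 1)
                / (INR (fact n) * (Rpower (INR n) z * INR n))).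
  - field; lra.
  - rewrite prod_shift; field; lra.
Qed.

Lemma is_lim_seq_inv_INR : is_lim_seq (fun n => / INR n) 0.
Proof.
  apply (is_lim_seq_inv INR p_infty); [apply is_lim_seq_INR|discriminate].
Qed.

Lemma is_lim_seq_comp_inv (f : R -> R) (u : nat -> R) :
  continuous f 0 ->
  (forall n, (1 <= n)%nat -> u n = f (/ INR n)) -> is_lim_seq u (f 0).
Proof.
  intros Hf Hu.
  apply (is_lim_seq_ext_loc (fun n => f (/ INR n))).
  - exists 1%nat; intros n Hn; symmetry; apply Hu, Hn.
  - apply is_lim_seq_continuous; [|apply is_lim_seq_inv_INR].
    apply continuity_pt_filterlim; exact Hf.
Qed.

Lemma is_lim_seq_shift_ratio (z : R) :
  is_lim_seq (fun n => (z + INR n + 1) / INR n) 1.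
Proof.
  replace (Finite 1) with (Finite ((fun x => (z + 1) * x + 1) 0)) by (f_equal; ring).
  apply (is_lim_seq_comp_inv (fun x => (z + 1) * x + 1)).
  - apply @ex_derive_continuous; auto_derive; exact I.
  - intros n Hn; assert (0 < INR n) by (apply lt_0_INR; lia); field; lra.
Qed.

Lemma gauss_lim_succ (z l : R) : z <> 0 ->
  is_lim_seq (gauss z) l -> is_lim_seq (gauss (z + 1)) (l / z).
Proof.
  intros Hz Hl.
  apply (is_lim_seq_ext_loc (fun n => / z * (gauss z n * ((z + INR n + 1) / INR n)))).
  - exists 1%nat; intros n Hn; rewrite gauss_succ by exact Hn; field; exact Hz.
  - replace (l / z) with (/ z * (l * 1)) by (field; exact Hz).
    apply (is_lim_seq_scal_l _ (/ z) (l * 1)).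
    apply (is_lim_seq_mult' _ _ l 1); [exact Hl|apply is_lim_seq_shift_ratio].
Qed.

Lemma gauss_lim_pred (z l : R) :
  is_lim_seq (gauss (z + 1)) l -> is_lim_seq (gauss z) (z * l).
Proof.
  intros Hl.
  apply (is_lim_seq_ext_loc
           (fun n => z * gauss (z + 1) n * / ((z + INR n + 1) / INR n))).
  - destruct (INR_unbounded (- z)) as [N HN].
    exists (S N); intros n Hn.
    assert (INR N <= INR n) by (apply le_INR; lia).
    assert (0 < INR n) by (apply lt_0_INR; lia).
    rewrite <- gauss_succ by lia; field; lra.
  - replace (z * l) with (z * l * / 1) by field.
    apply (is_lim_seq_mult' _ _ (z * l) (/ 1)).
    + apply (is_lim_seq_scal_l _ z l), Hl.
    + apply (is_lim_seq_inv _ 1); [apply is_lim_seq_shift_ratio|].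
      intros E; injection E; lra.
Qed.

Lemma prod_euler (z : R) (n : nat) : 1 < z ->
  prod_f_R0 (fun j => z + INR j) n * euler z = euler (z + INR n + 1).
Proof.
  intros Hz; induction n as [|n IH].
  - simpl; rewrite !Rplus_0_r, euler_succ by lra; reflexivity.
  - rewrite !prod_f_R0_S.
    replace (prod_f_R0 (fun j => z + INR j) n * (z + INR (S n)) * euler z)
      with ((z + INR (S n)) * (prod_f_R0 (fun j => z + INR j) n * euler z)) by ring.
    pose proof (pos_INR n).
    rewrite IH, S_INR, (euler_succ (z + (INR n + 1))) by lra.
    f_equal; f_equal; ring.
Qed.

Lemma euler_pos_23 (th : R) : 0 <= th <= 1 -> 0 < euler (2 + th).
Proof.
  intros Hth. pose proof (euler_shift_ge 2 th ltac:(lra) Hth) as H.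
  rewrite euler_2 in H. pose proof (Rpower_pos (2 + th) (1 - th)). nra.
Qed.

Lemma Rpower_le_self (x a : R) : 1 <= x -> 0 <= a <= 1 -> Rpower x a <= x.
Proof.
  intros Hx Ha; rewrite <- (Rpower_1 x) at 2 by lra.
  destruct (Req_dec x 1) as [->|].
  - unfold Rpower; rewrite ln_1, !Rmult_0_r; lra.
  - destruct (Req_dec a 1) as [->|]; [lra|].
    apply Rlt_le, Rpower_lt; lra.
Qed.

(** The product in [gauss] times Gamma(2 + th) is Gamma(n + 3 + th), and log-convexity squeezes this
    between multiples of Gamma(n + 3) = (n + 2)! that differ by a factor tending to 1. *)
Lemma gauss_lim_23 (th : R) : 0 <= th <= 1 ->
  is_lim_seq (gauss (2 + th)) (/ euler (2 + th)).
Proof.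
  intros Hth. pose proof (euler_pos_23 th Hth) as P.
  (* With N = n and x = 1/N these are (N+3)(N+2)(N+1)/N^3, respectively the same with an extra
     N/(N+4), over Gamma(2 + th). As functions of x they are continuous at 0, where both equal the
     claimed limit. *)
  set (u := fun x => (1 + 3 * x) * (1 + 2 * x) * (1 + x) / euler (2 + th)).
  set (v := fun x => (1 + 3 * x) * (1 + 2 * x) * (1 + x) / (1 + 4 * x) / euler (2 + th)).
  apply (is_lim_seq_le_le_loc (fun n => v (/ INR n)) _ (fun n => u (/ INR n))).
  - exists 1%nat; intros n Hn.
    assert (Hn0 : 1 <= INR n) by (apply (le_INR 1); lia).
    pose proof (prod_euler (2 + th) n ltac:(lra)) as E.
    replace (2 + th + INR n + 1) with (INR (n + 1) + 2 + th) in E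
      by (rewrite plus_INR; simpl INR; ring).
    pose proof (euler_shift_le (INR (n + 1) + 2) th
                  ltac:(rewrite plus_INR; simpl INR; lra) Hth) as U.
    pose proof (euler_shift_ge (INR (n + 1) + 2) th
                  ltac:(rewrite plus_INR; simpl INR; lra) Hth) as L.
    rewrite <- E, euler_fact in U, L.
    replace (n + 1 + 1)%nat with (S (S n)) in U, L by lia.
    rewrite !fact_simpl, !mult_INR, !S_INR, !plus_INR in U, L; simpl (INR 1) in U, L.
    set (N := INR n) in *. set (F := INR (fact n)) in *.
    set (p := prod_f_R0 (fun j => 2 + th + INR j) n) in *.
    assert (PF : 0 < F) by apply INR_fact_lt_0.
    unfold gauss; fold N F p.
    set (e := euler (2 + th)) in *.
    rewrite Rpower_plus. replace (Rpower N 2) with (N * N).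
    2: { replace 2 with (1 + 1) by ring; rewrite Rpower_plus, Rpower_1 by lra; ring. }
    pose proof (Rpower_pos N th) as PN.
    assert (PNN : 0 < N * N) by nra.
    assert (B1 : Rpower (N + 1 + 2) th <= Rpower N th * ((N + 3) / N)).
    { replace (N + 1 + 2) with (N * ((N + 3) / N)) by (field; lra).
      rewrite <- Rpower_mult_distr.
      2: lra.
      2: apply Rdiv_lt_0_compat; lra.
      apply Rmult_le_compat_l; [lra|]. apply Rpower_le_self; [|lra].
      apply (Rmult_le_reg_r N); [lra|]. unfold Rdiv.
      rewrite Rmult_assoc, Rinv_l by lra; lra. }
    assert (B2 : Rpower (N + 1 + 2 + th) (1 - th) * Rpower N th <= N + 4).
    { replace (N + 1 + 2 + th) with (N * ((N + 3 + th) / N)) by (field; lra).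
      rewrite <- Rpower_mult_distr.
      2: lra.
      2: apply Rdiv_lt_0_compat; lra.
      assert (B3 : Rpower ((N + 3 + th) / N) (1 - th) <= (N + 3 + th) / N).
      { apply Rpower_le_self; [|lra].
        apply (Rmult_le_reg_r N); [lra|]. unfold Rdiv.
        rewrite Rmult_assoc, Rinv_l by lra; lra. }
      replace (Rpower N (1 - th) * Rpower ((N + 3 + th) / N) (1 - th) * Rpower N th)
        with (Rpower N (1 - th) * Rpower N th * Rpower ((N + 3 + th) / N) (1 - th)) by ring.
      rewrite <- Rpower_plus. replace (1 - th + th) with 1 by ring.
      rewrite Rpower_1 by lra.
      apply Rle_trans with (N * ((N + 3 + th) / N)); [apply Rmult_le_compat_l; lra|].
      replace (N * ((N + 3 + th) / N)) with (N + 3 + th) by (field; lra); lra. }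
    unfold u, v; split.
    + apply (Rmult_le_reg_r (F * (N * N * Rpower N th) * e * (N + 4))).
      { repeat apply Rmult_lt_0_compat; lra. }
      replace (p / (F * (N * N * Rpower N th)) * (F * (N * N * Rpower N th) * e * (N + 4)))
        with (p * e * (N + 4)) by (field; repeat split; lra).
      replace ((1 + 3 * / N) * (1 + 2 * / N) * (1 + / N) / (1 + 4 * / N) / e *
               (F * (N * N * Rpower N th) * e * (N + 4)))
        with ((N + 3) * (N + 2) * (N + 1) * F * Rpower N th) by (field; repeat split; lra).
      apply Rle_trans with (p * e * (Rpower (N + 1 + 2 + th) (1 - th) * Rpower N th)).
      * replace ((N + 3) * (N + 2) * (N + 1) * F * Rpower N th)
          with ((N + 1 + 2) * ((N + 1 + 1) * ((N + 1) * F)) * Rpower N th) by ring.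
        replace (p * e * (Rpower (N + 1 + 2 + th) (1 - th) * Rpower N th))
          with (Rpower (N + 1 + 2 + th) (1 - th) * (p * e) * Rpower N th) by ring.
        apply Rmult_le_compat_r; lra.
      * apply Rmult_le_compat_l; [|exact B2].
        pose proof (Rpower_pos (N + 1 + 2 + th) (1 - th)).
        assert (0 <= (N + 1 + 2) * ((N + 1 + 1) * ((N + 1) * F)))
          by (repeat apply Rmult_le_pos; lra).
        nra.
    + apply (Rmult_le_reg_r (F * (N * N * Rpower N th) * e)).
      { repeat apply Rmult_lt_0_compat; lra. }
      replace (p / (F * (N * N * Rpower N th)) * (F * (N * N * Rpower N th) * e))
        with (p * e) by (field; repeat split; lra).
      eapply Rle_trans; [exact U|].
      apply Rle_trans with
        (Rpower N th * ((N + 3) / N) * ((N + 1 + 1) * ((N + 1) * F))).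
      * apply Rmult_le_compat_r; [|exact B1]. repeat apply Rmult_le_pos; lra.
      * right; field; lra.
  - replace (/ euler (2 + th)) with (v 0) by (unfold v; field; lra).
    apply (is_lim_seq_comp_inv v); [|reflexivity].
    apply @ex_derive_continuous; unfold v; auto_derive; lra.
  - replace (/ euler (2 + th)) with (u 0) by (unfold u; field; lra).
    apply (is_lim_seq_comp_inv u); [|reflexivity].
    apply @ex_derive_continuous; unfold u; auto_derive; lra.
Qed.

(** From [2,3] the recurrence reaches every real number in unit steps: a step down multiplies the
    limit by y and so passes through the poles of Gamma, a step up divides by y - 1 > 0. *)
Lemma gauss_ex_lim (z : R) : exists l : R, is_lim_seq (gauss z) l.
Proof.
  assert (H : forall n z, 2 - INR n <= z <= 3 + INR n ->
                exists l : R, is_lim_seq (gauss z) l).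
  { induction n as [|n IH]; intros y Hy.
    - simpl INR in Hy; exists (/ euler (2 + (y - 2))).
      replace (gauss y) with (gauss (2 + (y - 2))) by (f_equal; ring).
      apply gauss_lim_23; lra.
    - rewrite S_INR in Hy; pose proof (pos_INR n).
      destruct (Rlt_dec y (2 - INR n)) as [H1|H1].
      + destruct (IH (y + 1)) as [l Hl]; [lra|].
        exists (y * l); apply gauss_lim_pred, Hl.
      + destruct (Rlt_dec (3 + INR n) y) as [H2|H2]; [|apply IH; lra].
        destruct (IH (y - 1)) as [l Hl]; [lra|].
        exists (l / (y - 1)); replace (gauss y) with (gauss (y - 1 + 1)) by (f_equal; ring).
        apply gauss_lim_succ; [lra|exact Hl]. }
  destruct (INR_unbounded (Rabs z + 2)) as [n Hn].
  apply (H n). pose proof (Rle_abs z). pose proof (Rle_abs (- z)).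
  rewrite Rabs_Ropp in *; lra.
Qed.

Lemma gauss_lim (z : R) : is_lim_seq (gauss z) (inv_gamma z).
Proof.
  destruct (gauss_ex_lim z) as [l Hl].
  replace (inv_gamma z) with l; [exact Hl|].
  symmetry; change (real (Lim_seq (gauss z)) = real l).
  f_equal; apply is_lim_seq_unique, Hl.
Qed.

Lemma inv_gamma_unique (z l : R) : is_lim_seq (gauss z) l -> inv_gamma z = l.
Proof.
  intros H; change (real (Lim_seq (gauss z)) = real l).
  f_equal; apply is_lim_seq_unique, H.
Qed.

Lemma inv_gamma_succ (z : R) : inv_gamma z = z * inv_gamma (z + 1).
Proof. apply inv_gamma_unique, gauss_lim_pred, gauss_lim. Qed.

Lemma inv_gamma_euler (z : R) : 2 <= z -> 0 < euler z /\ inv_gamma z = / euler z.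
Proof.
  assert (H : forall n z, 2 <= z <= 3 + INR n -> 0 < euler z /\ inv_gamma z = / euler z).
  { induction n as [|n IH]; intros y Hy.
    - simpl INR in Hy; replace y with (2 + (y - 2)) by ring.
      split; [apply euler_pos_23; lra|apply inv_gamma_unique, gauss_lim_23; lra].
    - rewrite S_INR in Hy. destruct (Rle_dec y (3 + INR n)); [apply IH; lra|].
      pose proof (pos_INR n).
      destruct (IH (y - 1) ltac:(lra)) as [H1 H2].
      pose proof (inv_gamma_succ (y - 1)) as E1.
      pose proof (euler_succ (y - 1) ltac:(lra)) as E2.
      replace (y - 1 + 1) with y in E1, E2 by ring.
      split; [rewrite E2; apply Rmult_lt_0_compat; lra|].
      rewrite E2. apply (Rmult_eq_reg_l (y - 1)); [|lra].
      rewrite <- E1, H2; field; lra. }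
  intros Hz; destruct (INR_unbounded z) as [n Hn]; apply (H n); lra.
Qed.

(** * Wallis' integrals and the duplication formula *)

Definition wallis (n : nat) : R := RInt (fun t => sin t ^ n) 0 (PI / 2).

Lemma cont_sin_pow (n : nat) : continuity (fun t => sin t ^ n).
Proof.
  apply (cont_comp (fun x => x ^ n) sin); [|auto with cont].
  apply derivable_continuous, derivable_pow.
Qed.

Lemma wallis_succ2 (n : nat) : (INR n + 2) * wallis (S (S n)) = (INR n + 1) * wallis n.
Proof.
  assert (E : RInt (fun t => (INR n + 2) * sin t ^ S (S n) - (INR n + 1) * sin t ^ n)
                0 (PI / 2) = 0).
  { pose proof (cont_sin_pow n) as C1. pose proof (cont_sin_pow (S (S n))) as C2.
    rewrite (RInt_of_derive (fun t => - (cos t * sin t ^ S n))).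
    - eqR; rewrite cos_PI2, sin_0; simpl; ring.
    - intros t; auto_derive; [exact I|].
      change (match n with 0%nat => 1 | S _ => INR n + 1 end) with (INR (S n)).
      rewrite S_INR; simpl.
      pose proof (sin2_cos2 t) as SC; unfold Rsqr in SC.
      assert (CC : cos t * cos t = 1 - sin t * sin t) by lra.
      match goal with |- ?l = _ =>
        replace l with (sin t * sin t * sin t ^ n - (INR n + 1) * sin t ^ n * (cos t * cos t))
          by ring end.
      rewrite CC; ring.
    - apply cont_minus; apply (cont_mult (fun _ => _)); auto with cont. }
  rewrite (RInt_minus (fun t => (INR n + 2) * sin t ^ S (S n))
             (fun t => (INR n + 1) * sin t ^ n)) in E.
  2: apply ex_RInt_cont, (cont_mult (fun _ => _)); [auto with cont|apply cont_sin_pow].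
  2: apply ex_RInt_cont, (cont_mult (fun _ => _)); [auto with cont|apply cont_sin_pow].
  rewrite (RInt_scal (fun t => sin t ^ S (S n))) in E by (apply ex_RInt_cont, cont_sin_pow).
  rewrite (RInt_scal (fun t => sin t ^ n)) in E by (apply ex_RInt_cont, cont_sin_pow).
  change ((INR n + 2) * wallis (S (S n)) - (INR n + 1) * wallis n = 0) in E; lra.
Qed.

Lemma wallis_decr (n : nat) : wallis (S n) <= wallis n.
Proof.
  pose proof PI_RGT_0.
  apply RInt_le; [lra|apply ex_RInt_cont, cont_sin_pow|apply ex_RInt_cont, cont_sin_pow|].
  intros t Ht; simpl.
  pose proof (sin_ge_0 t ltac:(lra) ltac:(lra)). pose proof (SIN_bound t).
  pose proof (pow_le (sin t) n ltac:(lra)). nra.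
Qed.

Lemma wallis_0 : wallis 0 = PI / 2.
Proof.
  unfold wallis; simpl. rewrite RInt_const. change ((PI / 2 - 0) * 1 = PI / 2); ring.
Qed.

Lemma wallis_1 : wallis 1 = 1.
Proof.
  unfold wallis; rewrite (RInt_of_derive (fun t => - cos t)).
  - eqR; rewrite cos_PI2, cos_0; ring.
  - intros t; auto_derive; [exact I|ring].
  - apply cont_sin_pow.
Qed.

Lemma wallis_prod (n : nat) : (INR n + 1) * (wallis n * wallis (S n)) = PI / 2.
Proof.
  induction n as [|n IH].
  - rewrite wallis_0, wallis_1; simpl; ring.
  - rewrite <- IH, S_INR. pose proof (wallis_succ2 n).
    replace ((INR n + 1 + 1) * (wallis (S n) * wallis (S (S n))))
      with (wallis (S n) * ((INR n + 2) * wallis (S (S n)))) by ring.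
    rewrite H; ring.
Qed.

(** The reciprocal of the Wallis integral of index 2n + 1. It is the quotient of factorials left
    over when two Gauss products are interleaved into one. *)
Definition central (n : nat) : R := INR (fact (2 * n + 1)) / (4 ^ n * INR (fact n) ^ 2).

Lemma central_succ (n : nat) :
  central (S n) = central n * ((2 * INR n + 3) / (2 * INR n + 2)).
Proof.
  unfold central. replace (2 * S n + 1)%nat with (S (S (2 * n + 1))) by lia.
  rewrite !(fact_simpl (S (2 * n + 1))), !(fact_simpl (2 * n + 1)), (fact_simpl n),
    !mult_INR, !S_INR, plus_INR, mult_INR.
  simpl (INR 2); simpl (INR 1). simpl pow.
  pose proof (INR_fact_neq_0 n). pose proof (pow_lt 4 n ltac:(lra)). pose proof (pos_INR n).
  field; repeat split; lra.
Qed.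

Lemma wallis_central (n : nat) : wallis (2 * n + 1) * central n = 1.
Proof.
  induction n as [|n IH].
  - simpl (2 * 0 + 1)%nat; rewrite wallis_1; unfold central; simpl; field.
  - replace (2 * S n + 1)%nat with (S (S (2 * n + 1))) by lia.
    pose proof (wallis_succ2 (2 * n + 1)) as H.
    rewrite plus_INR, mult_INR in H; simpl (INR 2) in H; simpl (INR 1) in H.
    rewrite central_succ. pose proof (pos_INR n).
    transitivity (((2 * INR n + 1 + 2) * wallis (S (S (2 * n + 1)))) * central n
                  / (2 * INR n + 2)).
    + field; lra.
    + replace (1 + 1) with 2 in H by ring. rewrite H.
      transitivity ((wallis (2 * n + 1) * central n)); [field; lra|exact IH].
Qed.

Lemma central_pos (n : nat) : 0 < central n.
Proof.
  unfold central; apply Rdiv_lt_0_compat; [apply INR_fact_lt_0|].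
  apply Rmult_lt_0_compat; [apply pow_lt; lra|apply pow_lt, INR_fact_lt_0].
Qed.

(** With W the Wallis integrals, (j+1) W_j W_(j+1) = pi/2 at j = 2n and j = 2n + 1, together with
    monotonicity of W, encloses W_(2n+1)^2 between pi/(2(2n+2)) and pi/(2(2n+1)). This is where
    sqrt(pi) enters. *)
Lemma central_bounds (n : nat) :
  2 / PI * (2 * INR n + 1) <= central n ^ 2 <= 2 / PI * (2 * INR n + 2).
Proof.
  pose proof PI_RGT_0 as HP. pose proof (pos_INR n) as Hn.
  pose proof (central_pos n) as C.
  assert (Pw : wallis (2 * n + 1) = / central n).
  { apply (Rmult_eq_reg_r (central n)); [|lra].
    rewrite wallis_central, Rinv_l; lra. }
  pose proof (Rinv_0_lt_compat _ C) as Ci.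
  pose proof (wallis_prod (2 * n)) as E1.
  pose proof (wallis_prod (2 * n + 1)) as E2.
  pose proof (wallis_decr (2 * n)) as D1.
  pose proof (wallis_decr (2 * n + 1)) as D2.
  replace (S (2 * n)) with (2 * n + 1)%nat in * by lia.
  rewrite Pw in *. rewrite plus_INR in E2. rewrite mult_INR in E1, E2.
  simpl (INR 2) in *; simpl (INR 1) in *. replace (1 + 1) with 2 in * by ring.
  set (N := INR n) in *. set (c := central n) in *. set (i := / c) in *.
  assert (Ec : c * i = 1) by (unfold i; field; lra).
  assert (G1 : (2 * N + 1) * i ^ 2 <= PI / 2).
  { rewrite <- E1; apply Rmult_le_compat_l; [lra|].
    nra. }
  assert (G2 : PI / 2 <= (2 * N + 2) * i ^ 2).
  { rewrite <- E2. replace (2 * N + 1 + 1) with (2 * N + 2) by ring.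
    apply Rmult_le_compat_l; [lra|].
    nra. }
  assert (Ei : c ^ 2 * i ^ 2 = 1).
  { replace (c ^ 2 * i ^ 2) with ((c * i) ^ 2) by ring; rewrite Ec; ring. }
  assert (Pc : 0 < c ^ 2) by (apply pow_lt; lra).
  split.
  - apply (Rmult_le_reg_r (PI / 2)); [lra|].
    replace (2 / PI * (2 * N + 1) * (PI / 2)) with (2 * N + 1) by (field; lra).
    apply (Rmult_le_compat_l (c ^ 2)) in G1; [|lra].
    replace (c ^ 2 * ((2 * N + 1) * i ^ 2)) with ((2 * N + 1) * (c ^ 2 * i ^ 2)) in G1 by ring.
    rewrite Ei in G1; lra.
  - apply (Rmult_le_reg_r (PI / 2)); [lra|].
    replace (2 / PI * (2 * N + 2) * (PI / 2)) with (2 * N + 2) by (field; lra).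
    apply (Rmult_le_compat_l (c ^ 2)) in G2; [|lra].
    replace (c ^ 2 * ((2 * N + 2) * i ^ 2)) with ((2 * N + 2) * (c ^ 2 * i ^ 2)) in G2 by ring.
    rewrite Ei in G2; lra.
Qed.

Lemma central_lim : is_lim_seq (fun n => central n / sqrt (INR n)) (2 / sqrt PI).
Proof.
  pose proof PI_RGT_0 as HP.
  assert (HS : 0 < sqrt PI) by (apply sqrt_lt_R0; lra).
  assert (H2 : is_lim_seq (fun n => central n ^ 2 / INR n) (4 / PI)).
  { set (u := fun x => 2 / PI * (2 + x)). set (v := fun x => 2 / PI * (2 + 2 * x)).
    apply (is_lim_seq_le_le_loc (fun n => u (/ INR n)) _ (fun n => v (/ INR n))).
    - exists 1%nat; intros n Hn; assert (0 < INR n) by (apply lt_0_INR; lia).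
      pose proof (central_bounds n) as [B1 B2].
      pose proof (Rinv_0_lt_compat (INR n) ltac:(lra)) as I.
      unfold u, v; split.
      + replace (2 / PI * (2 + / INR n)) with (2 / PI * (2 * INR n + 1) * / INR n)
          by (field; lra). apply Rmult_le_compat_r; lra.
      + replace (2 / PI * (2 + 2 * / INR n)) with (2 / PI * (2 * INR n + 2) * / INR n)
          by (field; lra). apply Rmult_le_compat_r; lra.
    - replace (4 / PI) with (u 0) by (unfold u; field; lra).
      apply (is_lim_seq_comp_inv u); [|reflexivity].
      apply @ex_derive_continuous; unfold u; auto_derive; lra.
    - replace (4 / PI) with (v 0) by (unfold v; field; lra).
      apply (is_lim_seq_comp_inv v); [|reflexivity].
      apply @ex_derive_continuous; unfold v; auto_derive; lra. }
  apply (is_lim_seq_ext_loc (fun n => sqrt (central n ^ 2 / INR n))).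
  - exists 1%nat; intros n Hn; assert (0 < INR n) by (apply lt_0_INR; lia).
    rewrite sqrt_div_alt, sqrt_pow2 by (lra || (apply Rlt_le, central_pos)); reflexivity.
  - replace (2 / sqrt PI) with (sqrt (4 / PI)).
    + apply (is_lim_seq_continuous sqrt); [|exact H2].
      apply continuity_pt_sqrt, Rlt_le, Rdiv_lt_0_compat; lra.
    + rewrite sqrt_div_alt by lra; f_equal.
      replace 4 with (2 ^ 2) by ring; apply sqrt_pow2; lra.
Qed.

Lemma prod_duplication (z : R) (n : nat) :
  prod_f_R0 (fun j => z + INR j) n * prod_f_R0 (fun j => z + / 2 + INR j) n * 4 ^ S n
  = prod_f_R0 (fun j => 2 * z + INR j) (2 * n + 1).
Proof.
  induction n as [|n IH].
  - simpl; field.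
  - replace (2 * S n + 1)%nat with (S (S (2 * n + 1))) by lia.
    rewrite !prod_f_R0_S, <- IH, !S_INR, plus_INR, mult_INR.
    simpl (INR 2); simpl (INR 1). simpl pow. field.
Qed.

(** The n + 1 factors at z and the n + 1 factors at z + 1/2 interleave into the 2n + 2 factors at
    2z, hence the index 2n + 1. The rest is [central n] over sqrt n and a power of (2n+1)/n, with
    limits 2/sqrt(pi) and 2^(2z). *)
Lemma inv_gamma_duplication (z : R) :
  inv_gamma z * inv_gamma (z + / 2) =
  inv_gamma (2 * z) * (/ (2 * sqrt PI) * Rpower 4 z).
Proof.
  pose proof PI_RGT_0 as HP.
  assert (HS : 0 < sqrt PI) by (apply sqrt_lt_R0; lra).
  assert (L1 : is_lim_seq (fun n => gauss z n * gauss (z + / 2) n)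
                 (inv_gamma z * inv_gamma (z + / 2)))
    by (apply is_lim_seq_mult'; apply gauss_lim).
  assert (L2 : is_lim_seq (fun n => gauss (2 * z) (2 * n + 1) *
      ((central n / sqrt (INR n)) / 4 * Rpower ((2 * INR n + 1) / INR n) (2 * z)))
      (inv_gamma (2 * z) * (2 / sqrt PI / 4 * Rpower 2 (2 * z)))).
  { apply is_lim_seq_mult'.
    - apply (is_lim_seq_subseq (gauss (2 * z)) _ (fun n => (2 * n + 1)%nat));
        [|apply gauss_lim].
      apply eventually_subseq; intros n; lia.
    - apply is_lim_seq_mult'.
      + apply (is_lim_seq_scal_r _ (/ 4) (2 / sqrt PI)), central_lim.
      + replace (Rpower 2 (2 * z)) with ((fun x => Rpower (2 + x) (2 * z)) 0)
          by (cbv beta; f_equal; ring).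
        apply (is_lim_seq_comp_inv (fun x => Rpower (2 + x) (2 * z))).
        * apply @ex_derive_continuous; unfold Rpower; auto_derive; lra.
        * intros n Hn; assert (0 < INR n) by (apply lt_0_INR; lia); f_equal; field; lra. }
  replace (/ (2 * sqrt PI) * Rpower 4 z) with (2 / sqrt PI / 4 * Rpower 2 (2 * z)).
  - assert (E : Finite (inv_gamma z * inv_gamma (z + / 2)) =
            Finite (inv_gamma (2 * z) * (2 / sqrt PI / 4 * Rpower 2 (2 * z)))).
    { rewrite <- (is_lim_seq_unique _ _ L1), <- (is_lim_seq_unique _ _ L2).
      apply Lim_seq_ext_loc. exists 1%nat; intros n Hn.
      assert (Hn0 : 0 < INR n) by (apply lt_0_INR; lia).
      unfold gauss, central.
      pose proof (INR_fact_lt_0 n). pose proof (INR_fact_lt_0 (2 * n + 1)).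
      pose proof (prod_duplication z n) as D. rewrite <- D.
      rewrite plus_INR, mult_INR. simpl (INR 2); simpl (INR 1).
      replace (1 + 1) with 2 by ring.
      rewrite Rpower_plus. replace (Rpower (INR n) (/ 2)) with (sqrt (INR n))
        by (symmetry; apply Rpower_sqrt; lra).
      assert (ER : Rpower (2 * INR n + 1) (2 * z) =
        Rpower ((2 * INR n + 1) / INR n) (2 * z) * (Rpower (INR n) z * Rpower (INR n) z)).
      { rewrite <- Rpower_plus. replace (z + z) with (2 * z) by ring.
        rewrite Rpower_mult_distr.
        - f_equal; field; lra.
        - apply Rdiv_lt_0_compat; lra.
        - lra. }
      rewrite ER.
      pose proof (Rpower_pos ((2 * INR n + 1) / INR n) (2 * z)).
      pose proof (Rpower_pos (INR n) z).
      pose proof (sqrt_lt_R0 _ Hn0). pose proof (pow_lt 4 n ltac:(lra)).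
      simpl pow. field; repeat split; lra. }
    injection E; auto.
  - replace 4 with (2 * 2) at 2 by ring.
    rewrite <- Rpower_mult_distr by lra. rewrite <- Rpower_plus.
    replace (z + z) with (2 * z) by ring. field; lra.
Qed.

(** * Bessel functions of the first kind *)

Definition coef (nu : R) (j : nat) : R :=
  (-1) ^ j / INR (fact j) * inv_gamma (nu + INR j + 1).

(* [bessel_J nu x = (x/2)^nu * Jentire nu ((x/2)^2)] with [Jentire nu] entire. *)
Definition Jentire (nu w : R) : R := PSeries (coef nu) w.

(** Once the argument exceeds 1 the recurrence makes |1/Gamma| nonincreasing along unit steps; the
    finitely many earlier values are covered by a maximum. A crude bound suffices, as 1/j! supplies
    the convergence of the series. *)
Lemma inv_gamma_bounded (nu : R) :
  exists C, 0 <= C /\ forall j, Rabs (inv_gamma (nu + INR j + 1)) <= C.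
Proof.
  assert (Hfin : forall N, exists C, 0 <= C /\
            forall j, (j <= N)%nat -> Rabs (inv_gamma (nu + INR j + 1)) <= C).
  { induction N as [|N [C [HC H]]].
    - exists (Rabs (inv_gamma (nu + INR 0 + 1))); split; [apply Rabs_pos|].
      intros j Hj; replace j with 0%nat by lia; lra.
    - exists (Rmax C (Rabs (inv_gamma (nu + INR (S N) + 1)))); split.
      + eapply Rle_trans; [exact HC|apply Rmax_l].
      + intros j Hj; destruct (Nat.eq_dec j (S N)) as [->|]; [apply Rmax_r|].
        eapply Rle_trans; [apply H; lia|apply Rmax_l]. }
  destruct (INR_unbounded (- nu)) as [N HN].
  destruct (Hfin N) as [C [HC H]]; exists C; split; [exact HC|].
  intros j; destruct (Compare_dec.le_lt_dec j N) as [Hj|Hj]; [apply H, Hj|].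
  assert (G : forall k, Rabs (inv_gamma (nu + INR (N + k) + 1)) <= C).
  { induction k as [|k IH]; [rewrite Nat.add_0_r; apply H; lia|].
    rewrite inv_gamma_succ, Rabs_mult in IH.
    assert (INR N <= INR (N + k)) by (apply le_INR; lia).
    rewrite Rabs_pos_eq in IH by lra.
    rewrite Nat.add_succ_r, S_INR.
    replace (nu + INR (N + k) + 1 + 1) with (nu + (INR (N + k) + 1) + 1) in IH by ring.
    pose proof (Rabs_pos (inv_gamma (nu + (INR (N + k) + 1) + 1))). nra. }
  replace j with (N + (j - N))%nat by lia; apply G.
Qed.

Lemma coef_CV_disk (nu r : R) : CV_disk (coef nu) r.
Proof.
  destruct (inv_gamma_bounded nu) as [C [HC H]].
  apply (ex_series_le (K := R_AbsRing) (V := R_CompleteNormedModule) _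
           (fun j => C * (Rabs r ^ j * / INR (fact j)))).
  - intros j. change (Rabs (Rabs (coef nu j * r ^ j)) <= C * (Rabs r ^ j * / INR (fact j))).
    rewrite Rabs_Rabsolu; unfold coef, Rdiv.
    rewrite !Rabs_mult, pow_1_abs, <- RPow_abs.
    pose proof (Rinv_0_lt_compat _ (INR_fact_lt_0 j)).
    rewrite (Rabs_pos_eq (/ INR (fact j))) by lra.
    replace (C * (Rabs r ^ j * / INR (fact j)))
      with (/ INR (fact j) * Rabs r ^ j * C) by ring.
    replace (1 * / INR (fact j) * Rabs (inv_gamma (nu + INR j + 1)) * Rabs r ^ j)
      with (/ INR (fact j) * Rabs r ^ j * Rabs (inv_gamma (nu + INR j + 1))) by ring.
    apply Rmult_le_compat_l; [|apply H].
    apply Rmult_le_pos; [lra|apply pow_le, Rabs_pos].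
  - apply (ex_series_scal_l (K := R_AbsRing) C (fun j => Rabs r ^ j * / INR (fact j))).
    exists (exp (Rabs r)).
    apply (is_series_ext (fun j => scal (pow_n (Rabs r) j) (/ INR (fact j)))).
    + intros j; rewrite pow_n_pow; reflexivity.
    + exact (is_exp_Reals (Rabs r)).
Qed.

Lemma coef_CV_radius (nu w : R) : Rbar_lt (Rabs w) (CV_radius (coef nu)).
Proof.
  destruct (Rbar_lt_dec (Rabs w) (CV_radius (coef nu))) as [H|H]; [exact H|exfalso].
  apply Rbar_not_lt_le in H.
  apply (CV_disk_outside (coef nu) (Rabs w + 1)).
  - eapply Rbar_le_lt_trans; [exact H|].
    rewrite (Rabs_pos_eq (Rabs w + 1)) by (pose proof (Rabs_pos w); lra); simpl; lra.
  - apply ex_series_lim_0, ex_series_Rabs, coef_CV_disk.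
Qed.

Lemma ex_coef (nu w : R) : ex_pseries (coef nu) w.
Proof. apply CV_disk_correct, coef_CV_disk. Qed.

Lemma coef_derive (nu : R) (j : nat) : PS_derive (coef nu) j = - coef (nu + 1) j.
Proof.
  unfold PS_derive, coef. rewrite fact_simpl, mult_INR.
  replace (nu + INR (S j) + 1) with (nu + 1 + INR j + 1) by (rewrite S_INR; ring).
  pose proof (INR_fact_neq_0 j). pose proof (not_0_INR (S j) ltac:(lia)).
  simpl pow; field; split; assumption.
Qed.

Lemma coef_pred (nu : R) (j : nat) : coef (nu - 1) j = (nu + INR j) * coef nu j.
Proof.
  unfold coef. replace (nu - 1 + INR j + 1) with (nu + INR j) by ring.
  rewrite (inv_gamma_succ (nu + INR j)); ring.
Qed.

Lemma Jentire_is_derive (nu w : R) : is_derive (Jentire nu) w (- Jentire (nu + 1) w).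
Proof.
  unfold Jentire at 2. rewrite <- PSeries_opp.
  rewrite (PSeries_ext _ (PS_derive (coef nu))).
  - apply is_derive_PSeries, coef_CV_radius.
  - intros j; rewrite coef_derive; reflexivity.
Qed.

(** The recurrence of 1/Gamma read coefficientwise. With [Jentire_is_derive] it yields all Bessel
    recurrences at once for every real order, since 1/Gamma has no poles. *)
Lemma Jentire_pred (nu w : R) :
  Jentire (nu - 1) w = nu * Jentire nu w - w * Jentire (nu + 1) w.
Proof.
  unfold Jentire.
  rewrite <- (PSeries_scal nu), <- PSeries_incr_1, <- PSeries_minus.
  - apply PSeries_ext; intros j.
    unfold PS_minus, PS_plus, PS_opp, PS_scal, PS_incr_1.
    rewrite coef_pred; destruct j as [|j].
    + change ((nu + INR 0) * coef nu 0 = nu * coef nu 0 + - 0); simpl; ring.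
    + change ((nu + INR (S j)) * coef nu (S j) = nu * coef nu (S j) + - coef (nu + 1) j).
      rewrite <- coef_derive; unfold PS_derive; ring.
  - apply ex_pseries_scal; [apply Rmult_comm|apply ex_coef].
  - apply ex_pseries_incr_1, ex_coef.
Qed.

Lemma bessel_J_entire (nu x : R) :
  bessel_J nu x = Rpower (x / 2) nu * Jentire nu ((x / 2) ^ 2).
Proof.
  unfold bessel_J, Jentire, PSeries; f_equal; apply Series_ext; intros j.
  unfold coef; rewrite <- pow_mult; reflexivity.
Qed.

(** The factor sqrt x removes the first-order term from Bessel's equation. *)
Definition fJ (nu x : R) : R := sqrt x * bessel_J nu x.

Lemma bessel_J_three_term (nu x : R) : 0 < x ->
  bessel_J (nu - 1) x = 2 * nu / x * bessel_J nu x - bessel_J (nu + 1) x.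
Proof.
  intros Hx; rewrite !bessel_J_entire, Jentire_pred.
  unfold Rminus; rewrite !Rpower_plus, Rpower_Ropp, !Rpower_1 by lra.
  field; lra.
Qed.

Lemma bessel_J_is_derive (nu x : R) : 0 < x ->
  is_derive (bessel_J nu) x (nu / x * bessel_J nu x - bessel_J (nu + 1) x).
Proof.
  intros Hx.
  apply (is_derive_ext (fun y => Rpower (y / 2) nu * Jentire nu ((y / 2) ^ 2))).
  { intros y; rewrite bessel_J_entire; reflexivity. }
  unfold Rpower; auto_derive.
  - split; [lra|]. split; [eexists; apply Jentire_is_derive|exact I].
  - rewrite (Derive_eta _ _ _ (Jentire_is_derive nu _)).
    rewrite !bessel_J_entire, Rpower_plus, Rpower_1 by lra.
    change (x * / 2 * (x * / 2 * 1)) with ((x / 2) ^ 2).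
    change (x * / 2) with (x / 2).
    fold (Rpower (x / 2) nu). field; lra.
Qed.

Lemma fJ_is_derive (nu x : R) : 0 < x ->
  is_derive (fJ nu) x ((nu + / 2) / x * fJ nu x - fJ (nu + 1) x).
Proof.
  intros Hx; pose proof (bessel_J_is_derive nu x Hx) as D.
  pose proof (sqrt_lt_R0 x Hx) as Hs.
  unfold fJ; auto_derive.
  - split; [lra|]. split; [eexists; exact D|exact I].
  - rewrite (Derive_eta _ _ _ D).
    assert (E : x = sqrt x * sqrt x) by (rewrite sqrt_sqrt; lra).
    set (s := sqrt x) in *.
    rewrite E; field; lra.
Qed.

Lemma fJ_three_term (nu x : R) : 0 < x ->
  fJ (nu - 1) x = 2 * nu / x * fJ nu x - fJ (nu + 1) x.
Proof. intros Hx; unfold fJ; rewrite bessel_J_three_term by exact Hx; ring. Qed.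

Lemma fJ_is_derive' (nu x : R) : 0 < x ->
  is_derive (fJ nu) x (fJ (nu - 1) x - (nu - / 2) / x * fJ nu x).
Proof.
  intros Hx.
  replace (fJ (nu - 1) x - (nu - / 2) / x * fJ nu x)
    with ((nu + / 2) / x * fJ nu x - fJ (nu + 1) x).
  - apply fJ_is_derive, Hx.
  - rewrite fJ_three_term by exact Hx; field; lra.
Qed.

(** The derivative is carried along as an explicit function, so that energy and phase are built
    without [Derive]. *)
Definition bessel_ode (k : R) (f df : R -> R) : Prop :=
  forall x, 0 < x -> is_derive f x (df x) /\ is_derive df x ((k / x ^ 2 - 1) * f x).

Definition dfJ (nu x : R) : R := fJ (nu - 1) x - (nu - / 2) / x * fJ nu x.

(** Lowering from nu and raising from nu - 1 are both first-order formulas; used one after the other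
    they bring the second derivative back to order nu. *)
Lemma fJ_ode (nu : R) : bessel_ode (nu ^ 2 - / 4) (fJ nu) (dfJ nu).
Proof.
  intros x Hx; split; [apply fJ_is_derive', Hx|].
  pose proof (fJ_is_derive (nu - 1) x Hx) as D1.
  pose proof (fJ_is_derive' nu x Hx) as D2.
  unfold dfJ; auto_derive.
  - split; [eexists; exact D1|]. split; [lra|]. split; [eexists; exact D2|exact I].
  - rewrite (Derive_eta _ _ _ D1), (Derive_eta _ _ _ D2).
    replace (nu - 1 + 1) with nu by ring. field; lra.
Qed.

(** * Solutions of f'' = (k / x^2 - 1) f at infinity *)

(** Constant along solutions of f'' = -f; the term k/x^2 perturbs it by an integrable relative
    amount. *)
Definition energy (f df : R -> R) (x : R) : R := f x ^ 2 + df x ^ 2.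

Lemma energy_is_derive (k : R) (f df : R -> R) (x : R) :
  bessel_ode k f df -> 0 < x ->
  is_derive (energy f df) x (2 * k / x ^ 2 * f x * df x).
Proof.
  intros H Hx; destruct (H x Hx) as [D1 D2].
  unfold energy; auto_derive.
  - split; [eexists; exact D1|split; [eexists; exact D2|exact I]].
  - rewrite (Derive_eta _ _ _ D1), (Derive_eta _ _ _ D2); field; lra.
Qed.

Lemma energy_derive_bound (k : R) (f df : R -> R) (x : R) : 0 < x ->
  Rabs (2 * k / x ^ 2 * f x * df x) <= Rabs k / x ^ 2 * energy f df x.
Proof.
  intros Hx. assert (Hx2 : 0 < / x ^ 2) by (apply Rinv_0_lt_compat; nra).
  replace (2 * k / x ^ 2 * f x * df x) with (k * (/ x ^ 2) * (2 * f x * df x))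
    by (unfold Rdiv; ring).
  rewrite !Rabs_mult, (Rabs_pos_eq (/ x ^ 2)) by lra.
  unfold Rdiv; apply Rmult_le_compat_l.
  - apply Rmult_le_pos; [apply Rabs_pos|lra].
  - rewrite <- !Rabs_mult; unfold energy.
    pose proof (pow2_ge_0 (f x - df x)). pose proof (pow2_ge_0 (f x + df x)).
    apply Rabs_le; split; lra.
Qed.

Lemma Rabs_le_of_sqr (x B : R) : x ^ 2 <= B -> Rabs x <= B + 1.
Proof. intros H; apply Rabs_le; split; nra. Qed.

Lemma bessel_ode_bounded (k : R) (f df : R -> R) (x0 : R) :
  bessel_ode k f df -> 0 < x0 ->
  exists M, 0 <= M /\ forall x, x0 <= x -> Rabs (f x) <= M /\ Rabs (df x) <= M.
Proof.
  intros H H0.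
  set (B := energy f df x0 * exp (Rabs k / x0)).
  assert (HB : 0 <= B).
  { apply Rmult_le_pos; [unfold energy; nra|apply Rlt_le, exp_pos]. }
  exists (B + 1); split; [lra|]; intros x Hx.
  destruct (gronwall_inv_sqr (energy f df) (fun x => 2 * k / x ^ 2 * f x * df x)
              (Rabs k) x0 x) as [G _]; [lra| | |].
  - intros t Ht; apply (energy_is_derive k); [exact H|lra].
  - intros t Ht; apply energy_derive_bound; lra.
  - fold B in G.
    assert (1 <= exp (Rabs k / x)).
    { pose proof (exp_ineq1_le (Rabs k / x)).
      assert (0 <= Rabs k / x); [|lra].
      apply Rmult_le_pos; [apply Rabs_pos|apply Rlt_le, Rinv_0_lt_compat; lra]. }
    assert (energy f df x <= B) by (unfold energy in *; nra).
    unfold energy in *; split; apply Rabs_le_of_sqr; nra.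
Qed.

(** Variation of constants: f = [cos_part] cos x + [sin_part] sin x, so the limits of the two parts
    encode amplitude and phase of f at infinity. *)
Definition cos_part (f df : R -> R) (x : R) : R := f x * cos x - df x * sin x.
Definition sin_part (f df : R -> R) (x : R) : R := f x * sin x + df x * cos x.

Lemma parts_is_derive (k : R) (f df : R -> R) (x : R) :
  bessel_ode k f df -> 0 < x ->
  is_derive (cos_part f df) x (- (k / x ^ 2 * f x * sin x)) /\
  is_derive (sin_part f df) x (k / x ^ 2 * f x * cos x).
Proof.
  intros H Hx; destruct (H x Hx) as [D1 D2].
  unfold cos_part, sin_part; split; auto_derive;
    try (split; [eexists; exact D1|split; [eexists; exact D2|exact I]]);
    rewrite (Derive_eta _ _ _ D1), (Derive_eta _ _ _ D2); field; lra.
Qed.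

(** The derivatives of both parts are k f / x^2 times a sine or cosine, and f is bounded on [1, oo),
    so they are O(1/x^2). *)
Lemma bessel_ode_asymptotics (k : R) (f df : R -> R) :
  bessel_ode k f df ->
  exists al be C : R, 0 <= C /\
    is_lim (cos_part f df) p_infty al /\ is_lim (sin_part f df) p_infty be /\
    forall x, 1 <= x -> Rabs (cos_part f df x - al) <= C / x /\
                        Rabs (sin_part f df x - be) <= C / x.
Proof.
  intros H. destruct (bessel_ode_bounded k f df 1 H ltac:(lra)) as [M [HM HB]].
  assert (G : forall x c, 1 <= x -> -1 <= c <= 1 ->
                Rabs (k / x ^ 2 * f x * c) <= (Rabs k * M) / x ^ 2).
  { intros x c Hx Hc. destruct (HB x Hx) as [B1 _].
    assert (Hx2 : 0 < / x ^ 2) by (apply Rinv_0_lt_compat; nra).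
    unfold Rdiv; rewrite !Rabs_mult, (Rabs_pos_eq (/ x ^ 2)) by lra.
    assert (Rabs c <= 1) by (apply Rabs_le; lra).
    pose proof (Rabs_pos k). pose proof (Rabs_pos c). pose proof (Rabs_pos (f x)).
    replace (Rabs k * / x ^ 2 * Rabs (f x) * Rabs c)
      with ((Rabs k * / x ^ 2) * (Rabs (f x) * Rabs c)) by ring.
    replace (Rabs k * M * / x ^ 2) with ((Rabs k * / x ^ 2) * M) by ring.
    apply Rmult_le_compat_l; [apply Rmult_le_pos; lra|nra]. }
  destruct (is_lim_of_derive_inv_sqr (cos_part f df)
      (fun x => - (k / x ^ 2 * f x * sin x)) (Rabs k * M) 1) as [al [L1 B1]]; [lra| | |].
  { intros x Hx; apply parts_is_derive; [exact H|lra]. }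
  { intros x Hx; rewrite Rabs_Ropp; apply G; [exact Hx|apply SIN_bound]. }
  destruct (is_lim_of_derive_inv_sqr (sin_part f df)
      (fun x => k / x ^ 2 * f x * cos x) (Rabs k * M) 1) as [be [L2 B2]]; [lra| | |].
  { intros x Hx; apply (parts_is_derive k); [exact H|lra]. }
  { intros x Hx; apply G; [exact Hx|apply COS_bound]. }
  exists al, be, (Rabs k * M); repeat split; try assumption; try (apply B1 || apply B2; assumption).
  apply Rmult_le_pos; [apply Rabs_pos|exact HM].
Qed.

(** * The Laplace transform of t^nu J_nu(t) near its singularity at i *)

(** This is t^nu J_nu(t) for t > 0, written as a cut-off power times an entire function so that it
    extends continuously by 0 to t <= 0. *)
Definition gJ (nu t : R) : R :=
  pw (2 * nu) t * (Rpower 2 (- nu) * Jentire nu ((t / 2) ^ 2)).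

Lemma gJ_pos (nu t : R) : 0 < t -> gJ nu t = pw (nu - / 2) t * fJ nu t.
Proof.
  intros Ht; unfold gJ, fJ; rewrite bessel_J_entire, !pw_pos by lra.
  rewrite <- (Rpower_sqrt t) by lra.
  assert (E1 : Rpower t (nu - / 2) * Rpower t (/ 2) = Rpower t nu)
    by (rewrite <- Rpower_plus; f_equal; ring).
  assert (E2 : Rpower t nu = Rpower (t / 2) nu * Rpower 2 nu).
  { rewrite Rpower_mult_distr by lra; f_equal; field. }
  replace (2 * nu) with (nu + nu) by ring.
  rewrite Rpower_plus, Rpower_Ropp, <- Rmult_assoc, <- (Rmult_assoc (Rpower t (nu - / 2))), E1.
  rewrite E2 at 2. pose proof (Rpower_pos 2 nu).
  field; lra.
Qed.

Lemma gJ_is_derive (nu t : R) : 1 < 2 * nu -> is_derive (gJ nu) t (t * gJ (nu - 1) t).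
Proof.
  intros Hnu.
  pose proof (pw_is_derive (2 * nu) t Hnu) as D1.
  unfold gJ; auto_derive.
  - split; [eexists; exact D1|split; [eexists; apply Jentire_is_derive|exact I]].
  - rewrite (Derive_eta _ _ _ D1), (Derive_eta _ _ _ (Jentire_is_derive nu _)).
    change (t * / 2 * (t * / 2 * 1)) with ((t / 2) ^ 2).
    change (t * / 2) with (t / 2).
    rewrite Jentire_pred.
    replace (- (nu - 1)) with (- nu + 1) by ring.
    rewrite Rpower_plus, Rpower_1 by lra.
    replace (t * (pw (2 * (nu - 1)) t * (Rpower 2 (- nu) * 2 *
        (nu * Jentire nu ((t / 2) ^ 2) - (t / 2) ^ 2 * Jentire (nu + 1) ((t / 2) ^ 2)))))
      with (t * pw (2 * (nu - 1)) t * (Rpower 2 (- nu) * 2 *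
        (nu * Jentire nu ((t / 2) ^ 2) - (t / 2) ^ 2 * Jentire (nu + 1) ((t / 2) ^ 2)))) by ring.
    rewrite pw_mult.
    replace (2 * (nu - 1) + 1) with (2 * nu - 1) by ring.
    replace (pw (2 * nu) t) with (t * pw (2 * nu - 1) t)
      by (rewrite pw_mult; f_equal; ring).
    field.
Qed.

Lemma cont_Jentire_sqr (nu : R) : continuity (fun t => Jentire nu ((t / 2) ^ 2)).
Proof.
  apply (cont_comp (Jentire nu) (fun t => (t / 2) ^ 2)).
  - apply (continuity_of_derive _ _ (Jentire_is_derive nu)).
  - apply (continuity_of_derive _ (fun t => t / 2)); intros t; auto_derive; [exact I|field].
Qed.

Lemma cont_gJ (nu : R) : 0 < nu -> continuity (gJ nu).
Proof.
  intros H; apply cont_mult; [apply cont_pw; lra|].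
  apply (cont_mult (fun _ => _)); [auto with cont|apply cont_Jentire_sqr].
Qed.

Lemma continuity_bounded_01 (f : R -> R) :
  continuity f -> exists C, 0 <= C /\ forall t, 0 <= t <= 1 -> Rabs (f t) <= C.
Proof.
  intros H.
  destruct (continuity_ab_maj (fun t => Rabs (f t)) 0 1 ltac:(lra)) as [m [Hm _]].
  - intros t _; apply cont_abs, H.
  - exists (Rabs (f m)); split; [apply Rabs_pos|exact Hm].
Qed.

Lemma pw_le_1 (a b t : R) : a <= b -> 0 <= t <= 1 -> pw b t <= pw a t.
Proof.
  intros Hab Ht; destruct (Req_dec t 0) as [->|]; [rewrite !pw_nonpos; lra|].
  rewrite !pw_pos by lra; unfold Rpower.
  assert (ln t <= 0) by (rewrite <- ln_1; apply ln_le; lra).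
  apply exp_le; nra.
Qed.

Lemma pw_ge_1 (a b t : R) : a <= b -> 1 <= t -> pw a t <= pw b t.
Proof.
  intros Hab Ht; rewrite !pw_pos by lra; unfold Rpower.
  assert (0 <= ln t) by (rewrite <- ln_1; apply ln_le; lra).
  apply exp_le; nra.
Qed.

(** Up to 1 the factor t^(2 nu) lies below t^(nu - 1/2); beyond 1 the bound is the boundedness of
    [fJ nu]. A single power on the whole half-line then serves as dominating function. *)
Lemma gJ_bounded (nu : R) : 0 < nu ->
  exists C, 0 <= C /\ forall t, 0 <= t -> Rabs (gJ nu t) <= C * pw (nu - / 2) t.
Proof.
  intros Hnu.
  destruct (continuity_bounded_01 (fun t => Rpower 2 (- nu) * Jentire nu ((t / 2) ^ 2)))
    as [C1 [HC1 H1]].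
  { apply (cont_mult (fun _ => _)); [auto with cont|apply cont_Jentire_sqr]. }
  destruct (bessel_ode_bounded _ _ _ 1 (fJ_ode nu) ltac:(lra)) as [M [HM H2]].
  exists (C1 + M); split; [lra|]; intros t Ht.
  pose proof (pw_ge0 (nu - / 2) t) as P1.
  destruct (Rle_dec t 1) as [Ht1|Ht1].
  - unfold gJ; rewrite Rabs_mult, (Rabs_pos_eq (pw _ _)) by apply pw_ge0.
    specialize (H1 t ltac:(lra)).
    pose proof (pw_le_1 (nu - / 2) (2 * nu) t ltac:(lra) ltac:(lra)) as P2.
    pose proof (pw_ge0 (2 * nu) t).
    apply Rle_trans with (pw (nu - / 2) t * C1); [|nra].
    apply Rmult_le_compat; auto using Rabs_pos.
  - rewrite gJ_pos, Rabs_mult, (Rabs_pos_eq (pw _ _)) by (lra || apply pw_ge0).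
    destruct (H2 t ltac:(lra)) as [H3 _]. nra.
Qed.

Lemma subexp_gJ (nu : R) : / 2 < nu -> subexp (gJ nu).
Proof.
  intros Hnu; destruct (gJ_bounded nu ltac:(lra)) as [C [HC H]].
  apply (subexp_dominated _ (fun t => C * pw (nu - / 2) t)).
  - apply cont_gJ; lra.
  - auto with subexp.
  - exact H.
Qed.
#[local] Hint Extern 3 (subexp (gJ _)) => apply subexp_gJ; lra : subexp.
#[local] Hint Extern 3 (continuity (gJ _)) => apply cont_gJ; lra : cont.

Lemma lipschitz_at_0 (K dK : R -> R) :
  (forall t, is_derive K t (dK t)) -> continuity dK ->
  exists C, 0 <= C /\ forall t, 0 <= t <= 1 -> Rabs (K t - K 0) <= C * t.
Proof.
  intros Hd Hc; destruct (continuity_bounded_01 dK Hc) as [C [HC H]].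
  exists C; split; [exact HC|]; intros t Ht.
  destruct (MVT_gen K 0 t dK) as [c [Hc1 Hc2]].
  - intros x _; apply Hd.
  - intros x _; apply (continuity_of_derive K dK Hd).
  - rewrite Rmin_left, Rmax_right in Hc1 by lra.
    rewrite Hc2, Rminus_0_r, Rabs_mult, (Rabs_pos_eq t) by lra.
    apply Rmult_le_compat_r; [lra|apply H; lra].
Qed.

(* Watson's lemma, first term. *)
Lemma laplace_leading (K dK : R -> R) (a D : R) :
  0 < a -> (forall t, is_derive K t (dK t)) -> continuity dK ->
  subexp (fun t => pw a t * K t) ->
  (forall t, 1 <= t -> Rabs (pw a t * K t) <= D * pw (a + 1) t) ->
  is_lim (fun e => laplace (fun t => pw a t * K t) e * Rpower e (a + 1)) p_infty
    (K 0 * euler (a + 1)).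
Proof.
  intros Ha Hd Hc Hs HD.
  destruct (lipschitz_at_0 K dK Hd Hc) as [C [HC HL]].
  (* [C], the Lipschitz constant at 0, serves t <= 1; the other two bound the terms separately for t
     > 1, where t^a <= t^(a+1). *)
  set (B := C + Rabs D + Rabs (K 0)).
  assert (HB : forall t, 0 <= t ->
    Rabs (pw a t * K t - K 0 * pw a t) <= B * pw (a + 1) t).
  { intros t Ht. pose proof (pw_ge0 a t) as P1. pose proof (pw_ge0 (a + 1) t) as P2.
    pose proof (Rabs_pos D). pose proof (Rabs_pos (K 0)). pose proof (Rle_abs D).
    destruct (Rle_dec t 1) as [Ht1|Ht1].
    - replace (pw a t * K t - K 0 * pw a t) with (pw a t * (K t - K 0)) by ring.
      rewrite Rabs_mult, (Rabs_pos_eq (pw a t)) by lra.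
      apply Rle_trans with (pw a t * (C * t)).
      + apply Rmult_le_compat_l; [lra|apply HL; lra].
      + replace (pw a t * (C * t)) with (C * (t * pw a t)) by ring.
        rewrite pw_mult; unfold B; nra.
    - specialize (HD t ltac:(lra)).
      pose proof (pw_ge_1 a (a + 1) t ltac:(lra) ltac:(lra)) as P3.
      unfold Rminus; eapply Rle_trans; [apply Rabs_triang|].
      rewrite Rabs_Ropp, (Rabs_mult (K 0)), (Rabs_pos_eq (pw a t)) by lra.
      unfold B; nra. }
  assert (HE : forall e, 0 < e ->
    Rabs (laplace (fun t => pw a t * K t) e * Rpower e (a + 1) - K 0 * euler (a + 1))
    <= B * euler (a + 1 + 1) / e).
  { intros e He.
    pose proof (laplace_abs_le (fun t => pw a t * K t - K 0 * pw a t)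
      (fun t => B * pw (a + 1) t) e ltac:(auto with subexp) ltac:(auto with subexp) He HB)
      as H.
    rewrite laplace_minus, !laplace_scal, !laplace_pw in H by (auto with subexp; lra).
    pose proof (Rpower_pos e (a + 1)) as P.
    replace (laplace (fun t => pw a t * K t) e * Rpower e (a + 1) - K 0 * euler (a + 1))
      with ((laplace (fun t => pw a t * K t) e - K 0 * (Rpower e (- (a + 1)) * euler (a + 1)))
            * Rpower e (a + 1)).
    - rewrite Rabs_mult, (Rabs_pos_eq (Rpower _ _)) by lra.
      apply (Rmult_le_compat_r (Rpower e (a + 1))) in H; [|lra].
      eapply Rle_trans; [exact H|]. right.
      rewrite Rpower_Ropp, (Rpower_plus (a + 1) 1), Rpower_1 by lra. field; lra.
    - rewrite Rpower_Ropp; field; lra. }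
  set (l := K 0 * euler (a + 1)) in *. set (b := B * euler (a + 1 + 1)) in *.
  apply (is_lim_squeeze_div _ l b); intros e He; apply HE; lra.
Qed.

(* [K(e + i) = LC nu e - i LS nu e], and [- K'(e + i) = LC1 nu e - i LS1 nu e]. *)
Definition LC (nu : R) : R -> R := laplace (fun t => cos t * gJ nu t).
Definition LS (nu : R) : R -> R := laplace (fun t => sin t * gJ nu t).
Definition LC1 (nu : R) : R -> R := laplace (fun t => t * (cos t * gJ nu t)).
Definition LS1 (nu : R) : R -> R := laplace (fun t => t * (sin t * gJ nu t)).

Lemma gJ_0 (nu : R) : gJ nu 0 = 0.
Proof. unfold gJ; rewrite pw_nonpos by lra; ring. Qed.

(** Writing g for [gJ], the relation t^2 g_(nu-1) = 2 nu g_nu - g_(nu+1) replaces the order nu - 1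
    produced by [gJ_is_derive], so that only orders nu and nu + 1 remain. *)
Lemma tgJ_is_derive (nu t : R) : 1 < 2 * nu ->
  is_derive (fun t => t * gJ nu t) t ((2 * nu + 1) * gJ nu t - gJ (nu + 1) t).
Proof.
  intros Hnu.
  assert (D := gJ_is_derive nu t Hnu).
  auto_derive; [eexists; exact D|]; rewrite (Derive_eta _ _ _ D).
  unfold gJ.
  replace (2 * (nu + 1)) with (2 * (nu - 1) + 1 + 1 + 1 + 1) by ring.
  replace (2 * nu) with (2 * (nu - 1) + 1 + 1) at 1 3 by ring.
  rewrite <- !pw_mult.
  rewrite Jentire_pred.
  replace (- (nu - 1)) with (- nu + 1) by ring.
  replace (- (nu + 1)) with (- nu + - (1)) by ring.
  rewrite !Rpower_plus, (Rpower_Ropp 2 1), !Rpower_1 by lra.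
  field.
Qed.

(* For [(c, s) = (cos, sin)] and [(- sin, cos)]: real and imaginary part of
   [d/dt (e^{-pt} (p t g_nu - g_(nu+1))) = e^{-pt} ((2 nu + 1) p - (1 + p^2) t) g_nu]
   at [p = e + i]. *)
Lemma laplace_identity (nu e : R) (c s : R -> R) : 1 <= nu -> 0 < e ->
  subexp c -> subexp s ->
  (forall t, is_derive c t (- s t)) -> (forall t, is_derive s t (c t)) ->
  (2 * nu + 1) * (e * laplace (fun t => c t * gJ nu t) e + laplace (fun t => s t * gJ nu t) e)
  = e ^ 2 * laplace (fun t => t * (c t * gJ nu t)) e
    + 2 * e * laplace (fun t => t * (s t * gJ nu t)) e.
Proof.
  intros Hnu He Sc Ss Dc Ds.
  assert (S0 : subexp (gJ nu)) by auto with subexp.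
  assert (S1 : subexp (gJ (nu + 1))) by auto with subexp.
  assert (D1 : forall t, is_derive (gJ (nu + 1)) t (t * gJ nu t)).
  { intros t; pose proof (gJ_is_derive (nu + 1) t ltac:(lra)) as D.
    replace (nu + 1 - 1) with nu in D by ring; exact D. }
  set (h := fun t => t * gJ nu t).
  assert (D0 : forall t, is_derive h t ((2 * nu + 1) * gJ nu t - gJ (nu + 1) t))
    by (intros t; apply tgJ_is_derive; lra).
  assert (E : laplace (fun t => (2 * nu + 1) * e * (c t * gJ nu t)
      + (2 * nu + 1) * (s t * gJ nu t)
      - e ^ 2 * (t * (c t * gJ nu t)) - 2 * e * (t * (s t * gJ nu t))) e
    = 0 - exp (- (e * 0)) * ((e * h 0 - gJ (nu + 1) 0) * c 0 + h 0 * s 0)).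
  { apply is_laplace_unique.
    apply (is_laplace_of_derive (fun t => exp (- (e * t)) *
             ((e * h t - gJ (nu + 1) t) * c t + h t * s t))).
    - apply subexp_cont; auto 10 with subexp.
    - intros t; specialize (D1 t); specialize (D0 t); specialize (Dc t); specialize (Ds t).
      auto_derive.
      + repeat split; eexists; eassumption.
      + rewrite (Derive_eta _ _ _ D1), (Derive_eta _ _ _ D0), (Derive_eta _ _ _ Dc),
          (Derive_eta _ _ _ Ds); unfold h; ring.
    - apply (is_lim_exp_subexp (fun t => (e * h t - gJ (nu + 1) t) * c t + h t * s t));
        [unfold h; auto 10 with subexp|exact He]. }
  rewrite !laplace_minus, laplace_plus, !laplace_scal in E by auto 10 with subexp.
  unfold h in E; rewrite !gJ_0 in E; lra.
Qed.

(** Real and imaginary part of (2 nu + 1) p K = -(1 + p^2) K' at p = e + i, where 1 + p^2 = e^2 + 2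
    i e. *)
Lemma LC_LS_identities (nu e : R) : 1 <= nu -> 0 < e ->
  (2 * nu + 1) * (e * LC nu e + LS nu e) = e ^ 2 * LC1 nu e + 2 * e * LS1 nu e /\
  (2 * nu + 1) * (LC nu e - e * LS nu e) = 2 * e * LC1 nu e - e ^ 2 * LS1 nu e.
Proof.
  intros Hnu He; unfold LC, LS, LC1, LS1; split.
  - apply laplace_identity; auto with subexp; intros t; auto_derive; auto; ring.
  - assert (S0 : subexp (gJ nu)) by auto with subexp.
    pose proof (laplace_identity nu e (fun t => - sin t) cos Hnu He) as E.
    rewrite (laplace_ext (fun t => - sin t * gJ nu t) (fun t => - (sin t * gJ nu t))),
      (laplace_ext (fun t => t * (- sin t * gJ nu t)) (fun t => - (t * (sin t * gJ nu t)))),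
      !laplace_opp in E by (auto with subexp; intros; ring).
    assert (E' := E ltac:(auto with subexp) ltac:(auto with subexp)
      ltac:(intros t; auto_derive; auto; ring) ltac:(intros t; auto_derive; auto; ring)).
    lra.
Qed.

(** At p = e + i the number 1 + p^2 = e (e + 2i) has modulus e sqrt(e^2 + 4) and argument pi/2 -
    atan(e/2). Thus [amp z] is |1 + p^2|^z, and [phase z] is z times the varying part of the
    argument, with sign reversed. *)
Definition amp (z e : R) : R := Rpower e z * Rpower (e ^ 2 + 4) (z / 2).
Definition phase (z e : R) : R := z * atan (e / 2).
(* [LU - i LV = K(e + i) e^{-i phase} amp] does not depend on [e]. *)
Definition LU (nu e : R) : R :=
  (LC nu e * cos (phase (nu + / 2) e) - LS nu e * sin (phase (nu + / 2) e))
  * amp (nu + / 2) e.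
Definition LV (nu e : R) : R :=
  (LS nu e * cos (phase (nu + / 2) e) + LC nu e * sin (phase (nu + / 2) e))
  * amp (nu + / 2) e.

Lemma amp_is_derive (z e : R) : 0 < e ->
  is_derive (amp z) e (2 * z * ((e ^ 2 + 2) / (e * (e ^ 2 + 4))) * amp z e).
Proof.
  intros He; unfold amp, Rpower; auto_derive.
  - repeat split; nra.
  - change (e * (e * 1)) with (e ^ 2). unfold Rdiv. field. nra.
Qed.

Lemma phase_is_derive (z e : R) : is_derive (phase z) e (2 * z / (e ^ 2 + 4)).
Proof.
  unfold phase.
  replace (2 * z / (e ^ 2 + 4)) with (z * (/ 2 * (/ (1 + (e / 2) ^ 2)))) by (field; nra).
  apply (is_derive_scal (fun e => atan (e / 2)) e z).
  apply (is_derive_comp atan (fun e => e / 2) e).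
  - apply is_derive_Reals.
    apply derivable_pt_lim_atan.
  - auto_derive; [exact I|field].
Qed.

(** The two identities are solved for the derivatives by multiplying with the conjugate of 1 + p^2,
    whose squared modulus is e^2 (e^2 + 4). *)
Lemma LC_is_derive (nu e : R) : 1 <= nu -> 0 < e ->
  is_derive (LC nu) e (- ((2 * nu + 1) * ((e ^ 2 + 2) / (e * (e ^ 2 + 4)) * LC nu e
                                - / (e ^ 2 + 4) * LS nu e))) /\
  is_derive (LS nu) e (- ((2 * nu + 1) * ((e ^ 2 + 2) / (e * (e ^ 2 + 4)) * LS nu e
                                + / (e ^ 2 + 4) * LC nu e))).
Proof.
  intros Hnu He; destruct (LC_LS_identities nu e Hnu He) as [E1 E2].
  assert (S0 : subexp (gJ nu)) by auto with subexp.
  assert (P : e ^ 2 + 4 > 0) by nra.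
  assert (Q : LC1 nu e * (e * (e ^ 2 + 4)) = e * LC1 nu e * (e ^ 2 + 4)) by ring.
  split.
  - replace ((2 * nu + 1) * _) with (LC1 nu e).
    + apply (laplace_is_derive (fun t => cos t * gJ nu t)); auto with subexp.
    + apply (Rmult_eq_reg_r (e ^ 2 * (e ^ 2 + 4))); [|nra].
      transitivity (e ^ 2 * (e ^ 2 * LC1 nu e + 2 * e * LS1 nu e)
                    + 2 * e * (2 * e * LC1 nu e - e ^ 2 * LS1 nu e)); [ring|].
      rewrite <- E1, <- E2; field; lra.
  - replace ((2 * nu + 1) * _) with (LS1 nu e).
    + apply (laplace_is_derive (fun t => sin t * gJ nu t)); auto with subexp.
    + apply (Rmult_eq_reg_r (e ^ 2 * (e ^ 2 + 4))); [|nra].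
      transitivity (2 * e * (e ^ 2 * LC1 nu e + 2 * e * LS1 nu e)
                    - e ^ 2 * (2 * e * LC1 nu e - e ^ 2 * LS1 nu e)); [ring|].
      rewrite <- E1, <- E2; field; lra.
Qed.

Lemma LU_LV_const (nu x y : R) : 1 <= nu -> 0 < x -> 0 < y ->
  LU nu x = LU nu y /\ LV nu x = LV nu y.
Proof.
  intros Hnu Hx Hy.
  split; [apply (constant_of_derive_0 (LU nu))|apply (constant_of_derive_0 (LV nu))];
    try assumption; intros e He;
    destruct (LC_is_derive nu e Hnu He) as [D1 D2];
    pose proof (amp_is_derive (nu + / 2) e He) as D3;
    pose proof (phase_is_derive (nu + / 2) e) as D4;
    unfold LU, LV; auto_derive;
    try (repeat split; eexists; eassumption);
    rewrite (Derive_eta _ _ _ D1), (Derive_eta _ _ _ D2), (Derive_eta _ _ _ D3),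
      (Derive_eta _ _ _ D4); field; nra.
Qed.

(** Watson's lemma sees only the value at t = 0 of the trigonometric factor times the series: the
    cosine keeps the first coefficient 2^(-nu)/Gamma(nu + 1), the sine kills it. *)
Lemma LC_at_infinity (nu : R) : 1 <= nu ->
  is_lim (fun e => LC nu e * Rpower e (2 * nu + 1)) p_infty
    (Rpower 2 (- nu) * inv_gamma (nu + 1) * euler (2 * nu + 1)) /\
  is_lim (fun e => LS nu e * Rpower e (2 * nu + 1)) p_infty 0.
Proof.
  intros Hnu.
  destruct (gJ_bounded nu ltac:(lra)) as [D [HD HB]].
  assert (J0 : Jentire nu ((0 / 2) ^ 2) = inv_gamma (nu + 1)).
  { replace ((0 / 2) ^ 2) with 0 by field. unfold Jentire. rewrite PSeries_0.
    unfold coef; simpl; rewrite Rplus_0_r; field. }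
  set (K := fun (c : R -> R) t => c t * (Rpower 2 (- nu) * Jentire nu ((t / 2) ^ 2))).
  set (dK := fun (c dc : R -> R) t =>
     dc t * (Rpower 2 (- nu) * Jentire nu ((t / 2) ^ 2))
     + c t * (Rpower 2 (- nu) * (- (t / 2) * Jentire (nu + 1) ((t / 2) ^ 2)))).
  assert (H : forall c dc : R -> R, (forall t, is_derive c t (dc t)) ->
     continuity c -> continuity dc -> (forall t, -1 <= c t <= 1) ->
     is_lim (fun e => laplace (fun t => pw (2 * nu) t * K c t) e * Rpower e (2 * nu + 1))
       p_infty (K c 0 * euler (2 * nu + 1))).
  { intros c dc Hd Hc Hdc Hb.
    assert (HB2 : forall t, 0 <= t -> Rabs (pw (2 * nu) t * K c t) <= D * pw (nu - / 2) t).
    { intros t Ht. replace (pw (2 * nu) t * K c t) with (c t * gJ nu t)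
        by (unfold K, gJ; ring).
      rewrite Rabs_mult. specialize (HB t Ht). specialize (Hb t).
      assert (Rabs (c t) <= 1) by (apply Rabs_le; lra).
      pose proof (Rabs_pos (c t)). pose proof (Rabs_pos (gJ nu t)). nra. }
    assert (CK : continuity (K c)).
    { apply cont_mult; [exact Hc|apply (cont_mult (fun _ => _))];
        [auto with cont|apply cont_Jentire_sqr]. }
    apply (laplace_leading (K c) (dK c dc) (2 * nu) D); [lra| | | |].
    - intros t; specialize (Hd t). unfold K, dK; auto_derive.
      + split; [eexists; exact Hd|split; [eexists; apply Jentire_is_derive|exact I]].
      + rewrite (Derive_eta _ _ _ Hd), (Derive_eta _ _ _ (Jentire_is_derive nu _)).
        change (t * / 2 * (t * / 2 * 1)) with ((t / 2) ^ 2).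
        field.
    - assert (CJ := cont_Jentire_sqr nu). assert (CJ1 := cont_Jentire_sqr (nu + 1)).
      unfold dK. apply cont_plus; apply cont_mult; try assumption;
        apply (cont_mult (fun _ => _)); auto with cont.
      apply (cont_mult (fun t => - (t / 2))); [|exact CJ1].
      apply cont_opp; apply (cont_mult (fun t => t)); auto with cont.
    - apply (subexp_dominated _ (fun t => D * pw (nu - / 2) t)).
      + apply cont_mult; [auto with cont|exact CK].
      + auto with subexp.
      + exact HB2.
    - intros t Ht; eapply Rle_trans; [apply HB2; lra|].
      apply Rmult_le_compat_l; [exact HD|apply pw_ge_1; lra]. }
  split.
  - replace (Rpower 2 (- nu) * inv_gamma (nu + 1)) with (K cos 0)
      by (unfold K; rewrite J0, cos_0; ring).
    apply (is_lim_ext (fun e => laplace (fun t => pw (2 * nu) t * K cos t) e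
                                * Rpower e (2 * nu + 1))).
    + intros e; f_equal; apply laplace_ext; intros t _; unfold K, gJ; ring.
    + apply (H cos (fun t => - sin t)); auto with cont; [|apply COS_bound].
      intros t; auto_derive; [exact I|ring].
  - replace 0 with (K sin 0 * euler (2 * nu + 1)) by (unfold K; rewrite sin_0; ring).
    apply (is_lim_ext (fun e => laplace (fun t => pw (2 * nu) t * K sin t) e
                                * Rpower e (2 * nu + 1))).
    + intros e; f_equal; apply laplace_ext; intros t _; unfold K, gJ; ring.
    + apply (H sin cos); auto with cont; [|apply SIN_bound].
      intros t; auto_derive; [exact I|ring].
Qed.

Lemma is_lim_const_fun (f : R -> R) (c l : R) :
  (forall x, 0 < x -> f x = c) -> is_lim f p_infty l -> c = l.
Proof.
  intros H Hl.
  assert (E : Finite l = Finite c).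
  { rewrite <- (is_lim_unique _ _ _ Hl). apply is_lim_unique.
    apply (is_lim_ext_loc (fun _ => c)); [|apply is_lim_const].
    exists 0; intros x Hx; rewrite H; auto. }
  injection E; auto.
Qed.

Lemma is_lim_comp_cont (f g : R -> R) (l : R) :
  is_lim f p_infty l -> continuous g l -> is_lim (fun x => g (f x)) p_infty (g l).
Proof. apply is_lim_comp_continuous. Qed.

Lemma is_lim_Rinv_p : is_lim (fun x => / x) p_infty 0.
Proof. apply (is_lim_inv (fun t => t) p_infty p_infty); [apply is_lim_id|discriminate]. Qed.

(** The constants are evaluated at e -> oo, where the phase tends to z pi/2 with z = nu + 1/2, and
    the amplitude factor is asymptotic to e^(2 nu + 1). *)
Lemma LU_value (nu e : R) : 1 <= nu -> 0 < e ->
  LU nu e = Rpower 2 (- nu) * inv_gamma (nu + 1) * euler (2 * nu + 1)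
            * cos ((nu + / 2) * (PI / 2)) /\
  LV nu e = Rpower 2 (- nu) * inv_gamma (nu + 1) * euler (2 * nu + 1)
            * sin ((nu + / 2) * (PI / 2)).
Proof.
  intros Hnu He.
  set (z := nu + / 2).
  destruct (LC_at_infinity nu Hnu) as [L1 L2].
  set (c0 := Rpower 2 (- nu) * inv_gamma (nu + 1) * euler (2 * nu + 1)) in *.
  (* [amp z] with its leading power removed, as a function of the reciprocal variable. *)
  set (ra := fun x => Rpower (1 + 4 * x ^ 2) (z / 2)).
  assert (LR : is_lim (fun x => ra (/ x)) p_infty 1).
  { replace (Finite 1) with (Finite (ra 0)).
    - apply (is_lim_comp_cont Rinv ra 0 is_lim_Rinv_p).
      apply @ex_derive_continuous; unfold ra, Rpower; auto_derive; lra.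
    - f_equal; unfold ra, Rpower; replace (1 + 4 * 0 ^ 2) with 1 by ring.
      rewrite ln_1, Rmult_0_r, exp_0; reflexivity. }
  assert (EA : forall x, 0 < x -> amp z x = Rpower x (2 * nu + 1) * ra (/ x)).
  { intros x Hx; unfold amp, ra.
    replace (2 * nu + 1) with (z + 2 * (z / 2)) by (unfold z; field).
    rewrite Rpower_plus, <- (Rpower_mult x 2), Rmult_assoc, Rpower_mult_distr.
    - do 2 f_equal. replace (Rpower x 2) with (x ^ 2).
      + field; lra.
      + rewrite <- Rpower_pow by lra; f_equal; simpl; ring.
    - apply Rpower_pos.
    - pose proof (pow2_ge_0 (/ x)); lra. }
  assert (LP : is_lim (fun x => phase z x) p_infty (z * (PI / 2))).
  { unfold phase.
    apply (is_lim_ext_loc (fun x => z * (PI / 2 - atan (2 * / x)))).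
    - exists 0; intros x Hx.
      replace (2 * / x) with (/ (x / 2)) by (field; lra).
      rewrite atan_inv by lra; ring.
    - replace (Finite (z * (PI / 2))) with
        (Finite ((fun y => z * (PI / 2 - atan (2 * y))) 0)).
      + apply (is_lim_comp_cont Rinv (fun y => z * (PI / 2 - atan (2 * y))) 0 is_lim_Rinv_p).
        apply @ex_derive_continuous; auto_derive; exact I.
      + rewrite Rmult_0_r, atan_0; f_equal; ring. }
  assert (Lc : is_lim (fun x => cos (phase z x)) p_infty (cos (z * (PI / 2)))).
  { apply (is_lim_comp_cont _ cos _ LP), continuity_continuous, continuity_cos. }
  assert (Ls : is_lim (fun x => sin (phase z x)) p_infty (sin (z * (PI / 2)))).
  { apply (is_lim_comp_cont _ sin _ LP), continuity_continuous, continuity_sin. }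
  destruct (is_lim_scal_rotation _ _ _ _ _ _ _ _ _ _ L1 L2 Lc Ls LR) as [R1 R2].
  split.
  - transitivity ((c0 * cos (z * (PI / 2)) - 0 * sin (z * (PI / 2))) * 1); [|ring].
    apply (is_lim_const_fun (LU nu)).
    { intros x Hx; apply (LU_LV_const nu x e Hnu Hx He). }
    eapply is_lim_ext_loc; [|exact R1].
    exists 0; intros x Hx; unfold LU; fold z; rewrite EA by exact Hx; eqR; ring.
  - transitivity ((0 * cos (z * (PI / 2)) + c0 * sin (z * (PI / 2))) * 1); [|ring].
    apply (is_lim_const_fun (LV nu)).
    { intros x Hx; apply (LU_LV_const nu x e Hnu Hx He). }
    eapply is_lim_ext_loc; [|exact R2].
    exists 0; intros x Hx; unfold LV; fold z; rewrite EA by exact Hx; eqR; ring.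
Qed.

(** These integrands are t^(nu - 1/2) times the quantities whose limits give amplitude and phase.
    Integration by parts of sin t g_nu and cos t g_nu, with g for [gJ], removes the order nu - 1
    from their transforms. *)
Lemma LC_combinations (nu e : R) : 2 <= nu -> 0 < e ->
  laplace (fun t => cos t * gJ nu t - sin t * (t * gJ (nu - 1) t)) e
    = 2 * LC nu e - e * LS nu e /\
  laplace (fun t => sin t * gJ nu t + cos t * (t * gJ (nu - 1) t)) e
    = 2 * LS nu e + e * LC nu e.
Proof.
  intros Hnu He.
  assert (S0 : subexp (gJ nu)) by auto with subexp.
  assert (S1 : subexp (gJ (nu - 1))) by auto with subexp.
  assert (E1 : laplace (fun t => cos t * gJ nu t + sin t * (t * gJ (nu - 1) t)) e
     = e * LS nu e - sin 0 * gJ nu 0).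
  { apply (laplace_derive_fun (fun t => sin t * gJ nu t)); auto with subexp.
    intros t; pose proof (gJ_is_derive nu t ltac:(lra)) as D; auto_derive.
    - eexists; exact D.
    - rewrite (Derive_eta _ _ _ D); ring. }
  assert (E2 : laplace (fun t => - (sin t * gJ nu t) + cos t * (t * gJ (nu - 1) t)) e
     = e * LC nu e - cos 0 * gJ nu 0).
  { apply (laplace_derive_fun (fun t => cos t * gJ nu t)); auto with subexp.
    intros t; pose proof (gJ_is_derive nu t ltac:(lra)) as D; auto_derive.
    - eexists; exact D.
    - rewrite (Derive_eta _ _ _ D); ring. }
  rewrite laplace_plus in E1, E2 by auto with subexp.
  rewrite laplace_opp in E2 by auto with subexp.
  rewrite laplace_minus, laplace_plus by auto with subexp.
  rewrite gJ_0 in E1, E2. unfold LC, LS in *; split; lra.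
Qed.

(** Both comparison powers have explicit transforms, and one power of t less costs one factor e. The
    limit e -> 0 is phrased as e = 1/x with x -> oo; z > 2 keeps the exponent z - 2 positive. *)
Lemma laplace_abel (phi : R -> R) (z al B : R) : 2 < z -> subexp phi ->
  (forall t, 0 <= t -> Rabs (phi t - al * pw (z - 1) t) <= B * pw (z - 2) t) ->
  is_lim (fun x => Rpower (/ x) z * laplace phi (/ x)) p_infty (al * euler z).
Proof.
  intros Hz Hs HB.
  assert (HE : forall e, 0 < e ->
    Rabs (Rpower e z * laplace phi e - al * euler z) <= B * euler (z - 1) * e).
  { intros e He.
    pose proof (laplace_abs_le (fun t => phi t - al * pw (z - 1) t)
      (fun t => B * pw (z - 2) t) e ltac:(auto with subexp) ltac:(auto with subexp) He HB)
      as H.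
    rewrite laplace_minus, !laplace_scal, !laplace_pw in H by (auto with subexp; lra).
    replace (z - 1 + 1) with z in H by ring. replace (z - 2 + 1) with (z - 1) in H by ring.
    pose proof (Rpower_pos e z) as P.
    replace (Rpower e z * laplace phi e - al * euler z)
      with ((laplace phi e - al * (Rpower e (- z) * euler z)) * Rpower e z)
      by (rewrite Rpower_Ropp; field; lra).
    rewrite Rabs_mult, (Rabs_pos_eq (Rpower _ _)) by lra.
    apply (Rmult_le_compat_r (Rpower e z)) in H; [|lra].
    eapply Rle_trans; [exact H|]. right.
    replace (- (z - 1)) with (- z + 1) by ring.
    rewrite Rpower_plus, Rpower_1, Rpower_Ropp by lra. field; lra. }
  set (l := al * euler z) in *. set (b := B * euler (z - 1)) in *.
  apply (is_lim_squeeze_div _ l b); intros x Hx.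
  apply (HE (/ x)), Rinv_0_lt_compat; lra.
Qed.

(** The derivative of [fJ nu] is traded for [fJ (nu - 1)] at a cost O(1/x): this is the pair that
    occurs in the transforms and in the recurrence on the order. *)
Lemma fJ_parts_near (nu : R) : exists al be C : R, 0 <= C /\
  is_lim (cos_part (fJ nu) (dfJ nu)) p_infty al /\
  is_lim (sin_part (fJ nu) (dfJ nu)) p_infty be /\
  forall x, 1 <= x ->
    Rabs (fJ nu x * cos x - fJ (nu - 1) x * sin x - al) <= C / x /\
    Rabs (fJ nu x * sin x + fJ (nu - 1) x * cos x - be) <= C / x.
Proof.
  destruct (bessel_ode_asymptotics _ _ _ (fJ_ode nu)) as [al [be [C [HC [L1 [L2 HB]]]]]].
  destruct (bessel_ode_bounded _ _ _ 1 (fJ_ode nu) ltac:(lra)) as [M [HM HM2]].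
  exists al, be, (C + Rabs (nu - / 2) * M).
  split; [pose proof (Rabs_pos (nu - / 2)); nra|].
  split; [exact L1|split; [exact L2|]].
  intros x Hx; destruct (HB x Hx) as [B1 B2]; destruct (HM2 x Hx) as [M1 _].
  assert (Hi : 0 < / x) by (apply Rinv_0_lt_compat; lra).
  assert (R1 : forall c, -1 <= c <= 1 ->
     Rabs ((nu - / 2) / x * fJ nu x * c) <= Rabs (nu - / 2) * M / x).
  { intros c Hc; unfold Rdiv; rewrite !Rabs_mult, (Rabs_pos_eq (/ x)) by lra.
    assert (Rabs c <= 1) by (apply Rabs_le; lra).
    pose proof (Rabs_pos (nu - / 2)). pose proof (Rabs_pos (fJ nu x)). pose proof (Rabs_pos c).
    replace (Rabs (nu - / 2) * / x * Rabs (fJ nu x) * Rabs c)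
      with ((Rabs (nu - / 2) * / x) * (Rabs (fJ nu x) * Rabs c)) by ring.
    replace (Rabs (nu - / 2) * M * / x) with ((Rabs (nu - / 2) * / x) * M) by ring.
    apply Rmult_le_compat_l; [apply Rmult_le_pos; lra|nra]. }
  unfold cos_part, sin_part, dfJ in B1, B2.
  replace ((C + Rabs (nu - / 2) * M) / x) with (C / x + Rabs (nu - / 2) * M / x)
    by (field; lra).
  split.
  - replace (fJ nu x * cos x - fJ (nu - 1) x * sin x - al)
      with ((fJ nu x * cos x - (fJ (nu - 1) x - (nu - / 2) / x * fJ nu x) * sin x - al)
            + - ((nu - / 2) / x * fJ nu x * sin x)) by ring.
    eapply Rle_trans; [apply Rabs_triang|]; rewrite Rabs_Ropp.
    apply Rplus_le_compat; [exact B1|apply R1, SIN_bound].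
  - replace (fJ nu x * sin x + fJ (nu - 1) x * cos x - be)
      with ((fJ nu x * sin x + (fJ (nu - 1) x - (nu - / 2) / x * fJ nu x) * cos x - be)
            + ((nu - / 2) / x * fJ nu x * cos x)) by ring.
    eapply Rle_trans; [apply Rabs_triang|].
    apply Rplus_le_compat; [exact B2|apply R1, COS_bound].
Qed.

Lemma gJ_pair_near (nu al be C : R) (c s : R -> R) : 2 <= nu -> 0 <= C ->
  (forall t, -1 <= c t <= 1) -> (forall t, -1 <= s t <= 1) ->
  (forall x, 1 <= x -> Rabs (fJ nu x * c x + fJ (nu - 1) x * s x - al) <= C / x) ->
  exists B, forall t, 0 <= t ->
    Rabs (c t * gJ nu t + s t * (t * gJ (nu - 1) t) - al * pw (nu + / 2 - 1) t)
    <= B * pw (nu + / 2 - 2) t.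
Proof.
  intros Hnu HC Hc Hs H.
  destruct (gJ_bounded nu ltac:(lra)) as [C0 [HC0 H0]].
  destruct (gJ_bounded (nu - 1) ltac:(lra)) as [C1 [HC1 H1]].
  (* [C] is the rate used for t > 1; for t <= 1 the three terms are bounded one by one through [C0],
     [C1] and [Rabs al]. *)
  exists (C + C0 + C1 + Rabs al); intros t Ht.
  replace (nu + / 2 - 1) with (nu - / 2) by field.
  replace (nu + / 2 - 2) with (nu - 1 - / 2) by field.
  assert (Ep : t * pw (nu - 1 - / 2) t = pw (nu - / 2) t)
    by (rewrite pw_mult; f_equal; field).
  pose proof (pw_ge0 (nu - / 2) t) as P0. pose proof (pw_ge0 (nu - 1 - / 2) t) as P1.
  pose proof (Rabs_pos al).
  destruct (Rle_dec t 1) as [Ht1|Ht1].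
  - pose proof (pw_le_1 (nu - 1 - / 2) (nu - / 2) t ltac:(lra) ltac:(lra)) as P2.
    specialize (H0 t Ht); specialize (H1 t Ht).
    eapply Rle_trans; [apply (Rabs_triang _ (- (al * pw (nu - / 2) t)))|].
    rewrite Rabs_Ropp, (Rabs_mult al), (Rabs_pos_eq (pw _ t)) by lra.
    eapply Rle_trans; [apply Rplus_le_compat_r, Rabs_triang|].
    rewrite (Rabs_mult (c t)), (Rabs_mult (s t)), (Rabs_mult t), (Rabs_pos_eq t) by lra.
    assert (Rabs (c t) <= 1) by (apply Rabs_le, Hc).
    assert (Rabs (s t) <= 1) by (apply Rabs_le, Hs).
    set (p := pw (nu - 1 - / 2) t) in *. set (q := pw (nu - / 2) t) in *.
    pose proof (Rabs_pos (c t)). pose proof (Rabs_pos (s t)).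
    pose proof (Rabs_pos (gJ nu t)). pose proof (Rabs_pos (gJ (nu - 1) t)).
    assert (A0 : C0 * q <= C0 * p) by (apply Rmult_le_compat_l; assumption).
    assert (A1 : Rabs (c t) * Rabs (gJ nu t) <= C0 * p) by nra.
    assert (A5 : C1 * q <= C1 * p) by (apply Rmult_le_compat_l; assumption).
    assert (A2 : t * Rabs (gJ (nu - 1) t) <= C1 * q).
    { rewrite <- Ep; replace (C1 * (t * p)) with (t * (C1 * p)) by ring.
      apply Rmult_le_compat_l; assumption. }
    assert (A4 : 0 <= t * Rabs (gJ (nu - 1) t)) by nra.
    assert (A3 : Rabs (s t) * (t * Rabs (gJ (nu - 1) t)) <= C1 * p) by nra.
    nra.
  - assert (Ht0 : 0 < t) by lra.
    specialize (H t ltac:(lra)).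
    rewrite !gJ_pos by lra.
    replace (c t * (pw (nu - / 2) t * fJ nu t)
             + s t * (t * (pw (nu - 1 - / 2) t * fJ (nu - 1) t)) - al * pw (nu - / 2) t)
      with (pw (nu - / 2) t * (fJ nu t * c t + fJ (nu - 1) t * s t - al))
      by (rewrite <- Ep; ring).
    rewrite Rabs_mult, (Rabs_pos_eq (pw _ _)) by lra.
    apply Rle_trans with (pw (nu - / 2) t * (C / t)).
    + apply Rmult_le_compat_l; assumption.
    + rewrite <- Ep.
      replace (t * pw (nu - 1 - / 2) t * (C / t)) with (C * pw (nu - 1 - / 2) t)
        by (field; lra).
      apply Rmult_le_compat_r; lra.
Qed.

(** * Amplitude and phase of J_nu at infinity *)

(** The classical formula reads sqrt x J_nu(x) = [amplitude] cos(x - [theta nu]) + o(1). *)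
Definition theta (nu : R) : R := nu * (PI / 2) + PI / 4.
Definition amplitude : R := sqrt 2 / sqrt PI.

(** Duplication at nu + 1/2. The left side is the constant read off at e -> oo, the right side has
    the shape produced by e -> 0, so that Gamma(nu + 1/2) cancels in the comparison. *)
Lemma amplitude_value (nu : R) : 2 <= nu ->
  Rpower 2 (- nu) * inv_gamma (nu + 1) * euler (2 * nu + 1)
  = Rpower 2 (nu + / 2) / 2 * amplitude * euler (nu + / 2).
Proof.
  intros Hnu.
  pose proof (inv_gamma_duplication (nu + / 2)) as D.
  replace (nu + / 2 + / 2) with (nu + 1) in D by field.
  replace (2 * (nu + / 2)) with (2 * nu + 1) in D by field.
  destruct (inv_gamma_euler (nu + / 2) ltac:(lra)) as [P1 E1].
  destruct (inv_gamma_euler (2 * nu + 1) ltac:(lra)) as [P2 E2].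
  rewrite E1, E2 in D.
  pose proof PI_RGT_0. assert (HS : 0 < sqrt PI) by (apply sqrt_lt_R0; lra).
  assert (D' : inv_gamma (nu + 1) * euler (2 * nu + 1)
     = euler (nu + / 2) * (/ (2 * sqrt PI) * Rpower 4 (nu + / 2))).
  { apply (Rmult_eq_reg_l (/ euler (nu + / 2) * / euler (2 * nu + 1))).
    - transitivity (/ euler (nu + / 2) * inv_gamma (nu + 1)); [field; lra|].
      rewrite D; field; lra.
    - apply Rmult_integral_contrapositive_currified; apply Rinv_neq_0_compat; lra. }
  rewrite Rmult_assoc, D'. unfold amplitude.
  replace 4 with (2 * 2) by ring. rewrite <- Rpower_mult_distr by lra.
  assert (E3 : Rpower 2 (- nu) * Rpower 2 (nu + / 2) = sqrt 2).
  { rewrite <- Rpower_plus, <- Rpower_sqrt by lra; f_equal; ring. }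
  rewrite <- E3. field; lra.
Qed.

Definition fJ_phase (nu : R) : Prop :=
  is_lim (fun x => fJ nu x * cos x - fJ (nu - 1) x * sin x) p_infty
    (amplitude * cos (theta nu)) /\
  is_lim (fun x => fJ nu x * sin x + fJ (nu - 1) x * cos x) p_infty
    (amplitude * sin (theta nu)).

(** [LU] and [LV] are constant in e, so their values found from e -> oo are compared with the limit
    e -> 0, in which the unknown limits [al] and [be] appear. *)
Lemma fJ_phase_large (nu : R) : 2 <= nu -> fJ_phase nu.
Proof.
  intros Hnu. set (z := nu + / 2).
  destruct (fJ_parts_near nu) as [al [be [C [HC [_ [_ HB]]]]]].
  assert (S0 : subexp (gJ nu)) by auto with subexp.
  assert (S1 : subexp (gJ (nu - 1))) by auto with subexp.
  destruct (gJ_pair_near nu al be C cos (fun t => - sin t) Hnu HC) as [B1 HB1];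
    [apply COS_bound|intros t; pose proof (SIN_bound t); lra| |].
  { intros x Hx. replace (fJ nu x * cos x + fJ (nu - 1) x * - sin x - al)
      with (fJ nu x * cos x - fJ (nu - 1) x * sin x - al) by ring. apply HB, Hx. }
  destruct (gJ_pair_near nu be be C sin cos Hnu HC) as [B2 HB2];
    [apply SIN_bound|apply COS_bound| |].
  { intros x Hx. apply HB, Hx. }
  assert (LX1 : is_lim (fun x => Rpower (/ x) z * (2 * LC nu (/ x) - / x * LS nu (/ x)))
                  p_infty (al * euler z)).
  { apply (is_lim_ext_loc (fun x => Rpower (/ x) z *
       laplace (fun t => cos t * gJ nu t - sin t * (t * gJ (nu - 1) t)) (/ x))).
    - exists 0; intros x Hx; f_equal.
      destruct (LC_combinations nu (/ x) Hnu (Rinv_0_lt_compat x Hx)) as [E1 E2]; exact E1.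
    - apply (laplace_abel _ z al B1); [unfold z; lra|auto with subexp|].
      intros t Ht; specialize (HB1 t Ht); unfold z.
      replace (cos t * gJ nu t - sin t * (t * gJ (nu - 1) t))
        with (cos t * gJ nu t + - sin t * (t * gJ (nu - 1) t)) by ring.
      exact HB1. }
  assert (LX2 : is_lim (fun x => Rpower (/ x) z * (2 * LS nu (/ x) + / x * LC nu (/ x)))
                  p_infty (be * euler z)).
  { apply (is_lim_ext_loc (fun x => Rpower (/ x) z *
       laplace (fun t => sin t * gJ nu t + cos t * (t * gJ (nu - 1) t)) (/ x))).
    - exists 0; intros x Hx; f_equal.
      destruct (LC_combinations nu (/ x) Hnu (Rinv_0_lt_compat x Hx)) as [E1 E2]; exact E2.
    - apply (laplace_abel _ z be B2); [unfold z; lra|auto with subexp|].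
      intros t Ht; exact (HB2 t Ht). }
  set (X1 := fun x => Rpower (/ x) z * (2 * LC nu (/ x) - / x * LS nu (/ x))) in *.
  set (X2 := fun x => Rpower (/ x) z * (2 * LS nu (/ x) + / x * LC nu (/ x))) in *.
  (* The amplitude factor is split as e^z q(e) (e^2 + 4): e^z is already inside [X1] and [X2], and
     e^2 + 4 is the determinant of the system that expresses them through [LC] and [LS]. *)
  set (q := fun y => Rpower (y ^ 2 + 4) (z / 2) / (y ^ 2 + 4)).
  assert (Lq : is_lim (fun x => q (/ x)) p_infty (Rpower 2 z / 4)).
  { replace (Rpower 2 z / 4) with (q 0).
    - apply (is_lim_comp_cont Rinv q 0 is_lim_Rinv_p).
      apply @ex_derive_continuous; unfold q, Rpower; auto_derive; lra.
    - unfold q; replace (0 ^ 2 + 4) with 4 by ring; f_equal.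
      replace 4 with (Rpower 2 2).
      + rewrite Rpower_mult; f_equal; field.
      + replace 2 with (INR 2) at 2 by (simpl; ring).
        rewrite Rpower_pow by lra; simpl; ring. }
  assert (Lc : is_lim (fun x => cos (phase z (/ x))) p_infty 1).
  { replace (Finite 1) with (Finite ((fun y => cos (phase z y)) 0)).
    - apply (is_lim_comp_cont Rinv (fun y => cos (phase z y)) 0 is_lim_Rinv_p).
      apply @ex_derive_continuous; unfold phase; auto_derive; exact I.
    - unfold phase; cbv beta; replace (0 / 2) with 0 by field.
      rewrite atan_0, Rmult_0_r, cos_0; reflexivity. }
  assert (Ls : is_lim (fun x => sin (phase z (/ x))) p_infty 0).
  { replace (Finite 0) with (Finite ((fun y => sin (phase z y)) 0)).
    - apply (is_lim_comp_cont Rinv (fun y => sin (phase z y)) 0 is_lim_Rinv_p).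
      apply @ex_derive_continuous; unfold phase; auto_derive; exact I.
    - unfold phase; cbv beta; replace (0 / 2) with 0 by field.
      rewrite atan_0, Rmult_0_r, sin_0; reflexivity. }
  destruct (LU_value nu 1 ltac:(lra) ltac:(lra)) as [U0 V0].
  rewrite amplitude_value in U0, V0 by exact Hnu. fold z in U0, V0.
  pose proof (Rpower_pos 2 z) as P2.
  assert (Pe : 0 < euler z) by (apply inv_gamma_euler; unfold z; lra).
  assert (EA : forall x, 0 < x -> amp z (/ x) = Rpower (/ x) z * (q (/ x) * ((/ x) ^ 2 + 4))).
  { intros x Hx; unfold amp, q; assert (0 <= (/ x) ^ 2) by apply pow2_ge_0; field; nra. }
  assert (two : is_lim (fun _ => 2) p_infty 2) by apply is_lim_const.
  assert (one : is_lim (fun _ => 1) p_infty 1) by apply is_lim_const.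
  (* Inversion of that system with e = 1/x: 2 X1 + e X2 and 2 X2 - e X1 are e^z (e^2 + 4) times [LC]
     and [LS]. The next rotation undoes the phase. *)
  destruct (is_lim_scal_rotation _ _ _ _ _ _ _ _ _ _ LX2 LX1 two is_lim_Rinv_p one)
    as [R1 R1'].
  destruct (is_lim_scal_rotation _ _ _ _ _ _ _ _ _ _ R1' R1 Lc Ls Lq) as [RU RV].
  assert (EU : LU nu 1 = (2 * (al * euler z)) * (Rpower 2 z / 4)).
  { transitivity ((((al * euler z) * 2 + (be * euler z) * 0) * 1 * 1
       - ((be * euler z) * 2 - (al * euler z) * 0) * 1 * 0) * (Rpower 2 z / 4)); [|ring].
    apply (is_lim_const_fun (fun x => LU nu (/ x))).
    { intros x Hx; destruct (LU_LV_const nu (/ x) 1) as [E1 E2];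
        [lra|apply Rinv_0_lt_compat, Hx|lra|]; assumption. }
    eapply is_lim_ext_loc; [|exact RU].
    exists 0; intros x Hx; unfold LU; fold z; rewrite EA by exact Hx.
    unfold X1, X2; eqR; ring. }
  assert (EV : LV nu 1 = (2 * (be * euler z)) * (Rpower 2 z / 4)).
  { transitivity ((((be * euler z) * 2 - (al * euler z) * 0) * 1 * 1
       + ((al * euler z) * 2 + (be * euler z) * 0) * 1 * 0) * (Rpower 2 z / 4)); [|ring].
    apply (is_lim_const_fun (fun x => LV nu (/ x))).
    { intros x Hx; destruct (LU_LV_const nu (/ x) 1) as [E1 E2];
        [lra|apply Rinv_0_lt_compat, Hx|lra|]; assumption. }
    eapply is_lim_ext_loc; [|exact RV].
    exists 0; intros x Hx; unfold LV; fold z; rewrite EA by exact Hx.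
    unfold X1, X2; eqR; ring. }
  assert (Eth : z * (PI / 2) = theta nu) by (unfold z, theta; field).
  rewrite Eth in U0, V0.
  assert (Eal : al = amplitude * cos (theta nu)).
  { apply (Rmult_eq_reg_l (Rpower 2 z / 2 * euler z)); [|nra].
    transitivity (LU nu 1); [rewrite EU; field|rewrite U0; ring]. }
  assert (Ebe : be = amplitude * sin (theta nu)).
  { apply (Rmult_eq_reg_l (Rpower 2 z / 2 * euler z)); [|nra].
    transitivity (LV nu 1); [rewrite EV; field|rewrite V0; ring]. }
  unfold fJ_phase; rewrite <- Eal, <- Ebe.
  split; apply (is_lim_squeeze_div _ _ C); intros x Hx; apply HB, Hx.
Qed.

Lemma is_lim_bounded_div (f : R -> R) (M c : R) :
  (forall x, 1 <= x -> Rabs (f x) <= M) -> is_lim (fun x => c / x * f x) p_infty 0.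
Proof.
  intros H; apply (is_lim_squeeze_div _ 0 (Rabs c * M)); intros x Hx.
  rewrite Rminus_0_r; unfold Rdiv; rewrite !Rabs_mult, Rabs_inv, (Rabs_pos_eq x) by lra.
  specialize (H x Hx). pose proof (Rabs_pos c).
  assert (0 < / x) by (apply Rinv_0_lt_compat; lra).
  replace (Rabs c * M * / x) with (Rabs c * / x * M) by ring.
  apply Rmult_le_compat_l; [apply Rmult_le_pos; lra|exact H].
Qed.

Lemma fJ_times_bounded (nu : R) (c : R -> R) : (forall t, -1 <= c t <= 1) ->
  exists M, forall x, 1 <= x -> Rabs (fJ nu x * c x) <= M.
Proof.
  intros Hc; destruct (bessel_ode_bounded _ _ _ 1 (fJ_ode nu) ltac:(lra)) as [M [HM H]].
  exists M; intros x Hx; destruct (H x Hx) as [H1 _].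
  rewrite Rabs_mult. assert (Rabs (c x) <= 1) by (apply Rabs_le, Hc).
  pose proof (Rabs_pos (c x)). pose proof (Rabs_pos (fJ nu x)). nra.
Qed.

(** Up to O(1/x) the three-term relation says that order nu - 2 is minus order nu, so lowering the
    order turns the pair by a quarter period, as does [theta]. *)
Lemma fJ_phase_pred (nu : R) : fJ_phase nu -> fJ_phase (nu - 1).
Proof.
  intros [L1 L2].
  assert (Et : theta (nu - 1) = theta nu - PI / 2) by (unfold theta; field).
  destruct (fJ_times_bounded (nu - 1) sin SIN_bound) as [M1 HM1].
  destruct (fJ_times_bounded (nu - 1) cos COS_bound) as [M2 HM2].
  split.
  - replace (amplitude * cos (theta (nu - 1))) with (amplitude * sin (theta nu) - 0).
    + apply (is_lim_ext_loc (fun x => fJ nu x * sin x + fJ (nu - 1) x * cos x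
         - 2 * (nu - 1) / x * (fJ (nu - 1) x * sin x))).
      * exists 0; intros x Hx; rewrite (fJ_three_term (nu - 1)) by exact Hx.
        replace (nu - 1 + 1) with nu by ring; ring.
      * apply (is_lim_minus' _ _ p_infty (amplitude * sin (theta nu)) 0); [exact L2|].
        apply (is_lim_bounded_div (fun x => fJ (nu - 1) x * sin x) M1), HM1.
    + rewrite Et, cos_minus, cos_PI2, sin_PI2; ring.
  - replace (amplitude * sin (theta (nu - 1))) with (- (amplitude * cos (theta nu)) + 0).
    + apply (is_lim_ext_loc (fun x => - (fJ nu x * cos x - fJ (nu - 1) x * sin x)
         + 2 * (nu - 1) / x * (fJ (nu - 1) x * cos x))).
      * exists 0; intros x Hx; rewrite (fJ_three_term (nu - 1)) by exact Hx.
        replace (nu - 1 + 1) with nu by ring; ring.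
      * apply (is_lim_plus' _ _ p_infty (- (amplitude * cos (theta nu))) 0).
        -- apply (is_lim_opp _ p_infty (amplitude * cos (theta nu))), L1.
        -- apply (is_lim_bounded_div (fun x => fJ (nu - 1) x * cos x) M2), HM2.
    + rewrite Et, sin_minus, cos_PI2, sin_PI2; ring.
Qed.

Lemma fJ_phase_all (nu : R) : fJ_phase nu.
Proof.
  destruct (INR_unbounded (2 - nu)) as [n Hn].
  assert (H : forall n nu, 2 <= nu + INR n -> fJ_phase nu).
  { induction n0 as [|k IH]; intros y Hy.
    - apply fJ_phase_large; simpl in Hy; lra.
    - rewrite S_INR in Hy.
      replace y with (y + 1 - 1) by ring. apply fJ_phase_pred, IH; lra. }
  apply (H n); lra.
Qed.

Lemma fJ_parts_lim (nu : R) :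
  is_lim (cos_part (fJ nu) (dfJ nu)) p_infty (amplitude * cos (theta nu)) /\
  is_lim (sin_part (fJ nu) (dfJ nu)) p_infty (amplitude * sin (theta nu)).
Proof.
  destruct (fJ_parts_near nu) as [al [be [C [HC [L1 [L2 HB]]]]]].
  destruct (fJ_phase_all nu) as [P1 P2].
  assert (Eal : Finite al = Finite (amplitude * cos (theta nu))).
  { rewrite <- (is_lim_unique _ _ _ P1); symmetry; apply is_lim_unique.
    apply (is_lim_squeeze_div _ _ C); intros x Hx; apply HB, Hx. }
  assert (Ebe : Finite be = Finite (amplitude * sin (theta nu))).
  { rewrite <- (is_lim_unique _ _ _ P2); symmetry; apply is_lim_unique.
    apply (is_lim_squeeze_div _ _ C); intros x Hx; apply HB, Hx. }
  rewrite <- Eal, <- Ebe; split; assumption.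
Qed.

(** * Bessel functions of the second kind *)

Definition fY (nu x : R) : R := sqrt x * weber_quotient x nu.
Definition dfY (nu x : R) : R :=
  (dfJ nu x * cos (nu * PI) - dfJ (- nu) x) / sin (nu * PI).

Lemma fY_J (nu x : R) :
  fY nu x = (fJ nu x * cos (nu * PI) - fJ (- nu) x) / sin (nu * PI).
Proof. unfold fY, fJ, weber_quotient, Rdiv; ring. Qed.

Lemma fY_ode (nu : R) : bessel_ode (nu ^ 2 - / 4) (fY nu) (dfY nu).
Proof.
  intros x Hx.
  destruct (fJ_ode nu x Hx) as [D1 D2], (fJ_ode (- nu) x Hx) as [D3 D4].
  replace ((- nu) ^ 2) with (nu ^ 2) in D4 by ring.
  split.
  - apply (is_derive_ext (fun x => (fJ nu x * cos (nu * PI) - fJ (- nu) x) / sin (nu * PI))).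
    { intros t; symmetry; apply fY_J. }
    auto_derive.
    + repeat split; eexists; eassumption.
    + rewrite (Derive_eta _ _ _ D1), (Derive_eta _ _ _ D3); unfold dfY, Rdiv; ring.
  - unfold dfY at 1; auto_derive.
    + repeat split; eexists; eassumption.
    + rewrite (Derive_eta _ _ _ D2), (Derive_eta _ _ _ D4), fY_J; unfold Rdiv; ring.
Qed.

(** Since theta(-nu) = theta(nu) - nu pi, the addition formulas produce a factor sin(nu pi) that
    cancels the denominator. The limits are thus continuous in nu across the integers, which is what
    the integer case rests on. *)
Lemma fY_parts_lim (nu : R) : sin (nu * PI) <> 0 ->
  is_lim (cos_part (fY nu) (dfY nu)) p_infty (- (amplitude * sin (theta nu))) /\
  is_lim (sin_part (fY nu) (dfY nu)) p_infty (amplitude * cos (theta nu)).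
Proof.
  intros Hs.
  destruct (fJ_parts_lim nu) as [L1 L2], (fJ_parts_lim (- nu)) as [L3 L4].
  assert (Et : theta (- nu) = theta nu - nu * PI) by (unfold theta; field).
  rewrite Et in L3, L4.
  set (c := cos (nu * PI)) in *. set (s := sin (nu * PI)) in *.
  split.
  - replace (- (amplitude * sin (theta nu))) with
      ((amplitude * cos (theta nu) * c - amplitude * cos (theta nu - nu * PI)) * / s).
    + apply (is_lim_ext (fun x => (cos_part (fJ nu) (dfJ nu) x * c
                              - cos_part (fJ (- nu)) (dfJ (- nu)) x) * / s)).
      * intros x; unfold cos_part; rewrite fY_J; unfold dfY, c, s, Rdiv; ring.
      * apply (is_lim_scal_r _ (/ s) p_infty
          (amplitude * cos (theta nu) * c - amplitude * cos (theta nu - nu * PI))).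
        apply (is_lim_minus' _ _ p_infty (amplitude * cos (theta nu) * c)
                 (amplitude * cos (theta nu - nu * PI))); [|exact L3].
        apply (is_lim_scal_r _ c p_infty (amplitude * cos (theta nu))), L1.
    + rewrite cos_minus; fold c s; field; exact Hs.
  - replace (amplitude * cos (theta nu)) with
      ((amplitude * sin (theta nu) * c - amplitude * sin (theta nu - nu * PI)) * / s).
    + apply (is_lim_ext (fun x => (sin_part (fJ nu) (dfJ nu) x * c
                              - sin_part (fJ (- nu)) (dfJ (- nu)) x) * / s)).
      * intros x; unfold sin_part; rewrite fY_J; unfold dfY, c, s, Rdiv; ring.
      * apply (is_lim_scal_r _ (/ s) p_infty
          (amplitude * sin (theta nu) * c - amplitude * sin (theta nu - nu * PI))).
        apply (is_lim_minus' _ _ p_infty (amplitude * sin (theta nu) * c)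
                 (amplitude * sin (theta nu - nu * PI))); [|exact L4].
        apply (is_lim_scal_r _ c p_infty (amplitude * sin (theta nu))), L2.
    + rewrite sin_minus; fold c s; field; exact Hs.
Qed.

Lemma energy_parts (f df : R -> R) (x : R) :
  energy f df x = cos_part f df x ^ 2 + sin_part f df x ^ 2.
Proof.
  unfold energy, cos_part, sin_part.
  pose proof (sin2_cos2 x) as H; unfold Rsqr in H.
  transitivity ((f x ^ 2 + df x ^ 2) * (sin x * sin x + cos x * cos x));
    [rewrite H; ring|ring].
Qed.

Lemma energy_lim (f df : R -> R) (al be : R) :
  is_lim (cos_part f df) p_infty al -> is_lim (sin_part f df) p_infty be ->
  is_lim (energy f df) p_infty (al ^ 2 + be ^ 2).
Proof.
  intros H1 H2.
  apply (is_lim_ext (fun x => cos_part f df x * cos_part f df x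
                              + sin_part f df x * sin_part f df x)).
  - intros x; rewrite energy_parts; ring.
  - replace (al ^ 2 + be ^ 2) with (al * al + be * be) by ring.
    apply (is_lim_plus' _ _ p_infty (al * al) (be * be)).
    + apply (is_lim_mult _ _ p_infty al al); [exact H1|exact H1|exact I].
    + apply (is_lim_mult _ _ p_infty be be); [exact H2|exact H2|exact I].
Qed.

Lemma amplitude_sqr : amplitude ^ 2 = 2 / PI.
Proof.
  unfold amplitude. pose proof PI_RGT_0.
  pose proof (sqrt_lt_R0 PI ltac:(lra)).
  pose proof (sqrt_sqrt 2 ltac:(lra)) as E2. pose proof (sqrt_sqrt PI ltac:(lra)) as EP.
  replace ((sqrt 2 / sqrt PI) ^ 2) with ((sqrt 2 * sqrt 2) / (sqrt PI * sqrt PI))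
    by (field; lra).
  rewrite E2, EP; reflexivity.
Qed.

Lemma fY_energy_lim (nu : R) : sin (nu * PI) <> 0 ->
  is_lim (energy (fY nu) (dfY nu)) p_infty (2 / PI).
Proof.
  intros Hs; destruct (fY_parts_lim nu Hs) as [L1 L2].
  pose proof (energy_lim _ _ _ _ L1 L2) as L.
  replace ((- (amplitude * sin (theta nu))) ^ 2 + (amplitude * cos (theta nu)) ^ 2)
    with (2 / PI) in L; [exact L|].
  rewrite <- amplitude_sqr. pose proof (sin2_cos2 (theta nu)) as H; unfold Rsqr in H.
  transitivity (amplitude ^ 2 * (sin (theta nu) * sin (theta nu)
                                 + cos (theta nu) * cos (theta nu)));
    [rewrite H; ring|ring].
Qed.

(** The bounds depend only on |k| and the limit L, hence are uniform along a bounded sequence of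
    orders. *)
Lemma bessel_ode_energy_bounds (k L : R) (f df : R -> R) :
  bessel_ode k f df -> is_lim (energy f df) p_infty L ->
  forall x, 0 < x -> L * exp (- Rabs k / x) <= energy f df x <= L * exp (Rabs k / x).
Proof.
  intros H HL x Hx.
  apply (gronwall_inv_sqr_lim (energy f df) (fun x => 2 * k / x ^ 2 * f x * df x)
           (Rabs k) x L Hx); [| |exact HL|lra].
  - intros t Ht; apply (energy_is_derive k); [exact H|lra].
  - intros t Ht; apply energy_derive_bound; lra.
Qed.

(** The difference h = f - g satisfies h'' = (k1/x^2 - 1) h + (k1 - k2) g/x^2. Adding the constant
    |k1 - k2| M to the energy of h absorbs the forcing term, and the homogeneous Gronwall estimate
    applies. *)
Lemma bessel_ode_compare (k1 k2 M x0 a1 b1 a2 b2 : R) (f df g dg : R -> R) :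
  0 < x0 -> bessel_ode k1 f df -> bessel_ode k2 g dg ->
  (forall x, x0 <= x -> g x ^ 2 <= M) ->
  is_lim (cos_part f df) p_infty a1 -> is_lim (sin_part f df) p_infty b1 ->
  is_lim (cos_part g dg) p_infty a2 -> is_lim (sin_part g dg) p_infty b2 ->
  forall x, x0 <= x ->
  (f x - g x) ^ 2 + (df x - dg x) ^ 2 <=
  ((a1 - a2) ^ 2 + (b1 - b2) ^ 2 + Rabs (k1 - k2) * M)
  * exp ((Rabs k1 + Rabs (k1 - k2) + 1) / x0).
Proof.
  intros H0 Hf Hg HM L1 L2 L3 L4 x Hx.
  set (h := fun x => f x - g x). set (dh := fun x => df x - dg x).
  (* The summands pay for the k1 term, for the derivative's share of the forcing term, and (the 1)
     for the remaining |d| M. *)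
  set (d := k1 - k2). set (kap := Rabs k1 + Rabs d + 1).
  assert (HM0 : 0 <= M) by (specialize (HM x0 (Rle_refl _)); pose proof (pow2_ge_0 (g x0)); lra).
  assert (LE : is_lim (fun x => energy h dh x + Rabs d * M) p_infty
                ((a1 - a2) ^ 2 + (b1 - b2) ^ 2 + Rabs d * M)).
  { apply (is_lim_plus' _ _ p_infty ((a1 - a2) ^ 2 + (b1 - b2) ^ 2)); [|apply is_lim_const].
    apply energy_lim.
    - apply (is_lim_ext (fun x => cos_part f df x - cos_part g dg x)).
      + intros t; unfold cos_part, h, dh; ring.
      + apply (is_lim_minus' _ _ p_infty a1 a2); assumption.
    - apply (is_lim_ext (fun x => sin_part f df x - sin_part g dg x)).
      + intros t; unfold sin_part, h, dh; ring.
      + apply (is_lim_minus' _ _ p_infty b1 b2); assumption. }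
  destruct (gronwall_inv_sqr_lim (fun x => energy h dh x + Rabs d * M)
    (fun x => (2 * k1 * h x * dh x + 2 * d * dh x * g x) / x ^ 2) kap x0
    ((a1 - a2) ^ 2 + (b1 - b2) ^ 2 + Rabs d * M) H0) with (x := x) as [_ G];
    [| |exact LE|exact Hx|].
  - intros t Ht; destruct (Hf t ltac:(lra)) as [D1 D2], (Hg t ltac:(lra)) as [D3 D4].
    unfold energy, h, dh; auto_derive.
    + repeat split; eexists; eassumption.
    + rewrite (Derive_eta _ _ _ D1), (Derive_eta _ _ _ D2), (Derive_eta _ _ _ D3),
        (Derive_eta _ _ _ D4); unfold d; field; lra.
  - intros t Ht. specialize (HM t Ht).
    assert (Hi : 0 < / t ^ 2) by (apply Rinv_0_lt_compat; nra).
    unfold Rdiv; rewrite Rabs_mult, (Rabs_pos_eq (/ t ^ 2)) by lra.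
    rewrite (Rmult_assoc kap), (Rmult_comm (/ t ^ 2)), <- Rmult_assoc.
    apply Rmult_le_compat_r; [lra|].
    unfold energy; set (H := h t); set (K := dh t); set (G := g t) in *.
    assert (B1 : Rabs (2 * k1 * H * K) <= Rabs k1 * (H ^ 2 + K ^ 2)).
    { replace (2 * k1 * H * K) with (k1 * (2 * H * K)) by ring; rewrite Rabs_mult.
      apply Rmult_le_compat_l; [apply Rabs_pos|].
      pose proof (pow2_ge_0 (H - K)); pose proof (pow2_ge_0 (H + K)).
      apply Rabs_le; split; lra. }
    assert (B2 : Rabs (2 * d * K * G) <= Rabs d * (K ^ 2 + G ^ 2)).
    { replace (2 * d * K * G) with (d * (2 * K * G)) by ring; rewrite Rabs_mult.
      apply Rmult_le_compat_l; [apply Rabs_pos|].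
      pose proof (pow2_ge_0 (K - G)); pose proof (pow2_ge_0 (K + G)).
      apply Rabs_le; split; lra. }
    eapply Rle_trans; [apply Rabs_triang|].
    pose proof (Rabs_pos k1); pose proof (Rabs_pos d).
    pose proof (pow2_ge_0 H); pose proof (pow2_ge_0 K).
    assert (B3 : Rabs d * (K ^ 2 + G ^ 2) <= Rabs d * (K ^ 2 + M))
      by (apply Rmult_le_compat_l; lra).
    assert (0 <= Rabs d * H ^ 2) by (apply Rmult_le_pos; lra).
    assert (0 <= (Rabs k1 + Rabs d) * (Rabs d * M))
      by (apply Rmult_le_pos; [lra|apply Rmult_le_pos; lra]).
    unfold kap; nra.
  - pose proof (Rmult_le_pos _ _ (Rabs_pos d) HM0).
    assert (energy h dh x <= ((a1 - a2) ^ 2 + (b1 - b2) ^ 2 + Rabs d * M) * exp (kap / x))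
      by lra.
    change ((f x - g x) ^ 2 + (df x - dg x) ^ 2) with (energy h dh x).
    eapply Rle_trans; [eassumption|].
    apply Rmult_le_compat_l.
    + pose proof (pow2_ge_0 (a1 - a2)); pose proof (pow2_ge_0 (b1 - b2)); lra.
    + assert (Hk : 0 <= kap) by (unfold kap; pose proof (Rabs_pos k1); pose proof (Rabs_pos d); lra).
      apply exp_le, Rmult_le_compat_l; [exact Hk|apply Rinv_le_contravar; lra].
Qed.

(** * Integer order as a limit of non-integer orders *)

(** The sequence by which [Lim] at nu is defined, without its first term: that term would be nu + 1,
    again an integer order with degenerate quotient. *)
Definition order_seq (nu : R) (n : nat) : R := nu + / (INR (S n) + 1).
Definition kseq (nu : R) (n : nat) : R := order_seq nu n ^ 2 - / 4.

Lemma order_seq_lim (nu : R) : is_lim_seq (order_seq nu) nu.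
Proof. exact (proj1 (is_lim_seq_incr_1 _ _) (is_lim_seq_Rbar_loc_seq nu)). Qed.

Lemma order_step (n : nat) : 0 < / (INR (S n) + 1) < 1.
Proof.
  assert (1 < INR (S n) + 1) by (rewrite S_INR; pose proof (pos_INR n); lra).
  split; [apply Rinv_0_lt_compat; lra|].
  rewrite <- Rinv_1; apply Rinv_lt_contravar; lra.
Qed.

Lemma order_seq_sin (nu : R) (n : nat) :
  sin (nu * PI) = 0 -> sin (order_seq nu n * PI) <> 0.
Proof.
  intros H. pose proof PI_RGT_0 as HP.
  unfold order_seq; pose proof (order_step n) as Hd; set (d := / (INR (S n) + 1)) in *.
  rewrite Rmult_plus_distr_r, sin_plus, H, Rmult_0_l, Rplus_0_l.
  apply Rmult_integral_contrapositive_currified.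
  - intros Hc. pose proof (sin2_cos2 (nu * PI)) as E. rewrite H, Hc in E.
    unfold Rsqr in E; lra.
  - apply Rgt_not_eq, sin_gt_0; nra.
Qed.

Lemma order_seq_continuous_lim (nu : R) (f : R -> R) :
  continuity f -> is_lim_seq (fun n => f (order_seq nu n)) (f nu).
Proof.
  intros Hf; apply is_lim_seq_continuous; [apply Hf|apply order_seq_lim].
Qed.

Lemma kseq_lim (nu : R) : is_lim_seq (kseq nu) (nu ^ 2 - / 4).
Proof.
  apply (order_seq_continuous_lim nu (fun x => x ^ 2 - / 4)).
  apply (continuity_of_derive _ (fun x => 2 * x)); intros t; auto_derive; [exact I|ring].
Qed.

Lemma kseq_bound (nu : R) (n : nat) : Rabs (kseq nu n) <= (Rabs nu + 1) ^ 2 + 1.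
Proof.
  unfold kseq, order_seq; pose proof (order_step n) as Hd.
  set (d := / (INR (S n) + 1)) in *.
  assert (Rabs (nu + d) <= Rabs nu + 1).
  { eapply Rle_trans; [apply Rabs_triang|]; rewrite (Rabs_pos_eq d); lra. }
  assert ((nu + d) ^ 2 <= (Rabs nu + 1) ^ 2).
  { rewrite <- (pow2_abs (nu + d)); apply pow_incr; split; [apply Rabs_pos|assumption]. }
  pose proof (pow2_ge_0 (nu + d)). apply Rabs_le; lra.
Qed.

Lemma Rabs_lt_of_sqr (x e : R) : 0 < e -> x ^ 2 < e ^ 2 -> Rabs x < e.
Proof.
  intros He H; rewrite <- (pow2_abs x) in H; pose proof (Rabs_pos x).
  destruct (Rlt_dec (Rabs x) e); [assumption|nra].
Qed.

Lemma Rdiv_le_l (a b x : R) : 0 < x -> a <= b -> a / x <= b / x.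
Proof. intros Hx H; apply Rmult_le_compat_r; [apply Rlt_le, Rinv_0_lt_compat, Hx|exact H]. Qed.

Lemma fY_seq_bound (nu x0 : R) : sin (nu * PI) = 0 -> 0 < x0 ->
  exists M, 0 <= M /\ forall n x, x0 <= x -> fY (order_seq nu n) x ^ 2 <= M.
Proof.
  intros Hs H0. pose proof PI_RGT_0.
  set (K := (Rabs nu + 1) ^ 2 + 1).
  assert (P2 : 0 < 2 / PI) by (apply Rdiv_lt_0_compat; lra).
  exists (2 / PI * exp (K / x0)); split.
  - apply Rmult_le_pos; [lra|apply Rlt_le, exp_pos].
  - intros n x Hx.
    pose proof (bessel_ode_energy_bounds _ _ _ _ (fY_ode (order_seq nu n))
                  (fY_energy_lim _ (order_seq_sin nu n Hs)) x ltac:(lra)) as [_ B].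
    pose proof (kseq_bound nu n) as KB. unfold kseq in KB. fold K in KB.
    assert (E : exp (Rabs (order_seq nu n ^ 2 - / 4) / x) <= exp (K / x0)).
    { apply exp_le; apply Rle_trans with (K / x); [apply Rdiv_le_l; lra|].
      apply Rmult_le_compat_l; [pose proof (Rabs_pos (order_seq nu n ^ 2 - / 4)); lra|].
      apply Rinv_le_contravar; lra. }
    apply (Rmult_le_compat_l (2 / PI)) in E; [|lra].
    unfold energy in B. pose proof (pow2_ge_0 (dfY (order_seq nu n) x)). lra.
Qed.

Lemma is_lim_seq_cauchy (u : nat -> R) (l eta : R) : is_lim_seq u l -> 0 < eta ->
  exists N, forall n m, (N <= n)%nat -> (N <= m)%nat -> Rabs (u n - u m) < eta.
Proof.
  intros Hl He.
  assert (C : ex_lim_seq_cauchy u) by (apply ex_lim_seq_cauchy_corr; exists l; exact Hl).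
  destruct (C (mkposreal eta He)) as [N HN]; exists N; exact HN.
Qed.

Lemma cont_theta : continuity theta.
Proof. unfold theta; auto with cont. Qed.

(** Two members are compared through their data at infinity: the coefficient of 1/x^2 and the two
    limits are continuous in the order, hence Cauchy, and [bessel_ode_compare] carries this to all x
    >= x0 at once. *)
Lemma fY_seq_cauchy (nu x0 eps : R) : sin (nu * PI) = 0 -> 0 < x0 -> 0 < eps ->
  exists N, forall n m x, x0 <= x -> (N <= n)%nat -> (N <= m)%nat ->
    Rabs (fY (order_seq nu n) x - fY (order_seq nu m) x) < eps /\
    Rabs (dfY (order_seq nu n) x - dfY (order_seq nu m) x) < eps.
Proof.
  intros Hs H0 He.
  destruct (fY_seq_bound nu x0 Hs H0) as [M [HM HB]].
  set (K := (Rabs nu + 1) ^ 2 + 1).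
  (* [K] bounds |k1|; the 2 covers |k1 - k2| < 1 and the extra 1 in the Gronwall exponent. *)
  set (X := exp ((K + 2) / x0)).
  assert (PX : 0 < X) by apply exp_pos.
  (* The three errors total at most eta (2 + M); 3 + M leaves room for a strict inequality. The
     minimum with 1 gives y^2 <= eta from |y| < eta. *)
  set (eta := Rmin 1 (eps ^ 2 / ((3 + M) * X))).
  assert (Heta : 0 < eta).
  { apply Rmin_pos; [lra|apply Rdiv_lt_0_compat; nra]. }
  assert (Ce : continuity (fun x => - (amplitude * sin (theta x)))).
  { apply cont_opp, (cont_mult (fun _ => amplitude)); [auto with cont|].
    apply (cont_comp sin theta); [auto with cont|exact cont_theta]. }
  assert (Cf : continuity (fun x => amplitude * cos (theta x))).
  { apply (cont_mult (fun _ => amplitude)); [auto with cont|].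
    apply (cont_comp cos theta); [auto with cont|exact cont_theta]. }
  destruct (is_lim_seq_cauchy _ _ eta (kseq_lim nu) Heta) as [N1 HN1].
  destruct (is_lim_seq_cauchy _ _ eta (order_seq_continuous_lim nu _ Ce) Heta) as [N2 HN2].
  destruct (is_lim_seq_cauchy _ _ eta (order_seq_continuous_lim nu _ Cf) Heta) as [N3 HN3].
  exists (N1 + N2 + N3)%nat; intros n m x Hx Hn Hm.
  specialize (HN1 n m ltac:(lia) ltac:(lia)).
  specialize (HN2 n m ltac:(lia) ltac:(lia)).
  specialize (HN3 n m ltac:(lia) ltac:(lia)).
  destruct (fY_parts_lim _ (order_seq_sin nu n Hs)) as [L1 L2].
  destruct (fY_parts_lim _ (order_seq_sin nu m Hs)) as [L3 L4].
  pose proof (bessel_ode_compare _ _ M x0 _ _ _ _ _ _ _ _ H0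
     (fY_ode (order_seq nu n)) (fY_ode (order_seq nu m)) (HB m) L1 L2 L3 L4 x Hx) as G.
  fold (kseq nu n) (kseq nu m) in G.
  pose proof (Rmin_l 1 (eps ^ 2 / ((3 + M) * X))) as E1.
  pose proof (Rmin_r 1 (eps ^ 2 / ((3 + M) * X))) as E2.
  fold eta in E1, E2.
  assert (E3 : eta * ((3 + M) * X) <= eps ^ 2).
  { apply (Rmult_le_compat_r ((3 + M) * X)) in E2; [|nra].
    unfold Rdiv in E2; rewrite Rmult_assoc, Rinv_l, Rmult_1_r in E2 by nra; exact E2. }
  set (da := - (amplitude * sin (theta (order_seq nu n)))
             - - (amplitude * sin (theta (order_seq nu m)))) in *.
  set (db := amplitude * cos (theta (order_seq nu n))
             - amplitude * cos (theta (order_seq nu m))) in *.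
  assert (Sq : forall y, Rabs y < eta -> y ^ 2 <= eta).
  { intros y Hy; rewrite <- pow2_abs; pose proof (Rabs_pos y); nra. }
  pose proof (Sq _ HN2) as S2. pose proof (Sq _ HN3) as S3.
  pose proof (kseq_bound nu n) as KB. fold K in KB.
  assert (EX : exp ((Rabs (kseq nu n) + Rabs (kseq nu n - kseq nu m) + 1) / x0) <= X).
  { apply exp_le, Rdiv_le_l; lra. }
  assert (T : (da ^ 2 + db ^ 2 + Rabs (kseq nu n - kseq nu m) * M)
     * exp ((Rabs (kseq nu n) + Rabs (kseq nu n - kseq nu m) + 1) / x0)
     <= (eta * (2 + M)) * X).
  { apply Rmult_le_compat; [| |nra|exact EX].
    - pose proof (pow2_ge_0 da); pose proof (pow2_ge_0 db).
      pose proof (Rabs_pos (kseq nu n - kseq nu m)); nra.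
    - apply Rlt_le, exp_pos. }
  assert (F : eta * (2 + M) * X < eps ^ 2) by nra.
  set (y1 := fY (order_seq nu n) x - fY (order_seq nu m) x) in *.
  set (y2 := dfY (order_seq nu n) x - dfY (order_seq nu m) x) in *.
  pose proof (pow2_ge_0 y1); pose proof (pow2_ge_0 y2).
  split; apply Rabs_lt_of_sqr; lra.
Qed.

Lemma Derive_fY (mu x : R) : 0 < x -> Derive (fY mu) x = dfY mu x.
Proof. intros Hx; apply is_derive_unique, (fY_ode mu x Hx). Qed.

Lemma Derive_dfY (mu x : R) : 0 < x ->
  Derive (dfY mu) x = ((mu ^ 2 - / 4) / x ^ 2 - 1) * fY mu x.
Proof. intros Hx; apply is_derive_unique, (fY_ode mu x Hx). Qed.

Lemma locally_pos (P : R -> Prop) (x : R) :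
  0 < x -> (forall y, 0 < y -> P y) -> locally x P.
Proof.
  intros Hx H; exists (mkposreal x Hx); intros y Hy.
  change (Rabs (y - x) < x) in Hy; apply Rabs_def2 in Hy; apply H; lra.
Qed.

Lemma is_lim_seq_of_cauchy (u : nat -> R) :
  (forall eps, 0 < eps -> exists N, forall n m, (N <= n)%nat -> (N <= m)%nat ->
     Rabs (u n - u m) < eps) ->
  is_lim_seq u (real (Lim_seq u)).
Proof.
  intros H; apply Lim_seq_correct', ex_lim_seq_cauchy_corr.
  intros eps; destruct (H eps (cond_pos eps)) as [N HN]; exists N; exact HN.
Qed.

Definition fYlim (nu x : R) : R := real (Lim_seq (fun n => fY (order_seq nu n) x)).
Definition dfYlim (nu x : R) : R := real (Lim_seq (fun n => dfY (order_seq nu n) x)).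

Lemma fYlim_correct (nu x : R) : sin (nu * PI) = 0 -> 0 < x ->
  is_lim_seq (fun n => fY (order_seq nu n) x) (fYlim nu x) /\
  is_lim_seq (fun n => dfY (order_seq nu n) x) (dfYlim nu x).
Proof.
  intros Hs Hx; split; apply is_lim_seq_of_cauchy; intros eps He;
    destruct (fY_seq_cauchy nu x eps Hs Hx He) as [N HN]; exists N; intros n m Hn Hm;
    apply (HN n m x (Rle_refl x) Hn Hm).
Qed.

Lemma CVU_dom_fY (nu x0 : R) : sin (nu * PI) = 0 -> 0 < x0 ->
  CVU_dom (fun n => fY (order_seq nu n)) (fun x => x0 < x) /\
  CVU_dom (fun n => dfY (order_seq nu n)) (fun x => x0 < x).
Proof.
  intros Hs H0; split; apply CVU_dom_cauchy; intros eps;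
    destruct (fY_seq_cauchy nu x0 eps Hs H0 (cond_pos eps)) as [N HN]; exists N;
    intros n m x Hx Hn Hm; apply (HN n m x (Rlt_le _ _ Hx) Hn Hm).
Qed.

Lemma CVU_dom_ext_pos (f g : nat -> R -> R) (x0 : R) : 0 < x0 ->
  (forall n x, 0 < x -> f n x = g n x) ->
  CVU_dom g (fun x => x0 < x) -> CVU_dom f (fun x => x0 < x).
Proof.
  intros H0 E H. apply CVU_dom_cauchy. apply CVU_dom_cauchy in H.
  intros eps; destruct (H eps) as [N HN]; exists N; intros n m x Hx Hn Hm.
  rewrite !E by lra; apply HN; assumption.
Qed.

Lemma CVU_dom_ddfY (nu x0 : R) : sin (nu * PI) = 0 -> 0 < x0 ->
  CVU_dom (fun n x => (kseq nu n / x ^ 2 - 1) * fY (order_seq nu n) x) (fun x => x0 < x).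
Proof.
  intros Hs H0.
  destruct (fY_seq_bound nu x0 Hs H0) as [M [HM HB]].
  set (K := (Rabs nu + 1) ^ 2 + 1).
  assert (HK : 0 <= K) by (unfold K; pose proof (pow2_ge_0 (Rabs nu + 1)); lra).
  assert (Hi : 0 < / x0 ^ 2) by (apply Rinv_0_lt_compat; nra).
  set (D := (M + 1) * / x0 ^ 2 + (K * / x0 ^ 2 + 1)).
  assert (HD : 0 < D) by (unfold D; nra).
  apply CVU_dom_cauchy; intros eps.
  assert (Heta : 0 < eps / (2 * D)) by (apply Rdiv_lt_0_compat; [apply cond_pos|lra]).
  destruct (fY_seq_cauchy nu x0 _ Hs H0 Heta) as [N1 HN1].
  destruct (is_lim_seq_cauchy _ _ _ (kseq_lim nu) Heta) as [N2 HN2].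
  exists (N1 + N2)%nat; intros n m x Hx Hn Hm.
  destruct (HN1 n m x ltac:(lra) ltac:(lia) ltac:(lia)) as [B1 _].
  specialize (HN2 n m ltac:(lia) ltac:(lia)).
  specialize (HB n x ltac:(lra)); apply Rabs_le_of_sqr in HB.
  pose proof (kseq_bound nu m) as KB; fold K in KB.
  assert (Hix : 0 < / x ^ 2 <= / x0 ^ 2).
  { split; [apply Rinv_0_lt_compat; nra|apply Rinv_le_contravar; nra]. }
  set (eta := eps / (2 * D)) in *.
  assert (Ee : eta * D < eps).
  { unfold eta; pose proof (cond_pos eps).
    replace (eps / (2 * D) * D) with (eps / 2) by (field; lra); lra. }
  replace ((kseq nu n / x ^ 2 - 1) * fY (order_seq nu n) x
           - (kseq nu m / x ^ 2 - 1) * fY (order_seq nu m) x)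
    with ((kseq nu n - kseq nu m) * / x ^ 2 * fY (order_seq nu n) x
          + (kseq nu m * / x ^ 2 - 1) * (fY (order_seq nu n) x - fY (order_seq nu m) x))
    by (unfold Rdiv; ring).
  eapply Rle_lt_trans; [apply Rabs_triang|]; rewrite !Rabs_mult.
  rewrite (Rabs_pos_eq (/ x ^ 2)) by lra.
  assert (B2 : Rabs (kseq nu m * / x ^ 2 - 1) <= K * / x0 ^ 2 + 1).
  { eapply Rle_trans; [apply (Rabs_triang _ (- (1)))|].
    rewrite Rabs_Ropp, Rabs_R1, Rabs_mult, (Rabs_pos_eq (/ x ^ 2)) by lra.
    apply Rplus_le_compat_r, Rmult_le_compat; try lra; apply Rabs_pos. }
  pose proof (Rabs_pos (kseq nu n - kseq nu m)).
  pose proof (Rabs_pos (fY (order_seq nu n) x)).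
  pose proof (Rabs_pos (fY (order_seq nu n) x - fY (order_seq nu m) x)).
  assert (T1 : Rabs (kseq nu n - kseq nu m) * / x ^ 2 * Rabs (fY (order_seq nu n) x)
          <= eta * / x0 ^ 2 * (M + 1)).
  { apply Rmult_le_compat; [apply Rmult_le_pos; lra|lra| |lra].
    apply Rmult_le_compat; lra. }
  assert (T2 : Rabs (kseq nu m * / x ^ 2 - 1)
          * Rabs (fY (order_seq nu n) x - fY (order_seq nu m) x)
          <= (K * / x0 ^ 2 + 1) * eta).
  { apply Rmult_le_compat; try lra; apply Rabs_pos. }
  replace (eta * D) with (eta * / x0 ^ 2 * (M + 1) + (K * / x0 ^ 2 + 1) * eta) in Ee
    by (unfold D; ring).
  lra.
Qed.

Lemma continuity_pt_ext_pos (f g : R -> R) (x : R) : 0 < x ->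
  (forall y, 0 < y -> f y = g y) -> continuous g x -> continuity_pt f x.
Proof.
  intros Hx E H; apply continuity_pt_filterlim.
  apply (continuous_ext_loc f g x); [|exact H].
  apply locally_pos; [exact Hx|]; intros y Hy; symmetry; apply E, Hy.
Qed.

(** Functions and first derivatives converge uniformly on (x/2, oo), and through the equation so do
    the second derivatives; limit and derivative are then exchanged twice. *)
Lemma fYlim_ode (nu : R) : sin (nu * PI) = 0 ->
  bessel_ode (nu ^ 2 - / 4) (fYlim nu) (dfYlim nu).
Proof.
  intros Hs x Hx.
  assert (H0 : 0 < x / 2) by lra.
  destruct (CVU_dom_fY nu (x / 2) Hs H0) as [U1 U2].
  pose proof (CVU_dom_ddfY nu (x / 2) Hs H0) as U3.
  assert (Op : open (fun y => x / 2 < y)) by apply open_gt.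
  assert (Cn : is_connected (fun y => x / 2 < y)) by (intros a b c; lra).
  split.
  - replace (dfYlim nu x)
      with (real (Lim_seq (fun n => Derive (fY (order_seq nu n)) x))).
    + apply (CVU_Derive (fun n => fY (order_seq nu n)) (fun y => x / 2 < y) Op Cn U1).
      * intros n y Hy; eexists; apply (fY_ode (order_seq nu n)); lra.
      * intros n y Hy; apply (continuity_pt_ext_pos _ (dfY (order_seq nu n))); [lra| |].
        -- intros t Ht; apply Derive_fY, Ht.
        -- apply @ex_derive_continuous; eexists; apply (fY_ode (order_seq nu n)); lra.
      * apply (CVU_dom_ext_pos _ (fun n => dfY (order_seq nu n)) _ H0); [|exact U2].
        intros n y Hy; apply Derive_fY, Hy.
      * lra.
    + unfold dfYlim; f_equal; apply Lim_seq_ext; intros n; apply Derive_fY, Hx.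
  - replace (((nu ^ 2 - / 4) / x ^ 2 - 1) * fYlim nu x)
      with (real (Lim_seq (fun n => Derive (dfY (order_seq nu n)) x))).
    + apply (CVU_Derive (fun n => dfY (order_seq nu n)) (fun y => x / 2 < y) Op Cn U2).
      * intros n y Hy; eexists; apply (fY_ode (order_seq nu n)); lra.
      * intros n y Hy; apply (continuity_pt_ext_pos _
          (fun t => (kseq nu n / t ^ 2 - 1) * fY (order_seq nu n) t)); [lra| |].
        -- intros t Ht; apply Derive_dfY, Ht.
        -- apply @ex_derive_continuous.
           destruct (fY_ode (order_seq nu n) y ltac:(lra)) as [D1 _].
           auto_derive. repeat split; [nra|eexists; exact D1].
      * apply (CVU_dom_ext_pos _
          (fun n y => (kseq nu n / y ^ 2 - 1) * fY (order_seq nu n) y) _ H0); [|exact U3].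
        intros n y Hy; apply Derive_dfY, Hy.
      * lra.
    + rewrite (Lim_seq_ext _ (fun n => (kseq nu n / x ^ 2 - 1) * fY (order_seq nu n) x))
        by (intros n; apply Derive_dfY, Hx).
      destruct (fYlim_correct nu x Hs Hx) as [L1 _].
      rewrite (is_lim_seq_unique _ (((nu ^ 2 - / 4) / x ^ 2 - 1) * fYlim nu x));
        [reflexivity|].
      apply is_lim_seq_mult'; [|exact L1].
      apply is_lim_seq_minus'; [|apply is_lim_seq_const].
      apply (is_lim_seq_scal_r _ (/ x ^ 2) (nu ^ 2 - / 4)), kseq_lim.
Qed.

(** The limits in n and in x are exchanged by a sandwich: the bounds (2/pi) e^(-K/x) and (2/pi)
    e^(K/x) do not depend on n, so they survive n -> oo at fixed x, and both tend to 2/pi. *)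
Lemma fYlim_energy (nu : R) : sin (nu * PI) = 0 ->
  is_lim (energy (fYlim nu) (dfYlim nu)) p_infty (2 / PI).
Proof.
  intros Hs. pose proof PI_RGT_0.
  assert (P2 : 0 < 2 / PI) by (apply Rdiv_lt_0_compat; lra).
  set (K := (Rabs nu + 1) ^ 2 + 1).
  assert (B : forall x, 0 < x ->
    2 / PI * exp (- K / x) <= energy (fYlim nu) (dfYlim nu) x <= 2 / PI * exp (K / x)).
  { intros x Hx. destruct (fYlim_correct nu x Hs Hx) as [L1 L2].
    assert (LE : is_lim_seq (fun n => energy (fY (order_seq nu n)) (dfY (order_seq nu n)) x)
                   (energy (fYlim nu) (dfYlim nu) x)).
    { unfold energy; apply is_lim_seq_plus'.
      - apply (is_lim_seq_continuous (fun y => y ^ 2)); [|exact L1].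
        apply derivable_continuous, derivable_pow.
      - apply (is_lim_seq_continuous (fun y => y ^ 2)); [|exact L2].
        apply derivable_continuous, derivable_pow. }
    assert (G : forall n, 2 / PI * exp (- K / x)
       <= energy (fY (order_seq nu n)) (dfY (order_seq nu n)) x <= 2 / PI * exp (K / x)).
    { intros n.
      pose proof (bessel_ode_energy_bounds _ _ _ _ (fY_ode (order_seq nu n))
                    (fY_energy_lim _ (order_seq_sin nu n Hs)) x Hx) as [B1 B2].
      pose proof (kseq_bound nu n) as KB. unfold kseq in KB. fold K in KB.
      split.
      - eapply Rle_trans; [|exact B1]; apply Rmult_le_compat_l; [lra|].
        apply exp_le, Rdiv_le_l; lra.
      - eapply Rle_trans; [exact B2|]; apply Rmult_le_compat_l; [lra|].
        apply exp_le, Rdiv_le_l; lra. }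
    split; [refine (is_lim_seq_le _ _ _ _ _ (is_lim_seq_const _) LE)
           |refine (is_lim_seq_le _ _ _ _ _ LE (is_lim_seq_const _))]; intros n; apply G. }
  assert (LX : forall c, is_lim (fun x => 2 / PI * exp (c / x)) p_infty (2 / PI)).
  { intros c; replace (Finite (2 / PI)) with (Rbar_mult (2 / PI) 1)
      by (simpl; f_equal; ring).
    apply is_lim_scal_l, is_lim_exp_div_p_infty. }
  apply (is_lim_le_le_loc (fun x => 2 / PI * exp (- K / x)) (fun x => 2 / PI * exp (K / x)));
    [|apply LX|apply LX].
  exists 0; exact B.
Qed.

Definition bessel_omega (nu y : R) : R := sqrt y * bessel_Y nu y.

Lemma bessel_omega_fYlim (nu x : R) : sin (nu * PI) = 0 -> 0 < x ->
  bessel_omega nu x = fYlim nu x.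
Proof.
  intros Hs Hx; unfold bessel_omega, bessel_Y.
  destruct (Req_EM_T (sin (nu * PI)) 0) as [_|n]; [|contradiction].
  destruct (fYlim_correct nu x Hs Hx) as [L _].
  pose proof (sqrt_lt_R0 x Hx) as Hq.
  assert (L2 : is_lim_seq (fun n => weber_quotient x (order_seq nu n)) (/ sqrt x * fYlim nu x)).
  { apply (is_lim_seq_ext (fun n => / sqrt x * fY (order_seq nu n) x)).
    - intros n; unfold fY; field; lra.
    - apply (is_lim_seq_scal_l _ (/ sqrt x) (fYlim nu x)), L. }
  (* Dropping index 0 turns the sequence inside [Lim] into [order_seq]. *)
  unfold Lim. rewrite <- Lim_seq_incr_1.
  change (sqrt x * real (Lim_seq (fun n => weber_quotient x (order_seq nu n))) = fYlim nu x).
  rewrite (is_lim_seq_unique _ _ L2); simpl; field; lra.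
Qed.

Lemma bessel_ode_ext (k : R) (f g df : R -> R) :
  (forall x, 0 < x -> f x = g x) -> bessel_ode k f df -> bessel_ode k g df.
Proof.
  intros E H x Hx; destruct (H x Hx) as [D1 D2]; split.
  - apply (is_derive_ext_loc f); [|exact D1].
    apply locally_pos; assumption.
  - rewrite <- E by exact Hx; exact D2.
Qed.

Lemma bessel_omega_ode (nu : R) : exists domega,
  bessel_ode (nu ^ 2 - / 4) (bessel_omega nu) domega /\
  is_lim (energy (bessel_omega nu) domega) p_infty (2 / PI).
Proof.
  assert (Ext : forall f df, (forall x, 0 < x -> f x = bessel_omega nu x) ->
    bessel_ode (nu ^ 2 - / 4) f df -> is_lim (energy f df) p_infty (2 / PI) ->
    bessel_ode (nu ^ 2 - / 4) (bessel_omega nu) df /\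
    is_lim (energy (bessel_omega nu) df) p_infty (2 / PI)).
  { intros f df E H L; split; [apply (bessel_ode_ext _ f); assumption|].
    apply (is_lim_ext_loc (energy f df)); [|exact L].
    exists 0; intros x Hx; unfold energy; rewrite E by exact Hx; reflexivity. }
  destruct (Req_EM_T (sin (nu * PI)) 0) as [Hs|Hs].
  - exists (dfYlim nu); apply (Ext (fYlim nu)).
    + intros x Hx; symmetry; apply bessel_omega_fYlim; assumption.
    + apply fYlim_ode, Hs.
    + apply fYlim_energy, Hs.
  - exists (dfY nu); apply (Ext (fY nu)).
    + intros x Hx; unfold bessel_omega, bessel_Y.
      destruct (Req_EM_T (sin (nu * PI)) 0); [contradiction|reflexivity].
    + apply fY_ode.
    + apply fY_energy_lim, Hs.
Qed.

(** * Mean square *)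

Lemma exp_minus_1_bound (u : R) : 0 <= u ->
  exp u - 1 <= u * exp u /\ 1 - exp (- u) <= u.
Proof.
  intros Hu; pose proof (exp_ineq1_le (- u)) as H1.
  pose proof (exp_pos u) as P. split; [|lra].
  assert (E : exp u * exp (- u) = 1) by (rewrite <- exp_plus, Rplus_opp_r; apply exp_0).
  apply (Rmult_le_compat_l (exp u)) in H1; lra.
Qed.

Lemma continuous_square_ode (k : R) (f df : R -> R) (x : R) :
  bessel_ode k f df -> 0 < x -> continuous (fun u => f u ^ 2) x.
Proof.
  intros H Hx; destruct (H x Hx) as [D _].
  apply @ex_derive_continuous; auto_derive; eexists; exact D.
Qed.

Lemma RInt_square_is_derive (k : R) (f df : R -> R) (x : R) :
  bessel_ode k f df -> 0 < x ->
  is_derive (fun y => RInt (fun u => f u ^ 2) 1 y) x (f x ^ 2).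
Proof.
  intros H Hx.
  apply (is_derive_RInt (fun u => f u ^ 2) _ 1 x);
    [|apply (continuous_square_ode k f df); assumption].
  apply locally_pos; [exact Hx|]; intros y Hy.
  apply (@RInt_correct R_CompleteNormedModule).
  apply (@ex_RInt_continuous R_CompleteNormedModule); intros z Hz.
  apply (continuous_square_ode k f df); [exact H|].
  assert (0 < Rmin 1 y) by (apply Rmin_pos; lra); lra.
Qed.

(** The equation gives 2 f^2 = (f^2 + f'^2) - (f f')' + k f^2/y^2. The energy is L + O(1/y) and f f'
    is bounded, so the integral of f^2 is (L/2) y + O(ln y). *)
Lemma is_lim_mean_square (k L : R) (f df : R -> R) :
  0 <= k -> 0 <= L -> bessel_ode k f df -> is_lim (energy f df) p_infty L ->
  is_lim (fun y => RInt (fun u => f u ^ 2) 1 y / y) p_infty (L / 2).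
Proof.
  intros Hk HL H Hlim.
  destruct (bessel_ode_bounded k f df 1 H ltac:(lra)) as [M [HM HB]].
  (* The first summand bounds y times the distance of the energy from L, via e^u - 1 <= u e^u at u =
     k/y <= k; the second bounds y times k f^2/y^2. *)
  set (C := L * (k * exp k) + k * (M * M)).
  set (Phi := fun y => RInt (fun u => f u ^ 2) 1 y + / 2 * (f y * df y) - L / 2 * y).
  set (dPhi := fun y => / 2 * (energy f df y - L) + / 2 * (k / y ^ 2 * f y ^ 2)).
  assert (D : forall y, 0 < y -> is_derive Phi y (dPhi y)).
  { intros y Hy; destruct (H y Hy) as [D1 D2].
    pose proof (RInt_square_is_derive k f df y H Hy) as D3.
    set (S := fun y => RInt (fun u => f u ^ 2) 1 y) in *.
    change (is_derive (fun y => S y + / 2 * (f y * df y) - L / 2 * y) y (dPhi y)).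
    auto_derive.
    - repeat split; eexists; eassumption.
    - rewrite (Derive_eta _ _ _ D1), (Derive_eta _ _ _ D2), (Derive_eta _ _ _ D3).
      unfold dPhi, energy; field; lra. }
  assert (Hpos : 0 <= k * exp k) by (apply Rmult_le_pos; [lra|apply Rlt_le, exp_pos]).
  assert (B : forall y, 1 <= y -> Rabs (dPhi y) <= C / y).
  { intros y Hy. assert (Hi : 0 < / y) by (apply Rinv_0_lt_compat; lra).
    assert (Hi1 : / y <= 1) by (rewrite <- Rinv_1; apply Rinv_le_contravar; lra).
    destruct (bessel_ode_energy_bounds k L f df H Hlim y ltac:(lra)) as [E1 E2].
    rewrite (Rabs_pos_eq k) in E1, E2 by lra.
    destruct (exp_minus_1_bound (k / y)) as [X1 X2]; [apply Rmult_le_pos; lra|].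
    replace (- (k / y)) with (- k / y) in X2 by (field; lra).
    assert (X3 : exp (k / y) <= exp k).
    { apply exp_le; unfold Rdiv; nra. }
    assert (X4 : k / y * exp (k / y) <= k * exp k * / y).
    { unfold Rdiv. replace (k * exp k * / y) with (k * / y * exp k) by ring.
      apply Rmult_le_compat_l; [apply Rmult_le_pos; lra|exact X3]. }
    assert (X5 : k / y <= k * exp k * / y).
    { unfold Rdiv; apply Rmult_le_compat_r; [lra|].
      pose proof (exp_ineq1_le k); nra. }
    assert (A1 : Rabs (energy f df y - L) <= L * (k * exp k) * / y).
    { rewrite Rmult_assoc; apply Rabs_le; split.
      - assert (L * (1 - exp (- k / y)) <= L * (k * exp k * / y))
          by (apply Rmult_le_compat_l; lra). lra.
      - assert (L * (exp (k / y) - 1) <= L * (k * exp k * / y))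
          by (apply Rmult_le_compat_l; lra). lra. }
    assert (A2 : Rabs (k / y ^ 2 * f y ^ 2) <= k * (M * M) * / y).
    { destruct (HB y Hy) as [F1 _].
      assert (F2 : 0 <= f y ^ 2 <= M * M).
      { split; [apply pow2_ge_0|]. rewrite <- pow2_abs.
        pose proof (Rabs_pos (f y)); nra. }
      assert (I2 : 0 < / y ^ 2 <= / y).
      { split; [apply Rinv_0_lt_compat; nra|apply Rinv_le_contravar; nra]. }
      rewrite Rabs_pos_eq.
      - unfold Rdiv. replace (k * / y ^ 2 * f y ^ 2) with (k * f y ^ 2 * / y ^ 2) by ring.
        apply Rmult_le_compat; [apply Rmult_le_pos; lra|lra| |lra].
        apply Rmult_le_compat_l; lra.
      - apply Rmult_le_pos; [apply Rmult_le_pos; lra|lra]. }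
    unfold dPhi, C, Rdiv in *.
    eapply Rle_trans; [apply Rabs_triang|].
    rewrite !(Rabs_mult (/ 2)), (Rabs_pos_eq (/ 2)) by lra.
    pose proof (Rabs_pos (energy f df y - L)).
    pose proof (Rabs_pos (k * / y ^ 2 * f y ^ 2)). lra. }
  assert (G : forall y, 1 <= y -> Rabs (Phi y - Phi 1) <= C * ln y).
  { intros y Hy; apply Rabs_le; split.
    - assert (Phi 1 + C * ln 1 <= Phi y + C * ln y); [|rewrite ln_1 in *; lra].
      apply (nondecreasing_of_derive (fun y => Phi y + C * ln y)
               (fun y => dPhi y + C / y)); [exact Hy| |].
      + intros t Ht; pose proof (D t ltac:(lra)) as Dt; auto_derive.
        * split; [eexists; exact Dt|split; [lra|exact I]].
        * rewrite (Derive_eta _ _ _ Dt); field; lra.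
      + intros t Ht; specialize (B t ltac:(lra)); apply Rabs_le_between in B; lra.
    - assert (C * ln 1 - Phi 1 <= C * ln y - Phi y); [|rewrite ln_1 in *; lra].
      apply (nondecreasing_of_derive (fun y => C * ln y - Phi y)
               (fun y => C / y - dPhi y)); [exact Hy| |].
      + intros t Ht; pose proof (D t ltac:(lra)) as Dt; auto_derive.
        * split; [lra|split; [eexists; exact Dt|exact I]].
        * rewrite (Derive_eta _ _ _ Dt); field; lra.
      + intros t Ht; specialize (B t ltac:(lra)); apply Rabs_le_between in B; lra. }
  assert (L1 : is_lim (fun y => (Phi y - Phi 1) / y) p_infty 0).
  { assert (LL : is_lim (fun y => C * (ln y / y)) p_infty 0).
    { replace (Finite 0) with (Rbar_mult C 0) by (simpl; f_equal; ring).
      apply is_lim_scal_l, is_lim_div_ln_p. }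
    apply (is_lim_le_le_loc (fun y => - (C * (ln y / y))) (fun y => C * (ln y / y))).
    - exists 1; intros y Hy; specialize (G y ltac:(lra)); apply Rabs_le_between in G.
      assert (Hi : 0 < / y) by (apply Rinv_0_lt_compat; lra).
      unfold Rdiv; split; nra.
    - replace (Finite 0) with (Rbar_opp 0) by (simpl; f_equal; ring).
      apply is_lim_opp, LL.
    - exact LL. }
  assert (L2 : is_lim (fun y => / 2 / y * (f y * df y)) p_infty 0).
  { apply (is_lim_bounded_div _ (M * M)); intros y Hy; destruct (HB y Hy) as [F1 F2].
    rewrite Rabs_mult; apply Rmult_le_compat; auto using Rabs_pos. }
  pose proof (is_lim_div_p_infty (Phi 1)) as L3.
  apply (is_lim_ext_loc (fun y => (Phi y - Phi 1) / y - / 2 / y * (f y * df y)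
                                  + Phi 1 / y + L / 2)).
  - exists 0; intros y Hy.
    transitivity ((Phi y - / 2 * (f y * df y) + L / 2 * y) / y); [field; lra|].
    unfold Phi; f_equal; eqR; ring.
  - replace (Finite (L / 2)) with (Finite (0 - 0 + 0 + L / 2)) by (f_equal; ring).
    apply (is_lim_plus' _ _ p_infty (0 - 0 + 0) (L / 2)); [|apply is_lim_const].
    apply (is_lim_plus' _ _ p_infty (0 - 0) 0); [|exact L3].
    apply (is_lim_minus' _ _ p_infty 0 0); assumption.
Qed.

(** * Inversion of a monotone change of variable with critical points *)

(** The slope [q] of f at g y, extended by l, is continuous and nonzero at 0. The difference
    quotient of g is 1/q at the increment of g, which is nonzero because f undoes g and small
    because g is continuous at y. *)
Lemma is_derive_inverse (f g : R -> R) (y l : R) :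
  l <> 0 -> is_derive f (g y) l -> continuous g y ->
  locally y (fun z => f (g z) = z) -> is_derive g y (/ l).
Proof.
  intros Hl Hf Hg [r Hr].
  assert (Ey : f (g y) = y) by (apply Hr, ball_center).
  apply is_derive_Reals in Hf.
  apply is_derive_Reals; intros eps He.
  set (q := fun d => if Req_EM_T d 0 then l else (f (g y + d) - f (g y)) / d).
  assert (Cq : continuity_pt (fun d => / q d) 0).
  { apply (continuity_pt_inv q).
    - intros e Hpe; destruct (Hf e Hpe) as [d Hd].
      exists d; split; [apply cond_pos|]; intros x [_ Hx].
      simpl in *; unfold Rdist in *; rewrite Rminus_0_r in Hx.
      unfold q at 2; destruct (Req_EM_T 0 0); [|contradiction].
      unfold q; destruct (Req_EM_T x 0); [rewrite Rminus_diag, Rabs_R0; exact Hpe|].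
      apply Hd; assumption.
    - unfold q; destruct (Req_EM_T 0 0); [exact Hl|contradiction]. }
  destruct (Cq eps He) as [a [Ha HA]].
  apply continuity_pt_filterlim in Hg.
  destruct (Hg a Ha) as [b [Hb HBb]].
  assert (Hm : 0 < Rmin b r) by (apply Rmin_pos; [exact Hb|apply cond_pos]).
  exists (mkposreal _ Hm); intros h Hh0 Hh; simpl in Hh.
  pose proof (Rmin_l b r). pose proof (Rmin_r b r).
  assert (Eh : f (g (y + h)) = y + h).
  { apply Hr; change (Rabs (y + h - y) < r). replace (y + h - y) with h by ring; lra. }
  set (d := g (y + h) - g y) in *.
  assert (Hd0 : d <> 0).
  { intros E; apply Hh0. assert (E' : g (y + h) = g y) by (unfold d in E; lra).
    rewrite E' in Eh; lra. }
  assert (Hda : Rabs d < a).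
  { apply HBb; split.
    - split; [exact I|intros E; apply Hh0; lra].
    - simpl; unfold Rdist; replace (y + h - y) with h by ring; lra. }
  assert (Q : q d = h / d).
  { unfold q; destruct (Req_EM_T d 0); [contradiction|].
    replace (g y + d) with (g (y + h)) by (unfold d; ring).
    rewrite Eh, Ey; f_equal; ring. }
  assert (Q0 : q 0 = l) by (unfold q; destruct (Req_EM_T 0 0); [reflexivity|contradiction]).
  assert (T : Rabs (/ q d - / q 0) < eps).
  { apply HA; split.
    - split; [exact I|auto].
    - simpl; unfold Rdist; rewrite Rminus_0_r; exact Hda. }
  rewrite Q, Q0 in T.
  replace (d / h) with (/ (h / d)) by (field; split; assumption); exact T.
Qed.

(* The change of variable [dX/dtau = w^2/r0] may have isolated critical points, at the
   zeros of [w]; it is inverted by choice and only used where [w <> 0]. *)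
Definition inverse_var (X : R -> R) (x : R) : R :=
  epsilon (inhabits 0) (fun tau => 0 < tau /\ X tau = x).

Lemma inverse_var_spec (X : R -> R) (tau : R) : 0 < tau ->
  0 < inverse_var X (X tau) /\ X (inverse_var X (X tau)) = X tau.
Proof.
  intros H; apply (epsilon_spec (inhabits 0) (fun t => 0 < t /\ X t = X tau)).
  exists tau; split; [exact H|reflexivity].
Qed.

Definition var_change (r0 : R) (w X : R -> R) : Prop :=
  0 < r0 /\ (forall tau, 0 < tau -> is_derive X tau (w tau ^ 2 / r0)) /\
  (forall tau, 0 < tau -> continuous w tau).

Lemma var_change_monotone (r0 : R) (w X : R -> R) (a b : R) :
  var_change r0 w X -> 0 < a -> a <= b -> X a <= X b.
Proof.
  intros [Hr [HX _]] Ha Hab.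
  apply (nondecreasing_of_derive X (fun t => w t ^ 2 / r0)); [exact Hab| |].
  - intros t Ht; apply HX; lra.
  - intros t Ht; apply Rmult_le_pos; [apply pow2_ge_0|apply Rlt_le, Rinv_0_lt_compat, Hr].
Qed.

Lemma var_change_strict (r0 : R) (w X : R -> R) (a b : R) :
  var_change r0 w X -> 0 < a -> a < b -> (forall t, a <= t <= b -> w t <> 0) -> X a < X b.
Proof.
  intros [Hr [HX _]] Ha Hab Hw.
  destruct (MVT_gen X a b (fun t => w t ^ 2 / r0)) as [c [Hc E]].
  - intros t Ht; rewrite Rmin_left in Ht by lra; apply HX; lra.
  - intros t Ht; rewrite Rmin_left in Ht by lra.
    apply continuity_pt_filterlim, @ex_derive_continuous; eexists; apply HX; lra.
  - rewrite Rmin_left, Rmax_right in Hc by lra.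
    specialize (Hw c Hc).
    assert (0 < w c ^ 2) by nra.
    assert (0 < w c ^ 2 / r0) by (apply Rdiv_lt_0_compat; lra). nra.
Qed.

Lemma var_change_interval (r0 : R) (w X : R -> R) (tau eps : R) :
  var_change r0 w X -> 0 < tau -> w tau <> 0 -> 0 < eps ->
  exists d, 0 < d /\ d < eps /\ d < tau /\
    forall t, tau - d <= t <= tau + d -> w t <> 0.
Proof.
  intros [_ [_ Hc]] Ht Hw He; specialize (Hc tau Ht).
  apply continuity_pt_filterlim in Hc.
  destruct (Hc (Rabs (w tau)) (Rabs_pos_lt _ Hw)) as [a [Ha H]].
  exists (Rmin (Rmin a eps) tau / 2).
  assert (P : 0 < Rmin (Rmin a eps) tau) by (repeat apply Rmin_pos; assumption).
  pose proof (Rmin_l (Rmin a eps) tau). pose proof (Rmin_r (Rmin a eps) tau).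
  pose proof (Rmin_l a eps). pose proof (Rmin_r a eps).
  repeat split; try lra.
  intros t Htt E.
  destruct (Req_dec tau t) as [<-|Hne]; [contradiction|].
  assert (Rabs (w t - w tau) < Rabs (w tau)).
  { apply H; split; [split; [exact I|exact Hne]|].
    simpl; unfold Rdist; apply Rabs_def1; lra. }
  rewrite E, Rminus_0_l, Rabs_Ropp in *; lra.
Qed.

(** X is a priori only weakly monotone, but w tau <> 0 makes it strict on an interval around tau,
    which separates X tau from the values at all other points. *)
Lemma var_change_inj (r0 : R) (w X : R -> R) (tau t : R) :
  var_change r0 w X -> 0 < tau -> 0 < t -> w tau <> 0 -> X t = X tau -> t = tau.
Proof.
  intros V Ht0 Ht Hw E.
  destruct (Rtotal_order t tau) as [Hlt|[Heq|Hgt]]; [exfalso|exact Heq|exfalso].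
  - destruct (var_change_interval r0 w X tau (tau - t) V Ht0 Hw ltac:(lra))
      as [d [D1 [D2 [D3 D4]]]].
    assert (X t <= X (tau - d)) by (apply (var_change_monotone r0 w); auto; lra).
    assert (X (tau - d) < X tau); [|lra].
    apply (var_change_strict r0 w); auto; try lra. intros z Hz; apply D4; lra.
  - destruct (var_change_interval r0 w X tau (t - tau) V Ht0 Hw ltac:(lra))
      as [d [D1 [D2 [D3 D4]]]].
    assert (X (tau + d) <= X t) by (apply (var_change_monotone r0 w); auto; lra).
    assert (X tau < X (tau + d)); [|lra].
    apply (var_change_strict r0 w); auto; try lra. intros z Hz; apply D4; lra.
Qed.

Lemma inverse_var_left (r0 : R) (w X : R -> R) (tau : R) :
  var_change r0 w X -> 0 < tau -> w tau <> 0 -> inverse_var X (X tau) = tau.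
Proof.
  intros V Ht Hw; destruct (inverse_var_spec X tau Ht) as [P E].
  apply (var_change_inj r0 w X); assumption.
Qed.

(** At a zero of w the chosen preimage might be another point, but w vanishes there as well:
    otherwise injectivity would identify the two. Thus p is the right function of x at every tau,
    zeros included. *)
Lemma inverse_var_w (r0 : R) (w X : R -> R) (tau : R) :
  var_change r0 w X -> 0 < tau -> w (inverse_var X (X tau)) = w tau.
Proof.
  intros V Ht; destruct (Req_dec (w tau) 0) as [H0|H0].
  - destruct (inverse_var_spec X tau Ht) as [P E].
    destruct (Req_dec (w (inverse_var X (X tau))) 0) as [H1|H1]; [lra|].
    f_equal; symmetry; apply (var_change_inj r0 w X); auto.
  - rewrite (inverse_var_left r0 w); auto.
Qed.

(** Points on either side of tau have X-values strictly around X tau; the intermediate value theorem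
    puts a preimage of each nearby x between them, and injectivity makes it the chosen one. This
    contains the continuity of the inverse. *)
Lemma inverse_var_near (r0 : R) (w X : R -> R) (tau eps : R) :
  var_change r0 w X -> 0 < tau -> w tau <> 0 -> 0 < eps ->
  locally (X tau) (fun x => 0 < inverse_var X x /\ X (inverse_var X x) = x /\
     w (inverse_var X x) <> 0 /\ Rabs (inverse_var X x - tau) < eps).
Proof.
  intros V Ht Hw He.
  destruct (var_change_interval r0 w X tau eps V Ht Hw He) as [d [D1 [D2 [D3 D4]]]].
  assert (S1 : X (tau - d) < X tau).
  { apply (var_change_strict r0 w); auto; try lra. intros z Hz; apply D4; lra. }
  assert (S2 : X tau < X (tau + d)).
  { apply (var_change_strict r0 w); auto; try lra. intros z Hz; apply D4; lra. }
  assert (P : 0 < Rmin (X tau - X (tau - d)) (X (tau + d) - X tau))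
    by (apply Rmin_pos; lra).
  exists (mkposreal _ P); intros x Hx.
  change (Rabs (x - X tau) < Rmin (X tau - X (tau - d)) (X (tau + d) - X tau)) in Hx.
  apply Rabs_def2 in Hx.
  pose proof (Rmin_l (X tau - X (tau - d)) (X (tau + d) - X tau)).
  pose proof (Rmin_r (X tau - X (tau - d)) (X (tau + d) - X tau)).
  destruct (Ranalysis5.IVT_interv (fun t => X t - x) (tau - d) (tau + d)) as [t [Htt E]];
    try lra.
  - intros a Ha. destruct V as [_ [HX _]].
    apply continuity_pt_minus.
    + apply continuity_pt_filterlim, @ex_derive_continuous; eexists; apply HX; lra.
    + apply continuity_pt_const; intros u v; reflexivity.
  - assert (Ex : x = X t) by lra. subst x.
    rewrite (inverse_var_left r0 w) by (auto; lra).
    repeat split; try lra; [apply D4; lra|apply Rabs_def1; lra].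
Qed.

Lemma inverse_var_is_derive (r0 : R) (w X : R -> R) (tau : R) :
  var_change r0 w X -> 0 < tau -> w tau <> 0 ->
  is_derive (inverse_var X) (X tau) (r0 / w tau ^ 2).
Proof.
  intros V Ht Hw. destruct (V) as [Hr [HX _]].
  pose proof (inverse_var_left r0 w X tau V Ht Hw) as E.
  replace (r0 / w tau ^ 2) with (/ (w tau ^ 2 / r0)) by (field; split; [exact Hw|lra]).
  apply (is_derive_inverse X).
  - assert (0 < w tau ^ 2) by nra. apply Rgt_not_eq, Rdiv_lt_0_compat; lra.
  - rewrite E; apply HX, Ht.
  - intros Q [eps HQ].
    destruct (inverse_var_near r0 w X tau eps V Ht Hw (cond_pos eps)) as [d Hd].
    exists d; intros y Hy; apply HQ; rewrite E. apply (Hd y Hy).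
  - destruct (inverse_var_near r0 w X tau 1 V Ht Hw ltac:(lra)) as [d Hd].
    exists d; intros y Hy; apply (Hd y Hy).
Qed.

(** * Liouville transformation *)

Definition liouville_problem (m q0 r0 : R) (w X : R -> R) : sl_problem :=
  SL (fun x => w (inverse_var X x) ^ 4 / r0) (fun _ => q0) (fun _ => r0)
     (X m) (X (PI + m)) (w m ^ 2) (w (PI + m) ^ 2).

Definition liouville_data (k q0 r0 : R) (w dw X : R -> R) : Prop :=
  0 < r0 /\
  (forall tau, 0 < tau -> is_derive w tau (dw tau)) /\
  (forall tau, 0 < tau -> is_derive dw tau ((k / tau ^ 2 - q0 / r0) * w tau)) /\
  (forall tau, 0 < tau -> is_derive X tau (w tau ^ 2 / r0)).

Lemma liouville_var_change (k q0 r0 : R) (w dw X : R -> R) :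
  liouville_data k q0 r0 w dw X -> var_change r0 w X.
Proof.
  intros [Hr [H1 [H2 H3]]]; split; [exact Hr|split; [exact H3|]].
  intros tau Ht; apply @ex_derive_continuous; eexists; apply H1, Ht.
Qed.

Lemma locally_shift (P : R -> Prop) (c x : R) :
  locally x P -> locally (x - c) (fun t => P (t + c)).
Proof.
  intros [d Hd]; exists d; intros t Ht; apply Hd.
  change (Rabs (t - (x - c)) < d) in Ht. change (Rabs (t + c - x) < d).
  replace (t + c - x) with (t - (x - c)) by ring; exact Ht.
Qed.

Lemma locally_pull (P : R -> Prop) (g : R -> R) (x : R) :
  continuous g x -> locally (g x) P -> locally x (fun y => P (g y)).
Proof. intros Hg HP; exact (Hg P HP). Qed.

Lemma locally_interval (a b x : R) : a < x < b -> locally x (fun y => a < y < b).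
Proof.
  intros H; assert (P : 0 < Rmin (x - a) (b - x)) by (apply Rmin_pos; lra).
  exists (mkposreal _ P); intros y Hy.
  change (Rabs (y - x) < Rmin (x - a) (b - x)) in Hy; apply Rabs_def2 in Hy.
  pose proof (Rmin_l (x - a) (b - x)). pose proof (Rmin_r (x - a) (b - x)). lra.
Qed.

Lemma locally_nonzero (w : R -> R) (x : R) :
  continuous w x -> w x <> 0 -> locally x (fun y => w y <> 0).
Proof.
  intros Hc Hx; apply (Hc (fun v => v <> 0)).
  exists (mkposreal _ (Rabs_pos_lt _ Hx)); intros v Hv E.
  change (Rabs (v - w x) < Rabs (w x)) in Hv.
  rewrite E, Rminus_0_l, Rabs_Ropp in Hv; lra.
Qed.

(** The flux p u_x, as a function of tau, is the Wronskian Z = w v' - w' v, so Z' = w v'' - w'' v.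
    The equations for v and w cancel k/tau^2 and leave Z' = (q0/r0 - lam) w v, which dx/dtau =
    w^2/r0 turns into the equation for u. *)
Lemma liouville_forward (k m q0 r0 lam tau : R) (w dw X v u : R -> R) :
  0 < m -> liouville_data k q0 r0 w dw X ->
  (forall t, m <= t <= PI + m -> w t <> 0 -> u (X t) = / w t * v (t - m)) ->
  m < tau < PI + m -> w tau <> 0 ->
  sl_equation (normal_form k m) lam v (tau - m) ->
  sl_equation (liouville_problem m q0 r0 w X) lam u (X tau).
Proof.
  intros Hm LD Hu Ht Hw [Lv [Dv Ev]].
  pose proof (liouville_var_change _ _ _ _ _ _ LD) as V.
  destruct LD as [Hr [D1 [D2 D3]]].
  cbn [sl_p sl_q sl_r normal_form] in Lv, Dv, Ev.
  set (Z := fun t => Derive v (t - m) * w t - v (t - m) * dw t).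
  pose proof (inverse_var_is_derive r0 w X tau V ltac:(lra) Hw) as DI0.
  pose proof (inverse_var_left r0 w X tau V ltac:(lra) Hw) as Einv.
  assert (CI : continuous (inverse_var X) (X tau))
    by (apply @ex_derive_continuous; eexists; exact DI0).
  assert (N : locally (X tau) (fun x =>
     (m < inverse_var X x < PI + m /\ w (inverse_var X x) <> 0 /\
      X (inverse_var X x) = x) /\ ex_derive v (inverse_var X x - m))).
  { apply filter_and.
    - pose proof (inverse_var_near r0 w X tau (Rmin (tau - m) (PI + m - tau)) V
        ltac:(lra) Hw ltac:(apply Rmin_pos; lra)) as [d Hd].
      exists d; intros x Hx; destruct (Hd x Hx) as [P1 [P2 [P3 P4]]].
      pose proof (Rmin_l (tau - m) (PI + m - tau)).
      pose proof (Rmin_r (tau - m) (PI + m - tau)).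
      apply Rabs_def2 in P4; repeat split; try lra; assumption.
    - apply (locally_pull (fun t => ex_derive v (t - m)) (inverse_var X)); [exact CI|].
      rewrite Einv. apply (locally_pull (fun t => ex_derive v t) (fun t => t - m)).
      + apply @ex_derive_continuous; auto_derive; exact I.
      + exact Lv. }
  (* A whole neighbourhood is needed, because the flux formed with [Derive u] is differentiated once
     more. *)
  assert (DU : locally (X tau) (fun x =>
     is_derive u x (r0 / w (inverse_var X x) ^ 4 * Z (inverse_var X x)) /\
     w (inverse_var X x) <> 0)).
  { apply locally_locally in N. destruct N as [d Hd]; exists d; intros x Hx.
    specialize (Hd x Hx).
    pose proof (locally_singleton _ _ Hd) as [[Q1 [Q2 Q3]] Q4].
    split; [|exact Q2].
    apply (is_derive_ext_loc (fun y => / w (inverse_var X y) * v (inverse_var X y - m))).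
    { destruct Hd as [d' Hd']; exists d'; intros y Hy.
      destruct (Hd' y Hy) as [[R1 [R2 R3]] _].
      rewrite <- R3 at 3; symmetry; apply Hu; [lra|exact R2]. }
    pose proof (inverse_var_is_derive r0 w X (inverse_var X x) V ltac:(lra) Q2) as DI; rewrite Q3 in DI.
    pose proof (D1 (inverse_var X x) ltac:(lra)) as Dw.
    destruct Q4 as [dv Dv1].
    unfold Z; rewrite (is_derive_unique v _ _ Dv1).
    set (g := inverse_var X) in *. unfold Rminus in Dv1; unfold Rminus.
    auto_derive.
    - repeat split; try (eexists; eassumption); exact Q2.
    - rewrite (Derive_eta _ _ _ DI), (Derive_eta _ _ _ Dw), (Derive_eta _ _ _ Dv1).
      field; repeat split; try lra; exact Q2. }
  assert (DP : locally (X tau) (fun x =>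
     Z (inverse_var X x) = sl_p (liouville_problem m q0 r0 w X) x * Derive u x)).
  { destruct DU as [d Hd]; exists d; intros x Hx; destruct (Hd x Hx) as [U1 U2].
    rewrite (is_derive_unique u x _ U1); simpl; field; repeat split; (exact U2 || lra). }
  pose proof (locally_singleton _ _ Lv) as [v1 Dv1].
  assert (Dv2 : exists v2, is_derive (Derive v) (tau - m) v2).
  { destruct Dv as [v2 Dv2]; exists v2.
    apply (is_derive_ext (fun y => 1 * Derive v y)); [intros t; apply Rmult_1_l|exact Dv2]. }
  destruct Dv2 as [v2 Dv2].
  assert (Ev2 : Derive (fun y => 1 * Derive v y) (tau - m) = v2).
  { apply is_derive_unique, (is_derive_ext (Derive v)); [intros t; eqR; ring|exact Dv2]. }
  rewrite Ev2 in Ev.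
  assert (DZ : is_derive Z tau (v2 * w tau - v (tau - m) * ((k / tau ^ 2 - q0 / r0) * w tau))).
  { pose proof (D1 tau ltac:(lra)) as Dw. pose proof (D2 tau ltac:(lra)) as Ddw.
    pose proof (is_derive_unique v _ _ Dv1) as Ed.
    unfold Rminus in Dv1, Dv2, Ed.
    unfold Z, Rminus; set (dv := Derive v) in *; auto_derive.
    - repeat split; eexists; eassumption.
    - rewrite (Derive_eta _ _ _ Dv2), (Derive_eta _ _ _ Dw), (Derive_eta _ _ _ Dv1),
        (Derive_eta _ _ _ Ddw), Ed; ring. }
  assert (DPU : is_derive (fun y : R => sl_p (liouville_problem m q0 r0 w X) y * Derive u y)
     (X tau) (r0 / w tau ^ 2 *
       (v2 * w tau - v (tau - m) * ((k / tau ^ 2 - q0 / r0) * w tau)))).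
  { apply (is_derive_ext_loc (fun y => Z (inverse_var X y))); [exact DP|].
    apply (is_derive_comp Z (inverse_var X)); [rewrite Einv; exact DZ|exact DI0]. }
  split; [|split].
  - destruct DU as [d Hd]; exists d; intros x Hx; eexists; apply (Hd x Hx).
  - eexists; exact DPU.
  - rewrite (is_derive_unique _ _ _ DPU). simpl sl_q; simpl sl_r.
    rewrite Hu by (lra || exact Hw).
    replace (tau - m + m) with tau in Ev by ring.
    assert (Ev3 : v2 = k / tau ^ 2 * v (tau - m) - lam * v (tau - m)) by lra.
    rewrite Ev3; field; repeat split; try lra; exact Hw.
Qed.

(** Here the flux [G] = p u_x is what is known to be differentiable, so v' is written as w' u + G/w,
    which follows from v = w u, p = w^4/r0 and dx/dtau = w^2/r0. *)
Lemma liouville_backward (k m q0 r0 lam tau : R) (w dw X v u : R -> R) :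
  0 < m -> liouville_data k q0 r0 w dw X ->
  (forall t, m <= t <= PI + m -> w t <> 0 -> u (X t) = / w t * v (t - m)) ->
  m < tau < PI + m -> w tau <> 0 ->
  sl_equation (liouville_problem m q0 r0 w X) lam u (X tau) ->
  sl_equation (normal_form k m) lam v (tau - m).
Proof.
  intros Hm LD Hu Ht Hw [Lu [Du Eu]].
  pose proof (liouville_var_change _ _ _ _ _ _ LD) as V.
  destruct LD as [Hr [D1 [D2 D3]]].
  set (G := fun y => sl_p (liouville_problem m q0 r0 w X) y * Derive u y) in *.
  assert (CX : continuous X tau) by (apply @ex_derive_continuous; eexists; apply D3; lra).
  assert (Cw : continuous w tau) by (apply V; lra).
  assert (N : locally (tau - m) (fun t =>
     (m < t + m < PI + m /\ w (t + m) <> 0) /\ ex_derive u (X (t + m)))).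
  { apply (locally_shift (fun t => (m < t < PI + m /\ w t <> 0) /\ ex_derive u (X t))).
    apply filter_and; [apply filter_and|].
    - apply locally_interval; lra.
    - apply locally_nonzero; assumption.
    - apply (locally_pull (fun x => ex_derive u x) X); assumption. }
  assert (Ey : forall z : R, z + m - m = z) by (intros; ring).
  assert (DV : locally (tau - m) (fun t =>
     is_derive v t (dw (t + m) * u (X (t + m)) + G (X (t + m)) / w (t + m)))).
  { apply locally_locally in N. destruct N as [d Hd]; exists d; intros t Htt.
    specialize (Hd t Htt).
    pose proof (locally_singleton _ _ Hd) as [[Q1 Q2] [du Q3]].
    apply (is_derive_ext_loc (fun t => w (t + m) * u (X (t + m)))).
    { destruct Hd as [d' Hd']; exists d'; intros y Hy.
      destruct (Hd' y Hy) as [[R1 R2] _].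
      rewrite Hu by (lra || exact R2). rewrite Ey. change R in y.
      eqR; field; exact R2. }
    pose proof (D1 (t + m) ltac:(lra)) as Dw. pose proof (D3 (t + m) ltac:(lra)) as DX.
    unfold G; simpl sl_p.
    rewrite (inverse_var_left r0 w X (t + m) V ltac:(lra) Q2), (is_derive_unique u _ _ Q3).
    auto_derive.
    - repeat split; eexists; eassumption.
    - rewrite (Derive_eta _ _ _ Dw), (Derive_eta _ _ _ DX), (Derive_eta _ _ _ Q3).
      field; repeat split; (exact Q2 || lra). }
  destruct Du as [g DG]. change (is_derive G (X tau) g) in DG.
  pose proof (locally_singleton _ _ Lu) as [u1 Du1].
  assert (EG : G (X tau) = w tau ^ 4 / r0 * u1).
  { unfold G; simpl sl_p.
    rewrite (inverse_var_left r0 w X tau V ltac:(lra) Hw), (is_derive_unique u _ _ Du1).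
    reflexivity. }
  assert (DDV : is_derive (fun t : R => 1 * Derive v t) (tau - m)
     ((k / tau ^ 2 - q0 / r0) * w tau * u (X tau) + g * w tau / r0)).
  { apply (is_derive_ext_loc (fun t =>
        dw (t + m) * u (X (t + m)) + G (X (t + m)) / w (t + m))).
    { destruct DV as [d Hd]; exists d; intros y Hy.
      rewrite (is_derive_unique v y _ (Hd y Hy)); eqR; ring. }
    pose proof (D1 tau ltac:(lra)) as Dw. pose proof (D2 tau ltac:(lra)) as Ddw.
    pose proof (D3 tau ltac:(lra)) as DX.
    set (t := tau - m) in *. assert (E0 : t + m = tau) by (unfold t; ring).
    auto_derive; rewrite ?E0.
    - repeat split; try (eexists; eassumption); exact Hw.
    - rewrite (Derive_eta _ _ _ Dw), (Derive_eta _ _ _ Ddw), (Derive_eta _ _ _ DX),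
        (Derive_eta _ _ _ Du1), (Derive_eta _ _ _ DG), EG.
      field; repeat split; (exact Hw || lra). }
  split; [|split].
  - destruct DV as [d Hd]; exists d; intros t Htt; eexists; apply (Hd t Htt).
  - eexists; exact DDV.
  - cbn [sl_p sl_q sl_r normal_form]; rewrite (is_derive_unique _ _ _ DDV).
    change (- Derive G (X tau) + q0 * u (X tau) = lam * r0 * u (X tau)) in Eu.
    rewrite (is_derive_unique _ _ _ DG) in Eu.
    assert (Ev : v (tau - m) = w tau * u (X tau)).
    { rewrite Hu by (lra || exact Hw). field; exact Hw. }
    rewrite Ev. replace (tau - m + m) with tau by ring.
    assert (Eg : g = q0 * u (X tau) - lam * r0 * u (X tau)) by lra.
    rewrite Eg; field; split; lra.
Qed.

Lemma liouville_canonical_form (k m q0 r0 s x1 : R) (w dw F : R -> R) :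
  0 < m -> liouville_data k q0 r0 w dw (fun tau => - x1 + F (s * tau)) ->
  w m <> 0 -> exact_relation (fun _ => r0) w s F ->
  exact_canonical_form k m (fun _ => q0) (fun _ => r0) w s x1 F
    (liouville_problem m q0 r0 w (fun tau => - x1 + F (s * tau))).
Proof.
  intros Hm LD Hw0 HF.
  set (X := fun tau => - x1 + F (s * tau)) in *.
  pose proof (liouville_var_change _ _ _ _ _ _ LD) as V.
  pose proof PI_RGT_0 as HP.
  destruct (LD) as [Hr [D1 [D2 D3]]].
  assert (DD : forall tau, 0 < tau ->
     is_derive (Derive w) tau ((k / tau ^ 2 - q0 / r0) * w tau)).
  { intros tau Ht; apply (is_derive_ext_loc dw); [|apply D2, Ht].
    apply locally_pos; [exact Ht|]; intros y Hy.
    symmetry; apply is_derive_unique, D1, Hy. }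
  split; [|split; [|split]].
  - split; [|split].
    + intros tau Ht; split; eexists; [apply D1, Ht|apply DD, Ht].
    + exists m; split; assumption.
    + intros tau Ht Hw.
      replace (Derive_n w 2 tau) with ((k / tau ^ 2 - q0 / r0) * w tau)
        by (symmetry; apply (is_derive_unique (Derive w)), DD, Ht).
      field; repeat split; (exact Hw || lra).
  - exact HF.
  - split; [|repeat split].
    intros tau Ht; split; [|split; reflexivity].
    change (w (inverse_var X (X tau)) ^ 4 / r0 = w tau ^ 4 / r0).
    rewrite (inverse_var_w r0 w) by (assumption || lra); reflexivity.
  - intros lam v u Hu.
    change (forall tau, m <= tau <= PI + m -> w tau <> 0 ->
              u (X tau) = / w tau * v (tau - m)) in Hu.
    split; [|split].
    + intros tau Ht Hw; split; intros E.
      * apply (liouville_forward k m q0 r0 lam tau w dw X v u); assumption.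
      * apply (liouville_backward k m q0 r0 lam tau w dw X v u); assumption.
    + intros Hw; unfold sl_bc_lo; cbn [bc_lo sl_lo normal_form liouville_problem].
      rewrite Hu by (lra || exact Hw). replace (m - m) with 0 by ring.
      split; intros E.
      * replace (v 0) with 0 by lra; ring.
      * replace (1 * v 0) with (/ w m * (w m ^ 2 * (/ w m * v 0))) by (field; exact Hw).
        rewrite E; ring.
    + intros Hw; unfold sl_bc_hi; cbn [bc_hi sl_hi normal_form liouville_problem].
      rewrite Hu by (lra || exact Hw). replace (PI + m - m) with PI by ring.
      split; intros E.
      * replace (v PI) with 0 by lra; ring.
      * replace (1 * v PI)
          with (/ w (PI + m) * (w (PI + m) ^ 2 * (/ w (PI + m) * v PI)))
          by (field; exact Hw).
        rewrite E; ring.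
Qed.

(** * The canonical form produced by the Bessel function of the second kind *)

Theorem theorem10 (k m q0 r0 : R)
    (hk : 0 < k) (hm : 0 < m) (hq0 : 0 < q0) (hr0 : 0 < r0) :
  let n := sqrt (4 * k + 1) in
  let s := sqrt (Rabs (q0 / r0)) in
  let Y := bessel_Y (n / 2) in
  let omega := fun tau => sqrt (s * tau) * Y (s * tau) in
  Y (s * m) <> 0 ->
  Y (s * (PI + m)) <> 0 ->
  forall x1 : R,
  let P :=
    {| sl_p := fun x =>
         PI ^ 2 * q0 * (x + x1) ^ 2
           * Y (PI * sqrt (Rabs (q0 * r0)) * (x + x1)) ^ 4;
       sl_q := fun _ => q0;
       sl_r := fun _ => r0;
       sl_lo := - x1 + m / (PI * r0);
       sl_hi := - x1 + (PI + m) / (PI * r0);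
       bc_lo := s * m * Y (s * m) ^ 2;
       bc_hi := s * (PI + m) * Y (s * (PI + m)) ^ 2 |} in
  asymptotic_canonical_form k m (fun _ => q0) (fun _ => r0) omega s x1 P /\
  dirichlet P.
Proof.
  intros n s Y omega Y1 Y2 x1 P.
  pose proof PI_RGT_0 as HP.
  assert (Hqr : 0 < q0 / r0) by (apply Rdiv_lt_0_compat; lra).
  assert (Es2 : s * s = q0 / r0).
  { unfold s; rewrite sqrt_sqrt by apply Rabs_pos; apply Rabs_pos_eq; lra. }
  assert (Hs : 0 < s) by (unfold s; apply sqrt_lt_R0; rewrite Rabs_pos_eq; lra).
  assert (Esr : sqrt (Rabs (q0 * r0)) = s * r0).
  { rewrite Rabs_pos_eq by nra.
    replace (q0 * r0) with ((s * r0) * (s * r0)).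
    - apply sqrt_square; nra.
    - transitivity (s * s * r0 * r0); [ring|rewrite Es2; field; lra]. }
  (* This is what n is chosen for: the equation of sqrt y Y_nu(y) has coefficient nu^2 - 1/4. *)
  assert (Ek : (n / 2) ^ 2 - / 4 = k).
  { replace ((n / 2) ^ 2) with (n * n / 4) by field.
    unfold n; rewrite sqrt_sqrt by lra; field. }
  assert (Eom : forall tau, 0 < tau -> omega tau ^ 2 = s * tau * Y (s * tau) ^ 2).
  { intros tau Ht; unfold omega. rewrite Rpow_mult_distr.
    f_equal; apply pow2_sqrt; nra. }
  set (om := bessel_omega (n / 2)).
  destruct (bessel_omega_ode (n / 2)) as [dom [Hode Hen]].
  fold om in Hode, Hen; rewrite Ek in Hode.
  (* The base point 1 only fixes an additive constant, which does not affect the leading term. In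
     [F] the factor 1/(s r0) accounts for the chain rule in s tau and for the density. *)
  set (Q := fun y => RInt (fun u => om u ^ 2) 1 y).
  set (F := fun y => / (s * r0) * Q y).
  (* The factor 1/(s r0) of [F] times the mean 1/pi of omega^2. *)
  set (c := / (PI * r0 * s)).
  assert (DF : forall tau, 0 < tau ->
    is_derive (fun t => F (s * t)) tau (omega tau ^ 2 / r0)).
  { intros tau Ht.
    pose proof (RInt_square_is_derive k om dom (s * tau) Hode ltac:(nra)) as D.
    change (is_derive Q (s * tau) (om (s * tau) ^ 2)) in D.
    unfold F; auto_derive; [eexists; exact D|].
    rewrite (Derive_eta _ _ _ D).
    change (om (s * tau)) with (omega tau). field; lra. }
  assert (LD : liouville_data k q0 r0 omega (fun tau => s * dom (s * tau))
                 (fun tau => - x1 + F (s * tau))).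
  { split; [exact hr0|split; [|split]]; intros tau Ht.
    - destruct (Hode (s * tau) ltac:(nra)) as [D _].
      change (is_derive (fun tau => om (s * tau)) tau (s * dom (s * tau))).
      auto_derive; [eexists; exact D|]; rewrite (Derive_eta _ _ _ D); ring.
    - destruct (Hode (s * tau) ltac:(nra)) as [_ D].
      auto_derive; [eexists; exact D|]; rewrite (Derive_eta _ _ _ D).
      change (omega tau) with (om (s * tau)); rewrite <- Es2; field; lra.
    - replace (omega tau ^ 2 / r0) with (0 + omega tau ^ 2 / r0) by ring.
      apply (is_derive_plus (fun _ => - x1) (fun tau => F (s * tau))).
      + exact (is_derive_const (- x1) tau).
      + apply DF, Ht. }
  assert (Hom : forall tau, 0 < tau -> Y (s * tau) <> 0 -> omega tau <> 0).
  { intros tau Ht HY; apply Rmult_integral_contrapositive_currified; [|exact HY].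
    apply Rgt_not_eq, sqrt_lt_R0; nra. }
  split.
  - exists F, (liouville_problem m q0 r0 omega (fun tau => - x1 + F (s * tau))), c.
    split; [|split; [|split]].
    + apply (liouville_canonical_form k m q0 r0 s x1 omega (fun tau => s * dom (s * tau)));
        auto.
    + apply Rgt_not_eq, Rinv_0_lt_compat; apply Rmult_lt_0_compat;
        [apply Rmult_lt_0_compat|]; lra.
    + apply (is_lim_ext_loc (fun y => PI * (Q y / y))).
      * exists 0; intros y Hy; unfold F, c; field; repeat split; lra.
      (* 2/pi is the limit of the energy and the division by 2 passes to the mean of omega^2. *)
      * replace (Finite 1) with (Rbar_mult PI (2 / PI / 2)) by (simpl; f_equal; field; lra).
        apply is_lim_scal_l, (is_lim_mean_square k (2 / PI) om dom);
          [lra|apply Rlt_le, Rdiv_lt_0_compat; lra|exact Hode|exact Hen].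
    (* The scale s drops out, which explains the endpoints; pi s r0 times this value is s tau, so
       the argument of Y in p is again the scaled tau. *)
    + assert (Ec : forall tau, c * (s * tau) = tau / (PI * r0))
        by (intros tau; unfold c; field; repeat split; lra).
      split; [|split; [|split; [|split]]].
      * intros tau Ht; split; [|split; reflexivity].
        unfold P; cbn [sl_p]. rewrite Esr, Ec.
        replace (- x1 + tau / (PI * r0) + x1) with (tau / (PI * r0)) by ring.
        replace (PI * (s * r0) * (tau / (PI * r0))) with (s * tau) by (field; lra).
        replace (omega tau ^ 4) with ((omega tau ^ 2) ^ 2) by ring.
        rewrite Eom by lra.
        replace ((s * tau * Y (s * tau) ^ 2) ^ 2)
          with (s * s * tau ^ 2 * Y (s * tau) ^ 4) by ring.
        rewrite Es2; field; lra.
      * unfold P; cbn [sl_lo]; rewrite Ec; reflexivity.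
      * unfold P; cbn [sl_hi]; rewrite Ec; reflexivity.
      * unfold P; cbn [bc_lo]; rewrite Eom by lra; reflexivity.
      * unfold P; cbn [bc_hi]; rewrite Eom by lra; reflexivity.
  - split; unfold P; cbn [bc_lo bc_hi]; rewrite <- Eom by lra;
      apply pow_nonzero, Hom; auto; lra.
Qed.
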